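(* Let $(X,d,\mu)$ be a space of homogeneous type with $\mu(X)=\infty$ and $\mu(\{x_0\})=0$ for every $x_0\in X$. Suppose $w\in A_2$. Then $$\big(H^1_{w,2}(X)\big)'=\mathrm{BMO}_w(X).$$
   Context: A space of homogeneous type $(X,d,\mu)$: $d$ is a quasi-metric on $X$ (symmetric, $d(x,y)=0$ iff $x=y$, $d(x,y)\le A_0[d(x,z)+d(z,y)]$ for some $A_0\ge1$), $\mu$ is a nonzero doubling measure: $\mu(B(x,2r))\le C_\mu\mu(B(x,r))<\infty$ for all balls $B(x,r)=\{y:d(x,y)<r\}$. $w\in A_2$ means $w$ is nonnegative, locally integrable and $\sup_B\big(\frac1{\mu(B)}\int_Bw\,d\mu\big)\big(\frac1{\mu(B)}\int_Bw^{-1}d\mu\big)<\infty$, the supremum over all balls. $w(B)=\int_Bw\,d\mu$; $\|f\|_{L^2_w(B)}=(\int_B|f|^2w\,d\mu)^{1/2}$. A function $a$ is a $(1,2)$-atom if there is a ball $B\subset X$ with $\mathrm{supp}(a)\subset B$, $\int_Ba\,d\mu=0$, $\|a\|_{L^2_w(B)}\le w(B)^{-1/2}$. $H^1_{w,2}(X)$ is the space of $f=\sum_{j\ge1}\lambda_ja_j$ with $\sum_j|\lambda_j|<\infty$ and each $a_j$ a $(1,2)$-atom, with norm $\inf\sum_j|\lambda_j|$ over all such decompositions. $\mathrm{BMO}_w(X)$ is the space of $b\in L^1_{\rm loc}(X)$ with $\|b\|_{\mathrm{BMO}_w(X)}:=\sup_B\frac1{w(B)}\int_B|b-b_B|\,d\mu<\infty$,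 $b_B=\frac1{\mu(B)}\int_Bb\,d\mu$ (functions modulo constants). The prime denotes the dual space (bounded linear functionals). The identification is the usual one: $g\in\mathrm{BMO}_w(X)$ corresponds to the bounded functional $\ell_g$ determined on atoms by $\ell_g(a)=\int_Xa\,g\,d\mu$, with equivalence of norms.
   Formalization: The doubling measure is assumed Borel regular, with open sets and balls measurable (the claim fails on arbitrary sigma-algebras), and the atomic sums defining the Hardy space are taken as functionals, converging against every function of BMO_w (L^1_w or a.e. sums make ℓ_g ill-defined). *)

(* Defs.v *)
From HB Require Import structures.
From mathcomp Require Import all_boot all_order all_algebra.
From mathcomp Require Import all_classical all_reals all_analysis.

Set Implicit Arguments.
Unset Strict Implicit.
Unset Printing Implicit Defensive.
Import Order.TTheory GRing.Theory Num.Theory.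
Import numFieldNormedType.Exports.

Local Open Scope classical_set_scope.
Local Open Scope ring_scope.

Definition quasi_metric (R : realType) (X : Type) (rho : X -> X -> R) : Prop :=
  [/\ (forall x y, 0 <= rho x y),
      (forall x y, rho x y = rho y x),
      (forall x y, rho x y = 0 <-> x = y) &
      exists2 A0 : R, 1 <= A0 &
        forall x y z, rho x y <= A0 * (rho x z + rho z y)].

Definition qball (R : realType) (X : Type) (rho : X -> X -> R) (x : X) (r : R)
  : set X := [set y | rho x y < r].

Definition is_ball (R : realType) (X : Type) (rho : X -> X -> R) (B : set X)
  : Prop := exists x r, 0 < r /\ B = qball rho x r.

Definition qopen (R : realType) (X : Type) (rho : X -> X -> R) (U : set X)
  : Prop := forall x, U x -> exists2 r, 0 < r & qball rho x r `<=` U.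

(* Balls of a quasi-metric need not be open, hence [balls_measurable] besides
   [opens_measurable].  Both the Borel sigma-algebra and its completion satisfy
   [borel_regular]; without it a large extension of a Borel measure would be
   allowed, for which Lebesgue differentiation fails. *)
Record homogeneous_type (R : realType) (disp : measure_display)
    (X : measurableType disp) (rho : X -> X -> R)
    (mu : {measure set X -> \bar R}) : Prop := HomogeneousType {
  is_quasi_metric : quasi_metric rho ;
  opens_measurable : forall U, qopen rho U -> measurable U ;
  balls_measurable : forall B, is_ball rho B -> measurable B ;
  borel_regular : forall A, measurable A ->
    exists E, [/\ <<s qopen rho >> E, A `<=` E & mu E = mu A] ;
  measure_neq0 : mu [set: X] != 0%E ;
  measure_ball_lty : forall B, is_ball rho B -> (mu B < +oo)%E ;
  doubling : exists C : R, forall x r, 0 < r ->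
    (mu (qball rho x (2 * r)) <= C%:E * mu (qball rho x r))%E }.

(* Integrable on every ball, which is what makes the averages over balls
   meaningful even when X is not complete. *)
Definition loc_integrable (R : realType) (disp : measure_display)
    (X : measurableType disp) (rho : X -> X -> R)
    (mu : {measure set X -> \bar R}) (f : X -> R) : Prop :=
  forall B, is_ball rho B -> mu.-integrable B (EFin \o f).

Definition eaverage (R : realType) (disp : measure_display)
    (X : measurableType disp) (mu : {measure set X -> \bar R})
    (B : set X) (f : X -> \bar R) : \bar R :=
  ((mu B)^-1 * \int[mu]_(x in B) f x)%E.

(* The inverse is taken in \bar R, so that it is +oo where w vanishes.  As
   0 * +oo = 0 in \bar R, the weight w = 0 has to be excluded; for any other w,
   a ball on which w = 0 a.e. lies in a ball on which the product is +oo. *)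
Definition A2_weight (R : realType) (disp : measure_display)
    (X : measurableType disp) (rho : X -> X -> R)
    (mu : {measure set X -> \bar R}) (w : X -> R) : Prop :=
  [/\ (forall x, 0 <= w x),
      loc_integrable rho mu w,
      (0 < \int[mu]_x (w x)%:E)%E &
      (ereal_sup [set eaverage mu B (fun x => (w x)%:E) *
                      eaverage mu B (fun x => ((w x)%:E)^-1)
                 | B in is_ball rho] < +oo)%E].

Definition wmeas (R : realType) (disp : measure_display)
    (X : measurableType disp) (mu : {measure set X -> \bar R})
    (w : X -> R) (B : set X) : \bar R :=
  (\int[mu]_(x in B) (w x)%:E)%E.

Definition L2w_norm (R : realType) (disp : measure_display)
    (X : measurableType disp) (mu : {measure set X -> \bar R})
    (w : X -> R) (B : set X) (f : X -> R) : \bar R :=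
  ((\int[mu]_(x in B) (`|f x| ^+ 2 * w x)%:E) `^ 2^-1)%E.

Definition atom (R : realType) (disp : measure_display)
    (X : measurableType disp) (rho : X -> X -> R)
    (mu : {measure set X -> \bar R}) (w : X -> R) (a : X -> R) : Prop :=
  measurable_fun [set: X] a /\
  exists B, [/\ is_ball rho B,
    (forall x, a x != 0 -> B x),
    (\int[mu]_(x in B) (a x)%:E)%E = 0%E &
    (L2w_norm mu w B a <= wmeas mu w B `^ (- 2^-1))%E].

Definition bmo_norm (R : realType) (disp : measure_display)
    (X : measurableType disp) (rho : X -> X -> R)
    (mu : {measure set X -> \bar R}) (w : X -> R) (b : X -> R) : \bar R :=
  ereal_sup [set ((wmeas mu w B)^-1 * \int[mu]_(x in B)
                   `|b x - fine (eaverage mu B (EFin \o b))|%:E)%E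
            | B in is_ball rho].

Definition BMO (R : realType) (disp : measure_display)
    (X : measurableType disp) (rho : X -> X -> R)
    (mu : {measure set X -> \bar R}) (w : X -> R) : set (X -> R) :=
  [set b | loc_integrable rho mu b /\ (bmo_norm rho mu w b < +oo)%E].

Definition pairing (R : realType) (disp : measure_display)
    (X : measurableType disp) (mu : {measure set X -> \bar R})
    (a g : X -> R) : R := \int[mu]_x (a x * g x).

(* An integrable function such as an atom acts on BMO_w by integration. *)
Definition atom_fun (R : realType) (disp : measure_display)
    (X : measurableType disp) (rho : X -> X -> R)
    (mu : {measure set X -> \bar R}) (w : X -> R) (a : X -> R)
  : BMO rho mu w -> R := fun g => pairing mu a (val g).

(* [F = \sum_j lam j *: a j], the series being taken in the dual of BMO_w.
   This is the sense Coifman and Weiss give to the atomic series of H^p, p < 1,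
   namely in the dual of the Lipschitz space.  The sum cannot be taken a.e. or
   in L^1_w: for A_2 weights that vanish at two points, there are absolutely
   summable [lam] and atoms [a] with \sum_j lam j * a j = 0 in both senses but
   \sum_j lam j * \int a_j g <> 0 for some smooth g in BMO_w. *)
Definition atomic_decomposition (R : realType) (disp : measure_display)
    (X : measurableType disp) (rho : X -> X -> R)
    (mu : {measure set X -> \bar R}) (w : X -> R)
    (F : BMO rho mu w -> R) (lam : nat -> R) (a : nat -> X -> R) : Prop :=
  [/\ (forall j, atom rho mu w (a j)),
      (\sum_(0 <= j <oo) `|lam j|%:E < +oo)%E &
      forall g : BMO rho mu w,
        (fun n => \sum_(0 <= j < n) lam j * atom_fun (a j) g) @ \oo --> F g].

Definition H1 (R : realType) (disp : measure_display)
    (X : measurableType disp) (rho : X -> X -> R)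
    (mu : {measure set X -> \bar R}) (w : X -> R)
  : set (BMO rho mu w -> R) :=
  [set F | exists lam a, atomic_decomposition F lam a].

Definition H1_norm (R : realType) (disp : measure_display)
    (X : measurableType disp) (rho : X -> X -> R)
    (mu : {measure set X -> \bar R}) (w : X -> R)
    (F : BMO rho mu w -> R) : \bar R :=
  ereal_inf [set s | exists lam a, atomic_decomposition F lam a /\
                     s = (\sum_(0 <= j <oo) `|lam j|%:E)%E].

(* Only the values on H1 of an element of the dual are relevant. *)
Definition dual_norm (R : realType) (disp : measure_display)
    (X : measurableType disp) (rho : X -> X -> R)
    (mu : {measure set X -> \bar R}) (w : X -> R)
    (l : (BMO rho mu w -> R) -> R) : \bar R :=
  ereal_sup [set `|l F|%:E
            | F in [set F | H1 F /\ (H1_norm F <= 1)%E]].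

Definition H1_dual (R : realType) (disp : measure_display)
    (X : measurableType disp) (rho : X -> X -> R)
    (mu : {measure set X -> \bar R}) (w : X -> R)
  : set ((BMO rho mu w -> R) -> R) :=
  [set l | (forall (c : R) F G, H1 F -> H1 G -> l (c *: F + G) = c * l F + l G)
        /\ (dual_norm l < +oo)%E].

(* The integrability clause guarantees that [pairing] is a genuine integral. *)
Definition represents (R : realType) (disp : measure_display)
    (X : measurableType disp) (rho : X -> X -> R)
    (mu : {measure set X -> \bar R}) (w : X -> R)
    (g : X -> R) (l : (BMO rho mu w -> R) -> R) : Prop :=
  forall a, atom rho mu w a ->
    mu.-integrable [set: X] (EFin \o (fun x => a x * g x)) /\
    l (atom_fun a) = pairing mu a g.

(* Main.v *)
(** An atom pairs with a function [g] of BMO_w through the weighted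
    John-Nirenberg inequality: if [w] is in A_2 and [g] has norm at most [N],
    then the integral of [|g - g_B|^2 / w] over a ball [B] is at most
    [C N^2 w(B)], while an atom has its square integrable against [w].  The
    inequality is proved for averages of [g] over the cells of nested countable
    partitions, by induction on the scale with a stopping time; A_2 makes a
    stopping set of small measure carry a controlled fraction of the weight.
    It passes to [g] because these averages converge to [g] in L^1 as the mesh
    tends to 0, by Borel regularity of [mu].

    Conversely, correcting the mean on a fixed ball extends a bounded functional
    on H^1_w to functions of L^2_w with bounded support.  On indicators it is a
    signed measure, absolutely continuous with respect to [mu], hence has a
    Radon-Nikodym density [g].  Testing with the recentred sign of [g - g_B],
    which is a multiple of an atom, bounds the norm of [g] and also gives the
    uniqueness of [g] up to constants; simple functions identify the functional
    on all atoms, hence on H^1_w. *)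

Require Import Defs.
From HB Require Import structures.
From mathcomp Require Import all_boot all_order all_algebra.
From mathcomp Require Import finmap.
From mathcomp Require Import all_classical all_reals all_analysis.
From mathcomp Require Import measurable_realfun.
From mathcomp Require Import ring lra.

Set Implicit Arguments.
Unset Strict Implicit.
Unset Printing Implicit Defensive.
Import Order.TTheory GRing.Theory Num.Theory.
Import numFieldNormedType.Exports.

Local Open Scope classical_set_scope.
Local Open Scope ring_scope.

(** * Balls and nested partitions *)

(** Elements of [H1] are functions on BMO_w, so the functional attached to [g] is evaluation at [g].
    It is linear by construction; only its bound needs John-Nirenberg, and absolute summability
    carries that bound from atoms to series. The John-Nirenberg induction climbs from a finest
    partition, where [g] is replaced by its cell averages. This makes the base case immediate and
    removes any infinite descent. The constants depend neither on the number of levels nor on the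
    finest mesh, so the mesh can tend to 0 while the top scale stays fixed. Partitions of different
    meshes are chosen independently of each other, so the L^1 convergence of averages comes from a
    density argument and not from martingales. In the converse, the step from indicators to atoms
    compares the functional with evaluation at its density: the difference vanishes on indicators,
    hence, by dominated convergence, on all of L^2_w with bounded support. The ball on which means
    are corrected fixes the additive constant, since the density has integral zero there. *)

Section balls.
Context (R : realType) (disp : measure_display) (X : measurableType disp)
  (rho : X -> X -> R) (mu : {measure set X -> \bar R}).
Hypothesis hX : homogeneous_type rho mu.

Let is_ball_qball x r : 0 < r -> Defs.is_ball rho (qball rho x r).
Proof. by move=> r0; exists x, r. Qed.

Lemma measurable_qball x r : 0 < r -> measurable (qball rho x r).
Proof. by move=> r0; apply: (balls_measurable hX); exact: is_ball_qball. Qed.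

Lemma qball_lty x r : 0 < r -> (mu (qball rho x r) < +oo)%E.
Proof. by move=> r0; apply: (measure_ball_lty hX); exact: is_ball_qball. Qed.

Lemma qball_fin_num x r : 0 < r -> mu (qball rho x r) \is a fin_num.
Proof. by move=> r0; rewrite ge0_fin_numE// qball_lty. Qed.

Lemma qball_le x r s : r <= s -> qball rho x r `<=` qball rho x s.
Proof. by move=> rs y /= yr; exact: lt_le_trans rs. Qed.

Lemma qball_center x r : 0 < r -> qball rho x r x.
Proof.
move=> r0; case: (is_quasi_metric hX) => _ _ h _.
by rewrite /qball/=; have /h -> := erefl x.
Qed.

Lemma quasi_metric_const : exists2 A : R, 1 <= A &
  forall x y z, rho x y <= A * (rho x z + rho z y).
Proof. by case: (is_quasi_metric hX). Qed.

Lemma rho_ge0 x y : 0 <= rho x y.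
Proof. by case: (is_quasi_metric hX). Qed.

Lemma rho_sym x y : rho x y = rho y x.
Proof. by case: (is_quasi_metric hX). Qed.

Lemma bigcup_qball x r : 0 < r -> \bigcup_k qball rho x (2 ^+ k * r) = setT.
Proof.
move=> r0; rewrite -subTset => y _.
exists (Num.Def.archi_bound (rho x y / r)) => //=.
rewrite /qball/= -ltr_pdivrMr//.
have := archi_boundP (divr_ge0 (rho_ge0 x y) (ltW r0)).
move=> /lt_le_trans; apply.
by rewrite -natrX ler_nat ltnW// ltn_expl.
Qed.

Lemma qball_doubling : exists2 C : R, 1 <= C & forall x r, 0 < r ->
  fine (mu (qball rho x (2 * r))) <= C * fine (mu (qball rho x r)).
Proof.
have [C hC] := doubling hX.
exists (Num.max 1 C); first by rewrite le_max lexx.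
move=> x r r0; have := hC x r r0.
have r20 : 0 < 2 * r by rewrite mulr_gt0.
rewrite -(fineK (qball_fin_num x r0)) -(fineK (qball_fin_num x r20)).
rewrite -EFinM lee_fin => /le_trans; apply.
by rewrite ler_wpM2r ?fine_ge0// le_max lexx orbT.
Qed.

(** Doubling propagates a null ball to its concentric dilates, which exhaust [X]; the whole measure
    would then be zero. *)
Lemma qball_gt0 x r : 0 < r -> (0 < mu (qball rho x r))%E.
Proof.
move=> r0; rewrite lt0e measure_ge0 andbT; apply/eqP => h0.
have {}h0 k : mu (qball rho x (2 ^+ k * r)) = 0%E.
  elim: k => [|k ih]; first by rewrite expr0 mul1r.
  have k0 : 0 < 2 ^+ k * r by rewrite mulr_gt0// exprn_gt0.
  have [C hC] := doubling hX.
  have := hC x _ k0; rewrite mulrA -exprS ih mule0 => h.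
  by apply/eqP; rewrite eq_le h /=.
have /eqP := measure_neq0 hX; apply.
have : mu.-negligible (\bigcup_k qball rho x (2 ^+ k * r)).
  apply: negligible_bigcup => k; apply/negligibleP; last exact: h0.
  by apply: measurable_qball; rewrite mulr_gt0// exprn_gt0.
rewrite (bigcup_qball x r0) => /negligibleP; apply; exact: measurableT.
Qed.

Lemma fine_qball_gt0 x r : 0 < r -> 0 < fine (mu (qball rho x r)).
Proof. by move=> r0; rewrite fine_gt0// qball_gt0//= qball_lty. Qed.

Lemma le_fine_qball x r (A : set X) : 0 < r -> measurable A ->
  A `<=` qball rho x r -> fine (mu A) <= fine (mu (qball rho x r)).
Proof.
move=> r0 mA h; have mB := measurable_qball x r0.
have h1 : (mu A <= mu (qball rho x r))%E by apply: le_measure => //; rewrite inE.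
apply: fine_le => //; last exact: qball_fin_num.
by rewrite ge0_fin_numE// (le_lt_trans h1)// qball_lty.
Qed.

Lemma qball_scale t : 0 < t -> exists2 C : R, 1 <= C & forall x r, 0 < r ->
  fine (mu (qball rho x (t * r))) <= C * fine (mu (qball rho x r)).
Proof.
move=> t0; have [C C1 hC] := qball_doubling.
set k := Num.Def.archi_bound t.
have tk : t <= 2 ^+ k.
  rewrite ltW// (lt_le_trans (archi_boundP (ltW t0)))//.
  by rewrite -natrX ler_nat ltnW// ltn_expl.
have hk j x r : 0 < r ->
    fine (mu (qball rho x (2 ^+ j * r))) <= C ^+ j * fine (mu (qball rho x r)).
  move=> r0; elim: j => [|j ih]; first by rewrite !expr0 !mul1r.
  have j0 : 0 < 2 ^+ j * r by rewrite mulr_gt0// exprn_gt0.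
  rewrite exprS -mulrA (le_trans (hC _ _ j0))// exprS -mulrA.
  by rewrite ler_wpM2l// (le_trans _ C1).
exists (C ^+ k); first exact: exprn_ege1.
move=> x r r0; apply: le_trans (hk k x r r0).
apply: le_fine_qball; first by rewrite mulr_gt0// exprn_gt0.
  by apply: measurable_qball; rewrite mulr_gt0.
by apply: qball_le; rewrite ler_wpM2r// ltW.
Qed.

Lemma qball_sub_scale (A : R) x z (r s : R) :
  (forall x y z, rho x y <= A * (rho x z + rho z y)) -> 0 < A ->
  rho x z <= s -> qball rho x r `<=` qball rho z (A * (s + r)).
Proof.
move=> hA A0 xz y /= xy; rewrite /qball /=.
apply: le_lt_trans (hA _ _ x) _.
by rewrite ltr_pM2l// ler_ltD// rho_sym.
Qed.
End balls.

Lemma countable_bigcup_measurable (d : measure_display) (T : measurableType d)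
    (I : Type) (A : set I) (F : I -> set T) :
  countable A -> (forall i, A i -> measurable (F i)) ->
  measurable (\bigcup_(i in A) F i).
Proof.
move=> /countable_injP[f finj] mF.
rewrite (_ : \bigcup_(i in A) F i =
    \bigcup_n \bigcup_(i in [set i | A i /\ f i = n]) F i); last first.
  apply/seteqP; split => [x [i Ai Fx]|x [n _ [i [Ai _] Fx]]]; last by exists i.
  by exists (f i) => //; exists i.
apply: bigcup_measurable => n _.
have [[i [Ai fi]]|h] := pselect (exists i, A i /\ f i = n); last first.
  rewrite (_ : \bigcup_(i in _) _ = set0)// -subset0 => x [i [Ai fi] _].
  by apply: h; exists i.
rewrite (_ : \bigcup_(i in _) _ = F i); first exact: mF.
apply/seteqP; split => [x [j [Aj fj] Fx]|x Fx]; last by exists i.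
suff <- : j = i by [].
by apply: finj; [exact: mem_set|exact: mem_set|rewrite fj fi].
Qed.

(** * Separated sets and maximal nets *)

Section nets.
Context (R : realType) (disp : measure_display) (X : measurableType disp)
  (rho : X -> X -> R) (mu : {measure set X -> \bar R}).
Hypothesis hX : homogeneous_type rho mu.

Definition separated (s : R) (N : set X) :=
  forall z z', N z -> N z' -> z <> z' -> s <= rho z z'.

(** Packing argument. The balls of radius [e] around the points of [N] in the given ball are
    disjoint and lie in one ball of measure [M]. Each has measure at least [M / C], since its dilate
    of radius [r2] contains that ball. Hence there are at most [C] points. *)
Lemma finite_separated s x r (N : set X) : 0 < s -> 0 < r ->
  separated s N -> finite_set (N `&` qball rho x r).
Proof.
move=> s0 r0 sN; apply: contrapT => Ninf.
have [A A1 hA] := quasi_metric_const hX.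
have A0 : 0 < A by exact: lt_le_trans A1.
(* Chosen so that [A * (e + e) = s]: two balls of radius [e] that meet have centres closer than
   [s]. *)
pose e : R := s / (2 * A).
have e0 : 0 < e by rewrite divr_gt0// mulr_gt0.
pose r' := A * (r + e).
have r'0 : 0 < r' by rewrite mulr_gt0// addr_gt0.
pose r2 := A * (r + r').
have r20 : 0 < r2 by rewrite mulr_gt0// addr_gt0.
have [C C1 hC] := qball_scale hX (divr_gt0 r20 e0).
have C0 : 0 < C by exact: lt_le_trans C1.
pose M := fine (mu (qball rho x r')).
have M0 : 0 < M by exact: fine_qball_gt0.
have big z : qball rho x r z -> M <= C * fine (mu (qball rho z e)).
  move=> xz; apply: le_trans (hC z e e0).
  rewrite divfK ?gt_eqF//; apply: le_fine_qball => //.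
    exact: measurable_qball hX _ _ _.
  by apply: (qball_sub_scale hX hA A0); exact: ltW.
have [F FN Fn] := infinite_set_fset (Num.Def.archi_bound C) Ninf.
have CF : C < (size (finmap.enum_fset F))%:R.
  by apply: lt_le_trans (archi_boundP (ltW C0)) _; rewrite ler_nat.
have mb z : measurable (qball rho z e) by exact: measurable_qball hX _ _ _.
have tF : trivIset [set` F] (fun z => qball rho z e).
  move=> i j /FN[Ni _] /FN[Nj _] [y [iy jy]]; apply: contrapT => ij.
  have := sN i j Ni Nj ij; rewrite leNgt => /negP; apply.
  apply: le_lt_trans (hA _ _ y) _; rewrite (rho_sym hX y j).
  have -> : s = A * (e + e) by rewrite /e; field; rewrite gt_eqF.
  by rewrite ltr_pM2l// ltrD.
have := @measure_fbigsetU _ _ _ mu _ F (fun z => qball rho z e)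
  (fun z _ => mb z) tF.
set U := \big[_/_]_(i <- _) _ => hU.
have mU : measurable U by apply: bigsetU_measurable.
have UB : U `<=` qball rho x r'.
  rewrite /U big_seq; apply: (big_ind (fun V => V `<=` qball rho x r')) => //.
    by move=> V W VB WB y [/VB|/WB].
  move=> z zF; have /FN[_ xz] : [set` F] z by [].
  by apply: (qball_sub_scale hX hA A0); rewrite (rho_sym hX) ltW.
have h1 : fine (mu U) <= M by exact: le_fine_qball.
have h2 : fine (mu U) = \sum_(z <- finmap.enum_fset F) fine (mu (qball rho z e)).
  apply: EFin_inj; rewrite fineK; last first.
    rewrite ge0_fin_numE//; apply: le_lt_trans (qball_lty hX x r'0).
    apply: le_measure => //; rewrite inE //.
    exact: measurable_qball hX _ _ _.
  rewrite hU -sumEFin; apply: eq_bigr => z _.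
  by rewrite fineK//; exact: qball_fin_num hX _ _ _.
have h3 : \sum_(z <- finmap.enum_fset F) M / C <= fine (mu U).
  rewrite h2 big_seq [leRHS]big_seq; apply: ler_sum => z zF.
  have /FN[_ /big] : [set` F] z by [].
  by rewrite ler_pdivrMr// mulrC.
have := le_trans h3 h1.
rewrite big_const_seq count_predT iter_addr addr0 -mulr_natl mulrA.
rewrite ler_pdivrMr// mulrC ler_pM2l//.
by rewrite leNgt CF.
Qed.

Lemma countable_separated s N : 0 < s -> separated s N -> countable N.
Proof.
move=> s0 sN.
rewrite (_ : N = \bigcup_k (N `&` qball rho point (2 ^+ k * 1))); last first.
  by rewrite -setI_bigcupr (bigcup_qball hX) ?setIT.
apply: bigcup_countable => // k _.
apply: finite_set_countable; apply: finite_separated sN => //.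
Qed.

(** Zorn's lemma applies because two points of the union of a chain lie in one member. A point at
    distance at least [s] from a maximal separated set could be added to it. *)
Lemma maximal_separated s : 0 < s -> exists N, [/\ countable N,
  separated s N & forall x, exists2 z, N z & rho x z < s].
Proof.
move=> s0; have [F FP totF|N [sN maxN]] := @Zorn_bigcup X (separated s).
  move=> z z' [V FV Vz] [W FW Wz'].
  have [VW|WV] := totF _ _ FV FW.
    exact: (FP _ FW) (VW _ Vz) Wz'.
  exact: (FP _ FV) Vz (WV _ Wz').
exists N; split => //; first exact: countable_separated sN.
move=> x; apply: contrapT => h.
have {}h z : N z -> s <= rho x z.
  by move=> Nz; rewrite leNgt; apply/negP => xz; apply: h; exists z.
apply: (maxN (N `|` [set x])); last first.
  move=> z z' [Nz|->] [Nz'|->]//; first exact: sN.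
  - by rewrite (rho_sym hX) => _; exact: h.
  - by move=> _; exact: h.
split; first by move=> ? ?; left.
move=> /(_ x (or_intror erefl)) /h; rewrite leNgt => /negP; apply.
exact: (qball_center hX).
Qed.

End nets.

(** * Nested partitions whose cells are comparable to balls *)

Section partitions.
Context (R : realType) (disp : measure_display) (X : measurableType disp)
  (rho : X -> X -> R) (mu : {measure set X -> \bar R}).
Hypothesis hX : homogeneous_type rho mu.
Variable A : R.
Hypothesis A1 : 1 <= A.
Hypothesis hA : forall x y z, rho x y <= A * (rho x z + rho z y).

Let A0 : 0 < A. Proof. exact: lt_le_trans A1. Qed.

(** A point within [s / (2 * A)] of a centre goes to that centre, which is unique by separation. Any
    other point goes to the centre of least index among those within [s]. The priority given to
    close points is what puts a whole ball around each chosen centre inside its cell, and hence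
    bounds the measure of the cell from below. *)
Lemma net_projection s : 0 < s -> exists p : X -> X,
  [/\ countable (range p), forall S, measurable (p @^-1` S),
      forall x, rho x (p x) < s &
      forall x y, rho y (p x) < s / (2 * A) -> p y = p x].
Proof.
move=> s0; have [N [cN sN covN]] := maximal_separated hX s0.
have /countable_injP[f finj] := cN.
pose c := s / (2 * A).
have c0 : 0 < c by rewrite divr_gt0// mulr_gt0.
have cs : c <= s.
  rewrite ler_pdivrMr ?mulr_gt0// ler_peMr//; first exact: ltW.
  by have := A1; lra.
have uniq_close x z z' : N z -> N z' -> rho x z < c -> rho x z' < c -> z = z'.
  move=> Nz Nz' xz xz'; apply: contrapT => zz'.
  have := sN z z' Nz Nz' zz'; rewrite leNgt => /negP; apply.
  apply: le_lt_trans (hA _ _ x) _; rewrite (rho_sym hX z x).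
  have -> : s = A * (c + c) by rewrite /c; field; rewrite gt_eqF.
  by rewrite ltr_pM2l// ltrD.
pose P x z := N z /\ (rho x z < c \/
  [/\ forall z', N z' -> c <= rho x z', rho x z < s &
      forall z', N z' -> rho x z' < s -> (f z <= f z')%N]).
have exP x : exists z, P x z.
  have [[z [Nz xz]]|h] := pselect (exists z, N z /\ rho x z < c).
    by exists z; split => //; left.
  have {}h z : N z -> c <= rho x z.
    by move=> Nz; rewrite leNgt; apply/negP => xz; apply: h; exists z.
  have ex : exists n, `[< exists z, [/\ N z, rho x z < s & f z = n] >].
    have [z Nz xz] := covN x.
    by exists (f z); apply/asboolP; exists z.
  have [_ /asboolP[z [Nz xz <-]] zmin] := ex_minnP ex.
  exists z; split => //; right; split => // z' Nz' xz'.
  by apply: zmin; apply/asboolP; exists z'.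
have uniqP x z z' : P x z -> P x z' -> z = z'.
  move=> [Nz hz] [Nz' hz'].
  case: hz => [xz|[h xz hz]]; case: hz' => [xz'|[h' xz' hz']].
  - exact: uniq_close xz xz'.
  - by have := h' _ Nz; rewrite leNgt xz.
  - by have := h _ Nz'; rewrite leNgt xz'.
  - apply: finj; rewrite ?inE//; apply/eqP.
    by rewrite eqn_leq hz// hz'.
have [p pP] := choice exP.
have pE x z : P x z -> p x = z by move=> Pxz; exact: uniqP (pP x) Pxz.
have pN x : N (p x) by case: (pP x).
have mB z r : 0 < r -> measurable (qball rho z r) by exact: measurable_qball hX _ _.
exists p; split.
- by apply: sub_countable cN; apply: subset_card_le => _ [x _ <-].
(* The cell of a centre is its inner ball together with the part of its outer ball that avoids all
   inner balls and the outer balls of centres of smaller index. Only countably many balls occur, so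
   even an arbitrary [S] has a measurable preimage. *)
- move=> S.
  rewrite (_ : p @^-1` S = \bigcup_(z in N `&` S) (qball rho z c `|`
    ((qball rho z s `\` \bigcup_(z' in N) qball rho z' c) `\`
     \bigcup_(z' in N `&` [set z' | (f z' < f z)%N]) qball rho z' s))).
    apply: countable_bigcup_measurable.
      by apply: sub_countable cN; apply: subset_card_le; by move=> ? [].
    move=> z _; apply: measurableU; first exact: mB.
    apply: measurableD; first apply: measurableD; first exact: mB.
      by apply: countable_bigcup_measurable => // z' _; exact: mB.
    apply: countable_bigcup_measurable; last by move=> z' _; exact: mB.
    by apply: sub_countable cN; apply: subset_card_le; by move=> ? [].
  apply/seteqP; split => x.
    move=> Spx; exists (p x); first by split.
    case: (pP x) => _ [h|[h1 h2 h3]]; [left|right].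
      by rewrite /qball/= (rho_sym hX).
    split; first split.
    + by rewrite /qball/= (rho_sym hX).
    + move=> [z' Nz']; rewrite /qball/= (rho_sym hX).
      by rewrite ltNge h1.
    + move=> [z' [Nz' /= fz']]; rewrite /qball/= (rho_sym hX) => /(h3 _ Nz').
      by rewrite leqNgt fz'.
  move=> [z [Nz Sz] h] /=; rewrite (pE x z)//; split => //.
  case: h => [h|[[h1 h2] h3]]; [left|right].
    by rewrite (rho_sym hX).
  split; last 2 [by rewrite (rho_sym hX)].
  + move=> z' Nz'; rewrite leNgt; apply/negP => xz'; apply: h2.
    by exists z' => //; rewrite /qball/= (rho_sym hX).
  + move=> z' Nz' xz'; rewrite leqNgt; apply/negP => fz'; apply: h3.
    by exists z' => //; rewrite /qball/= (rho_sym hX).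
- move=> x; case: (pP x) => _ [h|[]//]; exact: lt_le_trans cs.
- by move=> x y h; apply: pE; split => //; left.
Qed.

(* A partition is encoded by the map [pi i] that sends a point to the centre of
   its cell. *)
Definition nested_partitions (s : R) (pi : nat -> X -> X) : Prop :=
  [/\ forall i, countable (range (pi i)),
      forall i S, measurable (pi i @^-1` S),
      forall i x y, pi i x = pi i y -> pi i.+1 x = pi i.+1 y,
      forall i x, rho x (pi i x) < 2 * A * (s * (8 * A ^+ 3) ^+ i) &
      forall i x y, rho y (pi i x) < s * (8 * A ^+ 3) ^+ i / (4 * A ^+ 2) ->
        pi i y = pi i x].

(** Each level projects the centre of the previous level instead of the point itself, which makes
    nesting automatic. The price is an accumulated displacement; the ratio [8 * A ^+ 3] between
    scales keeps it below a fixed multiple of the current scale. *)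
Lemma nested_partitions_exist s : 0 < s -> exists pi, nested_partitions s pi.
Proof.
move=> s0; pose D := 8 * A ^+ 3.
have A3 : 1 <= A ^+ 3 by exact: exprn_ege1.
have D0 : 0 < D by rewrite mulr_gt0// exprn_gt0.
pose r i := s * D ^+ i.
have r0 i : 0 < r i by rewrite mulr_gt0// exprn_gt0.
have rS i : r i.+1 = D * r i by rewrite /r exprS; ring.
have [p hp] := choice (fun i => net_projection (r0 i)).
pose pi := fix pi i x := if i is j.+1 then p j.+1 (pi j x) else p 0%N x.
have A2 : 1 <= A ^+ 2 by exact: exprn_ege1.
have hA2 : A <= A ^+ 2 by rewrite expr2 ler_peMr// ltW.
have hA3 : A ^+ 2 <= A ^+ 3 by rewrite [leRHS]exprS ler_peMl// exprn_ge0// ltW.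
have far i x : rho x (pi i x) < 2 * A * r i.
  elim: i => [|i ih] /=.
    have [_ _ h _] := hp 0%N; apply: lt_le_trans (h x) _.
    by rewrite ler_peMl// ?ltW//; have := A1; lra.
  have [_ _ h _] := hp i.+1; apply: le_lt_trans (hA _ _ (pi i x)) _.
  have -> : 2 * A * r i.+1 = A * (r i.+1 + r i.+1) by ring.
  rewrite ltr_pM2l// ltrD//; apply: lt_le_trans ih _.
  by rewrite rS ler_wpM2r ?ltW// /D; have := A1; lra.
exists pi; split.
- case=> [|i] /=; first by case: (hp 0%N).
  case: (hp i.+1) => h _ _ _; apply: sub_countable h.
  by apply: subset_card_le => _ [x _ <-]; exists (pi i x).
- elim=> [|i ih] S /=; first by case: (hp 0%N).
  exact: (ih (p i.+1 @^-1` S)).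
- by move=> i x y /= ->.
- exact: far.
- elim=> [|i ih] x y /=.
    rewrite expr0 mulr1 => h; have [_ _ _ +] := hp 0%N; apply.
    apply: lt_le_trans h _; rewrite /r expr0 mulr1.
    by rewrite ler_pM2l// lef_pV2 ?posrE ?mulr_gt0 ?exprn_gt0//; have := A1; lra.
  move=> h; have [_ _ _ +] := hp i.+1; apply.
  apply: le_lt_trans (hA _ _ y) _; rewrite (rho_sym hX (pi i y)).
  have h1 := far i y.
  (* This identity dictates the ratio of scales: with [r i.+1 = 8 * A ^+ 3 * r i], the displacement
     term [2 * A ^+ 2 * r i] is exactly half of the radius [r i.+1 / (2 * A)] allowed by the net. *)
  have -> : r i.+1 / (2 * A) = A * (2 * A * r i + r i.+1 / (4 * A ^+ 2)).
    by rewrite rS /D; field; rewrite gt_eqF.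
  by rewrite ltr_pM2l// ltrD.
Qed.

End partitions.

(** * Differentiation of integrals *)

Lemma ge0_lty_bound (R : realType) (x : \bar R) : (0 <= x)%E -> (x < +oo)%E ->
  exists2 T : R, 0 < T & (x <= T%:E)%E.
Proof.
move=> x0 xoo; exists (fine x + 1); first by rewrite ltr_wpDl// fine_ge0.
by rewrite EFinD fineK ?leeDl// ge0_fin_numE.
Qed.

Section Rintegral_extra.
Context (R : realType) (d : measure_display) (T : measurableType d)
  (mu : {measure set T -> \bar R}).

Lemma EFin_Rintegral (D : set T) (f : T -> R) : measurable D ->
  mu.-integrable D (EFin \o f) ->
  (\int[mu]_(x in D) f x)%:E = (\int[mu]_(x in D) (f x)%:E)%E.
Proof. by move=> mD hf; rewrite fineK//; exact: integrable_fin_num. Qed.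

Lemma Rintegral_subset (A B : set T) (f : T -> R) : measurable A ->
  measurable B -> A `<=` B -> mu.-integrable B (EFin \o f) ->
  (forall x, 0 <= f x) -> \int[mu]_(x in A) f x <= \int[mu]_(x in B) f x.
Proof.
move=> mA mB AB hf f0; rewrite -lee_fin !EFin_Rintegral//; last first.
  by apply: integrableS hf.
apply: ge0_subset_integral => //; first exact: measurable_int hf.
by move=> x _; rewrite lee_fin.
Qed.

Lemma integrable_ge0_lty (D : set T) (f : T -> R) : measurable_fun D f ->
  (forall x, 0 <= f x) -> (\int[mu]_(x in D) (f x)%:E < +oo)%E ->
  mu.-integrable D (EFin \o f).
Proof.
move=> mf f0 foo; apply/integrableP; split; first exact/measurable_EFinP.
rewrite (_ : (\int[mu]_(x in D) _)%E = (\int[mu]_(x in D) (f x)%:E)%E)//.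
by apply: eq_integral => x _ /=; rewrite ger0_norm.
Qed.

Lemma ge0_integral_gt0 (D : set T) (f : T -> R) : measurable D ->
  (0 < mu D)%E -> measurable_fun D f -> (forall x, 0 <= f x) ->
  {ae mu, forall x, D x -> 0 < f x} -> (0 < \int[mu]_(x in D) (f x)%:E)%E.
Proof.
move=> mD D0 mf f0 hf; rewrite lt0e integral_ge0 ?andbT; last first.
  by move=> x _; rewrite lee_fin.
apply/eqP => f_eq0.
have : ae_eq mu D (EFin \o f) (cst 0%E).
  apply/ae_eq_integral_abs => //; first exact/measurable_EFinP.
  rewrite -[RHS]f_eq0; apply: eq_integral => x _.
  by rewrite /= ger0_norm.
move=> h; have : {ae mu, forall x, ~ D x}.
  apply: filterS2 h hf => x fx0 fx Dx.
  by have := fx Dx; have [->] := fx0 Dx; rewrite ltxx.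
move=> [N [mN N0 DN]]; have : (mu D <= mu N)%E.
  by apply: le_measure; rewrite ?inE// => x Dx; apply: DN => /=; exact.
by rewrite N0 leNgt D0.
Qed.

Lemma integrable_cst_lty (D : set T) (k : R) : measurable D ->
  (mu D < +oo)%E -> mu.-integrable D (EFin \o cst k).
Proof.
move=> mD Doo; apply: measurable_bounded_integrable => //.
exact: bounded_cst.
Qed.

Lemma integrableB_EFin (D : set T) (f g : T -> R) : measurable D ->
  mu.-integrable D (EFin \o f) -> mu.-integrable D (EFin \o g) ->
  mu.-integrable D (EFin \o (fun x => f x - g x)).
Proof.
by move=> mD hf hg; apply: eq_integrable (integrableB mD hf hg).
Qed.

Lemma integrableD_EFin (D : set T) (f g : T -> R) : measurable D ->
  mu.-integrable D (EFin \o f) -> mu.-integrable D (EFin \o g) ->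
  mu.-integrable D (EFin \o (fun x => f x + g x)).
Proof.
by move=> mD hf hg; apply: eq_integrable (integrableD mD hf hg).
Qed.

Lemma integrableZ_EFin (D : set T) k (f : T -> R) : measurable D ->
  mu.-integrable D (EFin \o f) ->
  mu.-integrable D (EFin \o (fun x => k * f x)).
Proof.
by move=> mD hf; apply: eq_integrable (integrableZl mD k hf).
Qed.

End Rintegral_extra.

Lemma measurable_EFin_normr (R : realType) (d : measure_display)
    (T : measurableType d) (h : T -> R) : measurable_fun setT h ->
  measurable_fun setT (fun x => (`|h x|)%:E : \bar R).
Proof. by move=> mh; apply/measurable_EFinP; exact: measurableT_comp. Qed.

Section norm1.
Context (R : realType) (disp : measure_display) (X : measurableType disp)
  (mu : {measure set X -> \bar R}).

Definition norm1 (f : X -> R) : \bar R := (\int[mu]_x `|f x|%:E)%E.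

Lemma le_norm1D (f g : X -> R) : measurable_fun setT f -> measurable_fun setT g ->
  (norm1 (fun x => f x + g x)%R <= norm1 f + norm1 g)%E.
Proof.
move=> mf mg.
have mn := @measurable_EFin_normr R _ X.
rewrite /norm1 -ge0_integralD//; [|exact: mn|exact: mn].
apply: ge0_le_integral => //.
- by apply: mn; exact: measurable_funD.
- by apply: emeasurable_funD; exact: mn.
- by move=> x _; rewrite -EFinD lee_fin ler_normD.
Qed.

Lemma norm1Z c (f : X -> R) : measurable_fun setT f ->
  norm1 (fun x => c * f x) = (`|c|%:E * norm1 f)%E.
Proof.
move=> mf; rewrite /norm1 -ge0_integralZl//.
- by apply: eq_integral => x _; rewrite normrM EFinM.
- by apply/measurable_EFinP; exact: measurableT_comp.
Qed.

Lemma norm1_indic A : measurable A -> norm1 \1_A = mu A.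
Proof.
move=> mA; rewrite /norm1 -[in RHS](setIT A) -integral_indic//.
by apply: eq_integral => x _; rewrite ger0_norm.
Qed.

Lemma norm1_lty (f : X -> R) : mu.-integrable setT (EFin \o f) -> (norm1 f < +oo)%E.
Proof. by move=> /integrableP[]. Qed.

End norm1.

Lemma indic_setD (T : Type) (R : realType) (A B : set T) x : B `<=` A ->
  \1_(A `\` B) x = \1_A x - \1_B x :> R.
Proof.
move=> BA; rewrite !indicE in_setD.
case: (boolP (x \in B)) => [/set_mem/BA/mem_set ->|_]; first by rewrite subrr.
by rewrite andbT subr0.
Qed.

(** * Averages over the cells of a countable partition *)

Section cells.
Context (R : realType) (disp : measure_display) (X : measurableType disp)
  (mu : {measure set X -> \bar R}).
Variable p : X -> X.
Hypothesis cp : countable (range p).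
Hypothesis mp : forall S, measurable (p @^-1` S).

Definition cell x : set X := p @^-1` [set p x].

Lemma measurable_cell x : measurable (cell x). Proof. exact: mp. Qed.

Lemma cell_eq x y : cell x y -> cell y = cell x.
Proof. by rewrite /cell /= => ->. Qed.

(** Every set has a measurable preimage under [p], so [p] absorbs the irregularity of [h]. Functions
    constant on cells are measurable by this route. *)
Lemma measurable_comp_cell d (Y : measurableType d) (h : X -> Y) :
  measurable_fun setT (h \o p).
Proof. by move=> _ B mB; rewrite setTI; exact: (mp (h @^-1` B)). Qed.

(** A union of cells is a countable disjoint union, so inequalities on single cells add up. An
    injection of the centres into the integers enumerates the cells; indices without a centre
    contribute the empty set. *)
Lemma le_integral_cells (F G : X -> \bar R) (S : set X) :
  measurable_fun setT F -> measurable_fun setT G ->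
  (forall x, 0 <= F x)%E -> (forall x, 0 <= G x)%E ->
  (forall x, S (p x) ->
    \int[mu]_(y in cell x) F y <= \int[mu]_(y in cell x) G y)%E ->
  (\int[mu]_(y in p @^-1` S) F y <= \int[mu]_(y in p @^-1` S) G y)%E.
Proof.
move=> mF mG F0 G0 h.
have /countable_injP[f finj] := cp.
pose E n := p @^-1` (S `&` f @^-1` [set n]).
have -> : p @^-1` S = \bigcup_n E n.
  apply/seteqP; split => [x Sx|x [n _ []//]].
  by exists (f (p x)).
have tE : trivIset setT E.
  by move=> i j _ _ [x [[_ /= <-] [_ /= <-]]].
rewrite !ge0_integral_bigcup//; [|by move=> k; exact: mp|exact: measurable_funTS
  |by move=> k; exact: mp|exact: measurable_funTS].
apply: lee_nneseries => n _; first by move=> _; exact: integral_ge0.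
have [[x [Sx fx]]|nE] := pselect (exists x, E n x).
  rewrite (_ : E n = cell x); first exact: h.
  apply/seteqP; split => [y [Sy fy]|y].
    by apply: finj; [exact: mem_set|exact: mem_set|rewrite fy fx].
  by rewrite /cell /E /= => ->.
have -> : E n = set0.
  by rewrite -subset0 => x Ex; apply: nE; exists x.
by rewrite !integral_set0.
Qed.

(** Conditional expectation with respect to the sigma-algebra generated by the partition. *)
Definition cell_avg (g : X -> R) x : R :=
  (fine (mu (cell x)))^-1 * \int[mu]_(y in cell x) g y.

Lemma measurable_cell_avg g : measurable_fun setT (cell_avg g).
Proof.
exact: (@measurable_comp_cell _ _ (fun z =>
  (fine (mu (p @^-1` [set z])))^-1 * \int[mu]_(y in p @^-1` [set z]) g y)).
Qed.

Lemma cell_avg_eq g x y : cell x y -> cell_avg g y = cell_avg g x.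
Proof. by move=> /cell_eq xy; rewrite /cell_avg xy. Qed.

Hypothesis p0 : forall x, (0 < mu (cell x) < +oo)%E.

Lemma fine_cell_gt0 x : 0 < fine (mu (cell x)).
Proof. by rewrite fine_gt0. Qed.

Lemma cell_fin_num x : mu (cell x) \is a fin_num.
Proof. by rewrite ge0_fin_numE//; case/andP: (p0 x). Qed.

Lemma cell_avg_cst (f : X -> R) c x : (forall y, cell x y -> f y = c) ->
  cell_avg f x = c.
Proof.
move=> fc; have mc := measurable_cell x.
rewrite /cell_avg.
have -> : \int[mu]_(y in cell x) f y = \int[mu]_(y in cell x) (cst c y).
  by apply: eq_Rintegral => y; rewrite inE; exact: fc.
rewrite Rintegral_cst// mulrCA mulVf ?mulr1// gt_eqF//.
exact: fine_cell_gt0.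
Qed.

Lemma cell_avgB (f g : X -> R) x : mu.-integrable setT (EFin \o f) ->
  mu.-integrable setT (EFin \o g) ->
  cell_avg (fun x => f x - g x) x = cell_avg f x - cell_avg g x.
Proof.
move=> hf hg; rewrite /cell_avg RintegralB ?mulrBr//.
- exact: measurable_cell.
- by apply: integrableS hf => //; exact: measurable_cell.
- by apply: integrableS hg => //; exact: measurable_cell.
Qed.

Lemma cell_avgZ c (f : X -> R) x : mu.-integrable setT (EFin \o f) ->
  cell_avg (fun x => c * f x) x = c * cell_avg f x.
Proof.
move=> hf; rewrite /cell_avg RintegralZl; first by rewrite mulrCA.
- exact: measurable_cell.
- by apply: integrableS hf => //; exact: measurable_cell.
Qed.

(** Conditional expectation contracts L^1: on each cell this is the triangle inequality for the
    integral, and the cells are then summed. *)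
Lemma le_norm1_cell_avg (f : X -> R) : mu.-integrable setT (EFin \o f) ->
  (norm1 mu (cell_avg f) <= norm1 mu f)%E.
Proof.
move=> hf; have mf : measurable_fun setT f.
  by apply/measurable_EFinP; exact: measurable_int hf.
have mn := @measurable_EFin_normr R _ X.
apply: (@le_integral_cells _ _ setT) => //.
- by apply: mn; exact: measurable_cell_avg.
- exact: mn.
move=> x _; have mc := measurable_cell x.
have hfx : mu.-integrable (cell x) (EFin \o f) by exact: integrableS hf.
rewrite (eq_integral (cst `|cell_avg f x|%:E)); last first.
  by move=> y; rewrite inE => /(cell_avg_eq f) ->.
rewrite integral_cst// -(fineK (cell_fin_num x)) -EFinM.
have hn : mu.-integrable (cell x) (EFin \o (fun x => `|f x|)).
  exact: integrable_norm.
have /fineK <- := integrable_fin_num mc hn.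
rewrite lee_fin /cell_avg normrM ger0_norm; last first.
  by rewrite invr_ge0 ltW// fine_cell_gt0.
rewrite mulrAC mulVf ?mul1r; first exact: le_normr_Rintegral.
by rewrite gt_eqF// fine_cell_gt0.
Qed.

End cells.

Import HBSimple.

(** * Convergence in L^1 of averages over cells of shrinking mesh *)

Section differentiation.
Context (R : realType) (disp : measure_display) (X : measurableType disp)
  (rho : X -> X -> R) (mu : {measure set X -> \bar R}).
Hypothesis hX : homogeneous_type rho mu.
Variable p : nat -> X -> X.
Hypothesis cp : forall n, countable (range (p n)).
Hypothesis mp : forall n S, measurable (p n @^-1` S).
Hypothesis p0 : forall n x, (0 < mu (cell (p n) x) < +oo)%E.
Hypothesis mesh : forall e, 0 < e -> exists n0, forall n, (n0 <= n)%N ->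
  forall x, cell (p n) x `<=` qball rho x e.

Local Notation avg n := (cell_avg mu (p n)).

(** The partitions [p n] for different [n] are unrelated. Convergence is therefore taken in L^1,
    where contraction makes it stable under limits, so that checking it on a dense class is
    enough. *)
Definition avg_cvg (f : X -> R) : Prop :=
  mu.-integrable setT (EFin \o f) /\
  forall e, 0 < e -> exists n0, forall n, (n0 <= n)%N ->
    (norm1 mu (fun x => f x - avg n f x)%R <= e%:E)%E.

Let mint (f : X -> R) : mu.-integrable setT (EFin \o f) ->
  measurable_fun setT f.
Proof. by move=> hf; apply/measurable_EFinP; exact: measurable_int hf. Qed.

Let mavg n f : measurable_fun setT (avg n f).
Proof. exact: measurable_cell_avg. Qed.

(** The error is the sum of [f - h], of [h - avg n h], and of minus the average of [f - h]; by
    contraction the last costs no more than the first. *)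
Lemma avg_cvg_closed f : mu.-integrable setT (EFin \o f) ->
  (forall e, 0 < e -> exists2 h, avg_cvg h &
     (norm1 mu (fun x => f x - h x)%R <= e%:E)%E) -> avg_cvg f.
Proof.
move=> hf H; split=> // e e0; have e3 : 0 < e / 3 by rewrite divr_gt0.
have [h [hh cvh] fh] := H _ e3; have [n0 hn0] := cvh _ e3.
exists n0 => n /hn0 hn.
rewrite (_ : (fun x => f x - avg n f x) =
   (fun x => (f x - h x) + ((h x - avg n h x) +
      (-1) * avg n (fun x => f x - h x) x))); last first.
  by apply/funext => x; rewrite cell_avgB//; ring.
have mf := mint hf; have mh := mint hh.
have mfh := measurable_funB mf mh; have mha := measurable_funB mh (mavg n h).
have mlast : measurable_fun setT (fun x => (-1) * avg n (fun x => f x - h x) x).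
  by apply: measurable_funM => //; exact: mavg.
apply: le_trans (le_norm1D _ mfh (measurable_funD mha mlast)) _.
have -> : e%:E = ((e / 3)%:E + ((e / 3)%:E + (e / 3)%:E))%E.
  by rewrite -!EFinD; congr EFin; field.
apply: leeD => //; apply: le_trans (le_norm1D _ mha mlast) _.
apply: leeD => //; rewrite norm1Z; last exact: mavg.
rewrite normrN1 mul1e.
by apply: le_trans fh; apply: le_norm1_cell_avg => //; exact: integrableB_EFin.
Qed.

Lemma avg_cvgB f g : avg_cvg f -> avg_cvg g -> avg_cvg (fun x => f x - g x).
Proof.
move=> [hf cf] [hg cg]; split; first exact: integrableB_EFin.
move=> e e0; have e2 : 0 < e / 2 by rewrite divr_gt0.
have [n1 h1] := cf _ e2; have [n2 h2] := cg _ e2.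
exists (maxn n1 n2) => n; rewrite geq_max => /andP[/h1{}h1 /h2{}h2].
rewrite (_ : (fun x => _) = (fun x => (f x - avg n f x) +
  (-1) * (g x - avg n g x))); last first.
  by apply/funext => x; rewrite cell_avgB//; ring.
have mf := mint hf; have mg := mint hg.
have mfa := measurable_funB mf (mavg n f).
have mga := measurable_funB mg (mavg n g).
have mga1 : measurable_fun setT (fun x => (-1) * (g x - avg n g x)).
  by apply: measurable_funM.
apply: le_trans (le_norm1D _ mfa mga1) _.
rewrite norm1Z// normrN1 mul1e.
by have -> : e%:E = ((e / 2)%:E + (e / 2)%:E)%E; [
  rewrite -!EFinD; congr EFin; field | exact: leeD].
Qed.

Lemma avg_cvgZ c f : avg_cvg f -> avg_cvg (fun x => c * f x).
Proof.
move=> [hf cf]; split; first exact: integrableZ_EFin.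
move=> e e0; have ec : 0 < e / (`|c| + 1).
  by rewrite divr_gt0// ltr_wpDl.
have [n0 h0] := cf _ ec; exists n0 => n /h0{}h0.
rewrite (_ : (fun x => _) = (fun x => c * (f x - avg n f x))); last first.
  by apply/funext => x; rewrite cell_avgZ//; ring.
rewrite norm1Z; last by apply: measurable_funB; [exact: mint|exact: mavg].
apply: le_trans (_ : (`|c|%:E * (e / (`|c| + 1))%:E <= _)%E).
  by apply: lee_wpmul2l; rewrite ?lee_fin.
rewrite -EFinM lee_fin mulrA ler_pdivrMr ?ltr_wpDl//.
by rewrite mulrC ler_pM2l// lerDl.
Qed.

Lemma avg_cvg0 : avg_cvg (fun=> 0).
Proof.
have h0 : mu.-integrable setT (EFin \o (fun=> 0 : R) : X -> \bar R).
  exact: integrable0.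
split => // e e0; exists 0%N => n _.
rewrite /norm1 integral0_eq ?lee_fin ?ltW// => x _.
by rewrite /cell_avg Rintegral_cst ?mul0r ?mulr0 ?subrr ?normr0//;
  exact: measurable_cell.
Qed.

Lemma integrable_indic_lty A : measurable A -> (mu A < +oo)%E ->
  mu.-integrable setT (EFin \o \1_A).
Proof.
move=> mA Aoo; apply/integrableP; split.
  by apply/measurable_EFinP; exact: measurable_indic.
by rewrite -[ltLHS]/(norm1 mu \1_A) norm1_indic.
Qed.

Lemma norm1_indic_sub A B : measurable A -> measurable B -> B `<=` A ->
  norm1 mu (fun x => \1_A x - \1_B x) = mu (A `\` B).
Proof.
move=> mA mB BA; rewrite -norm1_indic; last exact: measurableD.
by apply: eq_integral => x _; rewrite indic_setD.
Qed.

(** Continuity from above for the sets [V k] of points of [U] missed by some [D n] with [n >= k]: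
    they decrease to the empty set, and [U] has finite measure. *)
Lemma small_tail (D : nat -> set X) U : measurable U -> (mu U < +oo)%E ->
  (forall n, measurable (D n)) ->
  (forall x, U x -> exists n0, forall n, (n0 <= n)%N -> D n x) ->
  forall e, 0 < e -> exists n0, forall n, (n0 <= n)%N -> (mu (U `\` D n) <= e%:E)%E.
Proof.
move=> mU Uoo mD UD e e0.
pose V k := \bigcup_(n in [set n | (k <= n)%N]) (U `\` D n).
have mV k : measurable (V k).
  by apply: bigcup_measurable => n _; exact: measurableD.
have VU k : V k `<=` U by move=> x [n _ []].
have V0 : \bigcap_k V k = set0.
  rewrite -subset0 => x Vx; have Ux := VU 0%N _ (Vx 0%N I).
  have [n0 hn0] := UD x Ux; have [n /= nn [_ ]] := Vx n0 I.
  by apply; exact: hn0.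
have Vlt k : (mu (V k) < +oo)%E.
  by apply: le_lt_trans Uoo; apply: le_measure; rewrite ?inE.
have : (mu \o V) x @[x --> \oo] --> mu (\bigcap_k V k).
  apply: nonincreasing_cvg_mu => //.
    by rewrite V0; exact: measurable0.
  move=> n m nm; apply/subsetPset => x [i /= mi Dx]; exists i => //=.
  exact: leq_trans mi.
rewrite V0 measure0 => /fine_cvgP[_ /cvgrPdist_le/(_ e e0)[n0 _ hn0]].
exists n0 => n nn; have /= := hn0 _ nn.
rewrite sub0r normrN ger0_norm ?fine_ge0// => h.
apply: (@le_trans _ _ (mu (V n))).
  apply: le_measure; rewrite ?inE//; first exact: measurableD.
  by move=> x Dx; exists n => /=.
by rewrite -[leLHS]fineK ?lee_fin// ge0_fin_numE.
Qed.

(** Let [D n] be the union of the cells contained in [U]. Its indicator is constant on cells, hence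
    equal to its own average, so the error is at most twice [mu (U \ D n)]. Around a point of [U]
    some ball lies in [U], and small cells of that point lie in this ball. *)
Lemma avg_cvg_qopen U : qopen rho U -> (mu U < +oo)%E -> avg_cvg \1_U.
Proof.
move=> oU Uoo; have mU := opens_measurable hX oU.
pose S n := [set z | p n @^-1` [set z] `<=` U].
pose D n := p n @^-1` (S n).
have mD n : measurable (D n) by exact: mp.
have DU n : D n `<=` U by move=> x; apply.
have Doo n : (mu (D n) < +oo)%E.
  by apply: le_lt_trans Uoo; apply: le_measure; rewrite ?inE//; exact: DU.
have iU := integrable_indic_lty mU Uoo.
have iD n := integrable_indic_lty (mD n) (Doo n).
have avgD n x : avg n \1_(D n) x = \1_(D n) x.
  apply: cell_avg_cst => // y; rewrite !indicE.
  have [Dx|nDx] := pselect (D n x).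
    by rewrite (mem_set Dx) /cell /= => yx; rewrite mem_set// /D /= yx.
  by rewrite (memNset nDx) /cell /= => yx; rewrite memNset// /D /= yx.
split=> // e e0; have e2 : 0 < e / 2 by rewrite divr_gt0.
have [n0 hn0] : exists n0, forall n, (n0 <= n)%N ->
    (mu (U `\` D n) <= (e / 2)%:E)%E.
  apply: small_tail => // x Ux; have [r r0 rU] := oU x Ux.
  have [n0 hn0] := mesh r0; exists n0 => n /hn0 /(_ x) h.
  exact: subset_trans h rU.
exists n0 => n /hn0 hn.
rewrite (_ : (fun x => _) = (fun x => (\1_U x - \1_(D n) x) +
   (-1) * avg n (fun x => \1_U x - \1_(D n) x) x)); last first.
  by apply/funext => x; rewrite cell_avgB// avgD; ring.
have m1 : measurable_fun setT (fun x => \1_U x - \1_(D n) x : R).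
  by apply: measurable_funB; exact: measurable_indic.
have m2 : measurable_fun setT
    (fun x => (-1) * avg n (fun x => \1_U x - \1_(D n) x) x).
  by apply: measurable_funM => //; exact: mavg.
apply: le_trans (le_norm1D _ m1 m2) _.
rewrite norm1Z; last exact: mavg.
rewrite normrN1 mul1e.
have -> : e%:E = ((e / 2)%:E + (e / 2)%:E)%E.
  by rewrite -!EFinD; congr EFin; field.
rewrite leeD ?norm1_indic_sub//.
apply: le_trans (le_norm1_cell_avg (@cp n) (mp n) (@p0 n) _) _.
  exact: integrableB_EFin measurableT iU (iD n).
by rewrite norm1_indic_sub.
Qed.

Lemma qopen_setI : setI_closed (qopen rho).
Proof.
move=> U V oU oV x [/oU[r r0 rU] /oV[s s0 sV]].
exists (Num.min r s); first by rewrite lt_min r0.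
move=> y xy; split; [apply: rU|apply: sV];
  by apply: lt_le_trans xy _; rewrite ge_min lexx ?orbT.
Qed.

(** Balls of a quasi-metric need not be open, so these interiors serve as an exhaustion of [X] by
    open sets of finite measure. *)
Definition qball_interior (m : nat) : set X :=
  [set x | exists2 r, 0 < r & qball rho x r `<=` qball rho point (2 ^+ m * 1)].

Let pow0 m : 0 < 2 ^+ m * 1 :> R.
Proof. by rewrite mulr_gt0// exprn_gt0. Qed.

Lemma qball_interior_open m : qopen rho (qball_interior m).
Proof.
have [A A1 hA] := quasi_metric_const hX.
have A0 : 0 < A by exact: lt_le_trans A1.
move=> x [r r0 rB]; pose e := r / (2 * A).
have e0 : 0 < e by rewrite divr_gt0// mulr_gt0.
exists e => // y xy; exists e => //; apply: subset_trans rB.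
rewrite (_ : r = A * (e + e)); last by rewrite /e; field; rewrite gt_eqF.
by apply: (qball_sub_scale hX hA A0); rewrite (rho_sym hX) ltW.
Qed.

Lemma qball_interior_sub m :
  qball_interior m `<=` qball rho point (2 ^+ m * 1).
Proof. by move=> x [r r0]; apply; exact: (qball_center hX). Qed.

Lemma measurable_qball_interior m : measurable (qball_interior m).
Proof. exact: (opens_measurable hX (@qball_interior_open m)). Qed.

Lemma qball_interior_lty m : (mu (qball_interior m) < +oo)%E.
Proof.
apply: le_lt_trans (qball_lty hX point (pow0 m)).
apply: le_measure; rewrite ?inE; [exact: measurable_qball_interior| |].
  exact: measurable_qball hX _ _ _.
exact: qball_interior_sub.
Qed.

Lemma qball_interior_cover x :
  exists n0, forall n, (n0 <= n)%N -> qball_interior n x.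
Proof.
have [A A1 hA] := quasi_metric_const hX.
have A0 : 0 < A by exact: lt_le_trans A1.
pose t := A * (rho x point + 1).
have t0 : 0 <= t.
  by apply: mulr_ge0; [exact: ltW|apply: addr_ge0 => //; exact: (rho_ge0 hX)].
exists (Num.Def.archi_bound t) => n tn; exists 1 => //.
apply: (@subset_trans _ (qball rho point t)).
  exact: (qball_sub_scale hX hA A0).
apply: qball_le; rewrite mulr1 ltW// (lt_le_trans (archi_boundP t0))//.
by rewrite -natrX ler_nat (leq_trans tn)// ltnW// ltn_expl.
Qed.

Lemma mu_setI_lty (A B : set X) : measurable A -> measurable B ->
  (mu B < +oo)%E -> (mu (A `&` B) < +oo)%E.
Proof.
move=> mA mB; apply: le_lt_trans; apply: le_measure; rewrite ?inE//.
exact: measurableI.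
Qed.

Lemma avg_cvg_indic_limit (D : nat -> set X) A : measurable A ->
  (mu A < +oo)%E -> (forall n, measurable (D n)) -> (forall n, D n `<=` A) ->
  (forall x, A x -> exists n0, forall n, (n0 <= n)%N -> D n x) ->
  (forall n, avg_cvg \1_(D n)) -> avg_cvg \1_A.
Proof.
move=> mA Aoo mD DA cA cD; apply: avg_cvg_closed.
  exact: integrable_indic_lty.
move=> e e0; have [n0 /(_ n0 (leqnn _)) hn0] := small_tail mA Aoo mD cA e0.
by exists \1_(D n0) => //; rewrite norm1_indic_sub.
Qed.

(** Dynkin's lambda-system argument from the open sets, which are stable under intersection. Cutting
    with [qball_interior m] keeps the indicators integrable, so that differences and increasing
    limits are allowed. *)
Lemma borel_avg_cvg E : <<s qopen rho >> E -> measurable E /\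
  forall m, avg_cvg \1_(E `&` qball_interior m).
Proof.
pose H := [set E | measurable E /\
  forall m, avg_cvg \1_(E `&` qball_interior m)].
suff : <<s qopen rho >> `<=` H by apply.
apply: lambda_system_subset => //.
- exact: qopen_setI.
- split => //.
  + split; first exact: measurableT.
    by move=> m; rewrite setTI; apply: avg_cvg_qopen;
      [exact: qball_interior_open|exact: qball_interior_lty].
  + move=> A B BA [mA cA] [mB cB]; split; first exact: measurableD.
    move=> m; rewrite (_ : \1__ = (fun x => \1_(A `&` qball_interior m) x -
       \1_(B `&` qball_interior m) x)); first exact: avg_cvgB.
    apply/funext => x; rewrite -indic_setD; last exact: setSI.
    by congr (\1_ _ x); apply/seteqP; split => y /=;
      [move=> [[Ay By] Oy]; split => // -[]|move=> [[Ay Oy] h]; split => //;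
       split => // By; exact: h].
  + move=> F ndF FH; have mF n : measurable (F n) by case: (FH n).
    split; first exact: bigcup_measurable.
    move=> m; apply: (@avg_cvg_indic_limit (fun n => F n `&` qball_interior m)).
    * apply: measurableI; first exact: bigcup_measurable.
      exact: measurable_qball_interior.
    * apply: mu_setI_lty; [exact: bigcup_measurable|
        exact: measurable_qball_interior|exact: qball_interior_lty].
    * by move=> n; apply: measurableI => //; exact: measurable_qball_interior.
    * by move=> n x [Fx Ox]; split => //; exists n.
    * move=> x [[n _ Fx] Ox]; exists n => k nk; split => //.
      by have /subsetPset := ndF _ _ nk; apply.
    * by move=> n; case: (FH n) => _; apply.
- move=> U oU; split; first exact: (opens_measurable hX oU).
  move=> m; apply: avg_cvg_qopen.
    by apply: qopen_setI => //; exact: qball_interior_open.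
  apply: mu_setI_lty; [exact: (opens_measurable hX oU)|
    exact: measurable_qball_interior|exact: qball_interior_lty].
Qed.

(** Borel regularity gives a Borel superset of the same finite measure, hence an indicator equal to
    that of [A] in L^1. *)
Lemma avg_cvg_indic A : measurable A -> (mu A < +oo)%E -> avg_cvg \1_A.
Proof.
move=> mA Aoo; have [E [bE AE EA]] := borel_regular hX mA.
have [mE cE] := borel_avg_cvg bE.
have Eoo : (mu E < +oo)%E by rewrite EA.
have {}cE : avg_cvg \1_E.
  apply: (@avg_cvg_indic_limit (fun n => E `&` qball_interior n)) => //.
    by move=> n; apply: measurableI => //; exact: measurable_qball_interior.
  move=> x Ex; have [n0 h] := qball_interior_cover x.
  by exists n0 => n /h.
apply: avg_cvg_closed; first exact: integrable_indic_lty.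
move=> e e0; exists \1_E => //.
rewrite (_ : norm1 _ _ = mu (E `\` A)); last first.
  rewrite -norm1_indic_sub//; apply: eq_integral => x _.
  by rewrite distrC.
have -> : mu (E `\` A) = 0%E; last by rewrite lee_fin ltW.
rewrite measureD// setIidr//.
apply: etrans (congr1 (fun z => z - mu A)%E EA) _.
by apply: subee; rewrite ge0_fin_numE.
Qed.

Lemma avg_cvg_sum (I : Type) (s : seq I) (F : I -> X -> R) :
  (forall i, avg_cvg (F i)) -> avg_cvg (fun x => \sum_(i <- s) F i x).
Proof.
move=> cF; elim: s => [|i s ih].
  by rewrite (_ : (fun x => _) = fun=> 0);
    [exact: avg_cvg0|apply/funext => x; rewrite big_nil].
rewrite (_ : (fun x => _) =
    (fun x => F i x - (-1) * \sum_(i <- s) F i x)); last first.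
  by apply/funext => x; rewrite big_cons mulN1r opprK.
by apply: avg_cvgB => //; exact: avg_cvgZ.
Qed.

Lemma sfun_avg_cvg (f : {sfun X >-> R}) :
  mu.-integrable setT (EFin \o (f : X -> R)) -> avg_cvg (f : X -> R).
Proof.
move=> hf; have -> : (f : X -> R) = (fun x =>
   \sum_(y <- finmap.enum_fset (fset_set (range f))) y * \1_(f @^-1` [set y]) x).
  by apply/funext => x; rewrite {1}fimfunE fsbig_finite.
apply: avg_cvg_sum => y.
have mA : measurable (f @^-1` [set y]) by exact: measurable_funPTI.
have [->|y0] := eqVneq y 0.
  by rewrite (_ : (fun x => _) = fun=> 0);
    [exact: avg_cvg0|apply/funext => x; rewrite mul0r].
apply: avg_cvgZ; apply: avg_cvg_indic => //.
(* Chebyshev's inequality: a level set of an integrable simple function at a nonzero value has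
   finite measure. *)
have : (`|y|%:E * mu (f @^-1` [set y]) <= norm1 mu f)%E.
  rewrite -norm1_indic// -norm1Z; last exact: measurable_indic.
  apply: ge0_le_integral => //.
  - by apply: measurable_EFin_normr; apply: measurable_funM => //;
      exact: measurable_indic.
  - exact: measurable_EFin_normr.
  - move=> x _; rewrite lee_fin indicE.
    case: (boolP (x \in _)) => [/set_mem/= ->|_]; first by rewrite mulr1.
    by rewrite mulr0 normr0.
move=> /le_lt_trans/(_ (norm1_lty hf)).
by move: (mu _) => [r| |]//; rewrite ?ltry// gt0_muley ?lte_fin ?normr_gt0.
Qed.

Lemma integrable_avg_cvg (f : X -> R) : mu.-integrable setT (EFin \o f) -> avg_cvg f.
Proof.
move=> hf; apply: avg_cvg_closed => // e e0.
have [g [ig _ gf]] := approximation_sfun_integrable measurableT hf.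
have /fine_cvgP[hfin /cvgrPdist_le/(_ e e0)[n0 _ hn0]] := gf.
case: hfin => n1 _ hn1.
pose n := maxn n0 n1.
exists (g n); last first.
  have := hn0 n (leq_maxl _ _); have := hn1 n (leq_maxr _ _).
  move=> /fineK hE; rewrite -[norm1 _ _]hE lee_fin sub0r normrN.
  by apply: le_trans; exact: ler_norm.
apply: sfun_avg_cvg; exact: ig.
Qed.

End differentiation.

(** * Weights *)

Section weights.
Context (R : realType) (disp : measure_display) (X : measurableType disp)
  (rho : X -> X -> R) (mu : {measure set X -> \bar R}) (w : X -> R).
Hypothesis hX : homogeneous_type rho mu.
Hypothesis hw : A2_weight rho mu w.

Let mB x r : 0 < r -> measurable (qball rho x r).
Proof. exact: measurable_qball hX _ _. Qed.

Let isB x r : 0 < r -> Defs.is_ball rho (qball rho x r).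
Proof. by move=> r0; exists x, r. Qed.

Let pow0 k : 0 < 2 ^+ k * 1 :> R.
Proof. by rewrite mulr_gt0// exprn_gt0. Qed.

Lemma loc_integrable_measurable (f : X -> R) : loc_integrable rho mu f ->
  measurable_fun setT f.
Proof.
move=> hf; rewrite -(bigcup_qball hX point ltr01).
apply/measurable_fun_bigcup => k; first exact: mB.
by apply/measurable_EFinP; apply: measurable_int (hf _ (isB _ (pow0 k))).
Qed.

Lemma weight_ge0 x : 0 <= w x. Proof. by case: hw. Qed.

Lemma weight_integrable x r : 0 < r ->
  mu.-integrable (qball rho x r) (EFin \o w).
Proof. by move=> r0; case: hw => _ + _ _; apply; exact: isB. Qed.

Lemma measurable_weight : measurable_fun setT w.
Proof. by apply: loc_integrable_measurable; case: hw. Qed.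

Lemma measurable_weightV : measurable_fun setT (fun x => (w x)^-1).
Proof.
rewrite (_ : (fun x => _) = (fun x => w x `^ (-1))); last first.
  by apply/funext => x; rewrite powR_inv1// weight_ge0.
by apply: (measurableT_comp (measurable_powR _)); exact: measurable_weight.
Qed.

Lemma measurable_weighteV : measurable_fun setT (fun x => ((w x)%:E)^-1%E).
Proof.
rewrite (_ : (fun x => _) =
    (fun x => if w x == 0 then +oo%E else ((w x)^-1)%:E)); last first.
  by apply/funext => x; rewrite inver.
apply: measurable_fun_ifT => //.
- by apply: measurable_fun_eqr => //; exact: measurable_weight.
- by apply/measurable_EFinP; exact: measurable_weightV.
Qed.

Let subB k l : (k <= l)%N ->
  qball rho point (2 ^+ k * 1) `<=` qball rho point (2 ^+ l * 1).
Proof. by move=> kl; apply: qball_le; rewrite !mulr1 ler_weXn2l// ler1n. Qed.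

Lemma weight_ball_large : exists k0, forall k, (k0 <= k)%N ->
  (0 < \int[mu]_(x in qball rho point (2 ^+ k * 1)) (w x)%:E)%E.
Proof.
have mw := measurable_weight.
have [k0 hk0] : exists k0,
    (0 < \int[mu]_(x in qball rho point (2 ^+ k0 * 1)) (w x)%:E)%E.
  apply: contrapT => h.
  have {}h k : (\int[mu]_(x in qball rho point (2 ^+ k * 1)) (w x)%:E = 0)%E.
    apply/eqP; rewrite eq_le integral_ge0 ?andbT; last first.
      by move=> x _; rewrite lee_fin weight_ge0.
    by rewrite leNgt; apply/negP => h0; apply: h; exists k.
  case: hw => w0 _ + _; rewrite -(bigcup_qball hX point ltr01).
  have := @ge0_nondecreasing_set_cvg_integral _ _ _
    (fun k => qball rho point (2 ^+ k * 1)) (EFin \o w) mu.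
  move=> /(_ _ _ _ _)/cvg_lim <-//.
  - by rewrite (_ : (fun k => _) = cst 0%E) ?lim_cst ?ltxx//;
      apply/funext => k; exact: h.
  - by move=> k l kl; apply/subsetPset; exact: subB.
  - by move=> k; exact: mB.
  - by move=> k; apply/measurable_EFinP; exact: measurable_funTS.
  - by move=> k x _; rewrite lee_fin w0.
exists k0 => k kk0; apply: lt_le_trans hk0 _.
apply: ge0_subset_integral; [exact: mB|exact: mB| | |exact: subB].
- by apply/measurable_EFinP; exact: measurable_funTS.
- by move=> x _; rewrite lee_fin weight_ge0.
Qed.

Lemma A2_const : exists2 K : R, 1 <= K & forall x r, 0 < r ->
  (eaverage mu (qball rho x r) (EFin \o w) *
   eaverage mu (qball rho x r) (fun y => ((w y)%:E)^-1%E) <= K%:E)%E.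
Proof.
case: hw => w0 _ _; set s := ereal_sup _ => soo.
exists (Num.max 1 (fine s)); first by rewrite le_max lexx.
move=> x r r0.
have hs : (eaverage mu (qball rho x r) (EFin \o w) *
   eaverage mu (qball rho x r) (fun y => ((w y)%:E)^-1%E) <= s)%E.
  by apply: ereal_sup_ubound; exists (qball rho x r) => //; exact: isB.
apply: (le_trans hs); case: (s) soo hs => [t| |]// _ _.
- by rewrite lee_fin le_max lexx orbT.
- exact: leNye.
Qed.

(** Otherwise the A_2 product on the ball would be a positive finite factor times +oo. Positivity of
    [w(B)] is what rules out the convention 0 * +oo = 0. *)
Lemma weightV_integral_lty k0 : (forall k, (k0 <= k)%N ->
  (0 < \int[mu]_(x in qball rho point (2 ^+ k * 1)) (w x)%:E)%E) ->
  forall k, (k0 <= k)%N ->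
  (\int[mu]_(x in qball rho point (2 ^+ k * 1)) ((w x)%:E)^-1 < +oo)%E.
Proof.
move=> hk k /hk; set B := qball _ _ _ => W0.
have [K K1 /(_ point _ (pow0 k))] := A2_const.
rewrite -/B /eaverage => hK.
have mB0 := qball_gt0 hX point (pow0 k); rewrite -/B in mB0.
have mBf := qball_fin_num hX point (pow0 k); rewrite -/B in mBf.
have Wf : (\int[mu]_(x in B) (w x)%:E \is a fin_num)%E.
  by apply: integrable_fin_num; [exact: mB|exact: weight_integrable].
rewrite ltNge leye_eq; apply/negP => /eqP Vy.
move: hK; rewrite Vy -(fineK mBf) -[X in (_ * X * _)%E](fineK Wf) inver.
have m0 : 0 < fine (mu B) by rewrite fine_gt0// mB0 ltey_eq mBf.
have W00 : 0 < fine (\int[mu]_(x in B) (w x)%:E)%E.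
  by rewrite fine_gt0// W0 ltey_eq Wf.
rewrite gt_eqF// -EFinM gt0_muley ?lte_fin ?invr_gt0//.
by rewrite gt0_muley ?lte_fin ?mulr_gt0 ?invr_gt0// leye_eq.
Qed.

(** The extended inverse of [w] is +oo exactly where [w] vanishes, and it is integrable on large
    balls, hence finite almost everywhere there. *)
Lemma weight_gt0_ae : {ae mu, forall x, 0 < w x}.
Proof.
have [k0 hk0] := weight_ball_large.
have hV := weightV_integral_lty hk0.
pose Z := [set x | w x = 0].
suff : mu.-negligible Z.
  apply: negligibleS => x /= /negP; rewrite -leNgt => wx.
  by apply/eqP; rewrite eq_le wx weight_ge0.
have ZU : Z `<=` \bigcup_k (Z `&` qball rho point (2 ^+ (k0 + k) * 1)).
  move=> x Zx; have : (\bigcup_k qball rho point (2 ^+ k * 1)) x.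
    by rewrite (bigcup_qball hX point ltr01).
  move=> [k _ kx]; exists k => //; split => //.
  by apply: subB kx; exact: leq_addl.
apply: (negligibleS ZU).
apply: negligible_bigcup => k.
set B := qball _ _ _.
have Bl : (\int[mu]_(x in B) ((w x)%:E)^-1 < +oo)%E.
  by apply: hV; exact: leq_addr.
have hint : mu.-integrable B (fun x => ((w x)%:E)^-1%E).
  apply/integrableP; split; first exact: measurable_funTS measurable_weighteV.
  rewrite (_ : (\int[mu]_(x in B) _)%E =
      (\int[mu]_(x in B) ((w x)%:E)^-1)%E)//.
  apply: eq_integral => x _; rewrite gee0_abs//.
  by rewrite inve_ge0 lee_fin weight_ge0.
have := integrable_ae (mB point (pow0 _)) hint.
apply: negligibleS => x /= [Zx Bx] /(_ Bx).
by rewrite inver Zx eqxx.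
Qed.

Lemma weightV_integrable x r : 0 < r ->
  mu.-integrable (qball rho x r) (EFin \o (fun y => (w y)^-1)).
Proof.
move=> r0; have [k0 hk0] := weight_ball_large.
have hV := weightV_integral_lty hk0.
have [A A1 hA] := quasi_metric_const hX.
have A0 : 0 < A by exact: lt_le_trans A1.
pose t := A * (rho x point + r).
have t0 : 0 <= t.
  by apply: mulr_ge0; [exact: ltW|apply: addr_ge0;
    [exact: (rho_ge0 hX)|exact: ltW]].
pose k := (k0 + Num.Def.archi_bound t)%N.
apply: (@integrableS _ _ _ _ (qball rho point (2 ^+ k * 1))).
- exact: mB.
- exact: mB.
- apply: (@subset_trans _ (qball rho point t)).
    exact: (qball_sub_scale hX hA A0).
  apply: qball_le; rewrite mulr1 ltW// (lt_le_trans (archi_boundP t0))//.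
  by rewrite -natrX ler_nat (leq_trans (leq_addl k0 _))// ltnW// ltn_expl.
apply: integrable_ge0_lty.
- exact: measurable_funTS measurable_weightV.
- by move=> y; rewrite invr_ge0 weight_ge0.
apply: le_lt_trans (hV k (leq_addr _ _)).
apply: ge0_le_integral; first exact: mB.
- by move=> y _; rewrite lee_fin invr_ge0 weight_ge0.
- by apply/measurable_EFinP; exact: measurable_funTS measurable_weightV.
- exact: measurable_funTS measurable_weighteV.
(* The real inverse is 0 at a zero of [w], where the extended inverse is +oo, so the former is
   dominated by the latter. *)
- move=> y _; rewrite inver; case: ifPn => // _; exact: leey.
Qed.

Lemma weight_ball_gt0 x r : 0 < r -> 0 < \int[mu]_(y in qball rho x r) w y.
Proof.
move=> r0; rewrite -lte_fin EFin_Rintegral; [|exact: mB|exact: weight_integrable].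
apply: ge0_integral_gt0; [exact: mB|exact: (qball_gt0 hX)| | |].
- exact: measurable_funTS measurable_weight.
- exact: weight_ge0.
- by apply: filterS weight_gt0_ae => y.
Qed.

Lemma weightV_ball_gt0 x r : 0 < r ->
  0 < \int[mu]_(y in qball rho x r) (w y)^-1.
Proof.
move=> r0; rewrite -lte_fin EFin_Rintegral; [|exact: mB|exact: weightV_integrable].
apply: ge0_integral_gt0; [exact: mB|exact: (qball_gt0 hX)| | |].
- exact: measurable_funTS measurable_weightV.
- by move=> y; rewrite invr_ge0 weight_ge0.
- by apply: filterS weight_gt0_ae => y wy _; rewrite invr_gt0.
Qed.

(** Almost everywhere positivity of [w] lets the real inverse replace the extended one in the A_2
    condition, so that the estimates below can be made in [R]. *)
Lemma A2_ball : exists2 K : R, 1 <= K & forall x r, 0 < r ->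
  (\int[mu]_(y in qball rho x r) w y) *
  (\int[mu]_(y in qball rho x r) (w y)^-1) <=
  K * fine (mu (qball rho x r)) ^+ 2.
Proof.
have [K K1 hK] := A2_const; exists K => // x r r0.
have := hK x r r0; rewrite /eaverage; set B := qball _ _ _.
rewrite (_ : (\int[mu]_(y in B) ((w y)%:E)^-1)%E =
    (\int[mu]_(y in B) ((w y)^-1)%:E)%E); last first.
  apply: ge0_ae_eq_integral; first exact: mB.
  - exact: measurable_funTS measurable_weighteV.
  - by apply/measurable_EFinP; exact: measurable_funTS measurable_weightV.
  - by move=> y _; rewrite inve_ge0 lee_fin weight_ge0.
  - by move=> y _; rewrite lee_fin invr_ge0 weight_ge0.
  - by apply: filterS weight_gt0_ae => y wy _; rewrite inver gt_eqF.
rewrite -EFin_Rintegral; [|exact: mB|exact: weight_integrable].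
rewrite -EFin_Rintegral; [|exact: mB|exact: weightV_integrable].
rewrite -(fineK (qball_fin_num hX x r0)) inver.
have m0 := fine_qball_gt0 hX x r0; rewrite gt_eqF// -!EFinM lee_fin -/B.
set m := fine _ in m0 *; set a := Rintegral _ _ _; set b := Rintegral _ _ _.
have -> : m^-1 * a * (m^-1 * b) = a * b / m ^+ 2 by field; rewrite gt_eqF.
by rewrite ler_pdivrMr// exprn_gt0.
Qed.

(* AM-GM: [2 * mu E <= t * w(E) + w^-1(E) / t], optimized over [t]. *)
Lemma measure_sq_le (D E : set X) : measurable D -> measurable E -> E `<=` D ->
  (mu D < +oo)%E ->
  mu.-integrable D (EFin \o w) ->
  mu.-integrable D (EFin \o (fun y => (w y)^-1)) ->
  fine (mu E) ^+ 2 <=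
    (\int[mu]_(y in E) w y) * (\int[mu]_(y in E) (w y)^-1).
Proof.
move=> mD mE ED Doo iw iv.
have iwE : mu.-integrable E (EFin \o w) by exact: integrableS iw.
have ivE : mu.-integrable E (EFin \o (fun y => (w y)^-1)) by exact: integrableS iv.
have Eoo : (mu E < +oo)%E.
  by apply: le_lt_trans Doo; apply: le_measure; rewrite ?inE.
set m := fine _; set a := Rintegral _ _ _; set b := Rintegral _ _ _.
have a0 : 0 <= a by apply: Rintegral_ge0 => y _; exact: weight_ge0.
have b0 : 0 <= b.
  by apply: Rintegral_ge0 => y _; rewrite invr_ge0; exact: weight_ge0.
have m0 : 0 <= m by exact: fine_ge0.
have amgm t : 0 < t -> 2 * m <= t * a + t^-1 * b.
  move=> t0; rewrite -lee_fin.
  have i1 : mu.-integrable E (EFin \o (fun y => t * w y + t^-1 * (w y)^-1)).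
    have := integrableD mE (integrableZl mE t iwE) (integrableZl mE t^-1 ivE).
    exact: eq_integrable.
  have -> : t * a + t^-1 * b =
      \int[mu]_(y in E) (t * w y + t^-1 * (w y)^-1).
    rewrite RintegralD//; last 2 first.
    - exact: eq_integrable (integrableZl mE t iwE).
    - exact: eq_integrable (integrableZl mE t^-1 ivE).
    by rewrite !RintegralZl.
  have -> : 2 * m = \int[mu]_(y in E) (cst 2 y) by rewrite Rintegral_cst.
  have i2 : mu.-integrable E (EFin \o (cst 2 : X -> R)).
    exact: integrable_cst_lty.
  rewrite !EFin_Rintegral//; apply: (ae_ge0_le_integral mE).
  - by move=> y _; rewrite lee_fin.
  - exact: (measurable_int _ i2).
  - move=> y _; rewrite lee_fin addr_ge0// mulr_ge0 ?invr_ge0 ?weight_ge0 ?ltW//.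
  - exact: (measurable_int _ i1).
  - apply: filterS weight_gt0_ae => y wy _; rewrite lee_fin.
    have tw : 0 < t * w y by rewrite mulr_gt0.
    have -> : t^-1 * (w y)^-1 = (t * w y)^-1 by rewrite invfM.
    rewrite -(ler_pM2r tw) [leRHS]mulrDl mulVf ?gt_eqF//.
    by rewrite -subr_ge0 (_ : _ - _ = (t * w y - 1) ^+ 2) ?sqr_ge0//; ring.
have [m_eq0|mn0] := eqVneq m 0; first by rewrite m_eq0 expr0n/= mulr_ge0.
have mp : 0 < m by rewrite lt_neqAle eq_sym mn0.
have [a_eq0|an0] := eqVneq a 0.
  (* If [w(E)] were 0, the parameter [t = (b + 1) / m] would give [2 * m <= m * b / (b + 1) <= m],
     against [0 < m]. *)
  have tb : 0 < (b + 1) / m by rewrite divr_gt0// ltr_wpDl.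
  have := amgm _ tb; rewrite a_eq0 mulr0 add0r invf_div => h.
  suff : m < m by rewrite ltxx.
  have hb : m / (b + 1) * b <= m.
    by rewrite -mulrA ler_piMr// mulrC ler_pdivrMr ?ltr_wpDl// mul1r lerDl.
  by have := le_trans h hb; lra.
have ap : 0 < a by rewrite lt_neqAle eq_sym an0.
(* The parameter [t = m / a] makes the first term equal to [m] and leaves [m <= a / m * b]. *)
have := amgm _ (divr_gt0 mp ap); rewrite divfK// invf_div => h.
have {}h : m <= a / m * b by lra.
by move: h; rewrite -(ler_pM2r mp) mulrAC divfK// expr2.
Qed.

End weights.

(** * The weighted John-Nirenberg inequality *)

Section ge0_real_integrals.
Context (R : realType) (d : measure_display) (T : measurableType d)
  (mu : {measure set T -> \bar R}).

Lemma le_ge0_integral (D : set T) (f1 f2 : T -> R) : measurable D ->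
  measurable_fun setT f1 -> measurable_fun setT f2 ->
  (forall x, 0 <= f1 x) -> (forall x, D x -> f1 x <= f2 x) ->
  (\int[mu]_(x in D) (f1 x)%:E <= \int[mu]_(x in D) (f2 x)%:E)%E.
Proof.
move=> mD m1 m2 f0 f12; apply: ge0_le_integral => //.
- by move=> x _; rewrite lee_fin.
- by apply/measurable_EFinP; exact: measurable_funTS.
- by apply/measurable_EFinP; exact: measurable_funTS.
Qed.

Lemma ge0_integral_lin (D : set T) (f1 f2 : T -> R) a b : measurable D ->
  measurable_fun setT f1 -> measurable_fun setT f2 ->
  (forall x, 0 <= f1 x) -> (forall x, 0 <= f2 x) -> 0 <= a -> 0 <= b ->
  (\int[mu]_(x in D) (a * f1 x + b * f2 x)%:E =
   a%:E * \int[mu]_(x in D) (f1 x)%:E + b%:E * \int[mu]_(x in D) (f2 x)%:E)%E.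
Proof.
move=> mD m1 m2 f10 f20 a0 b0.
have m1D : measurable_fun D (EFin \o f1).
  by apply/measurable_EFinP; exact: measurable_funTS.
have m2D : measurable_fun D (EFin \o f2).
  by apply/measurable_EFinP; exact: measurable_funTS.
rewrite -!ge0_integralZl//; [|by move=> x _; rewrite lee_fin..].
rewrite -ge0_integralD//.
- by move=> x _; rewrite -EFinM lee_fin mulr_ge0.
- by apply: emeasurable_funM.
- by move=> x _; rewrite -EFinM lee_fin mulr_ge0.
- by apply: emeasurable_funM.
Qed.

Lemma measure_avg_dist (D : set T) (g : T -> R) c : measurable D ->
  (0 < mu D < +oo)%E -> mu.-integrable D (EFin \o g) ->
  `|(fine (mu D))^-1 * \int[mu]_(x in D) g x - c| * fine (mu D) <=
  \int[mu]_(x in D) `|g x - c|.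
Proof.
move=> mD Doo ig.
have m0 : 0 < fine (mu D) by rewrite fine_gt0.
have ic : mu.-integrable D (EFin \o cst c).
  by apply: integrable_cst_lty => //; case/andP: Doo.
have i1 : mu.-integrable D (EFin \o (fun x => g x - c)).
  exact: integrableB_EFin.
have := le_normr_Rintegral mD i1; rewrite RintegralB// Rintegral_cst//.
rewrite (_ : _ - c * _ =
    ((fine (mu D))^-1 * \int[mu]_(x in D) g x - c) * fine (mu D)); last first.
  by field; rewrite gt_eqF.
by rewrite normrM [X in _ * X <= _]ger0_norm// ltW.
Qed.

(** The triangle inequality through [c]: the distance from the mean to [c] costs the same integral
    once more. This allows oscillation hypotheses with an arbitrary constant in place of the
    mean. *)
Lemma measure_avg_osc (D : set T) (g : T -> R) c : measurable D ->
  (0 < mu D < +oo)%E -> mu.-integrable D (EFin \o g) ->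
  \int[mu]_(x in D) `|g x - (fine (mu D))^-1 * \int[mu]_(x in D) g x| <=
  2 * \int[mu]_(x in D) `|g x - c|.
Proof.
move=> mD Doo ig; set a := _^-1 * _.
have icst k : mu.-integrable D (EFin \o cst k).
  by apply: integrable_cst_lty => //; case/andP: Doo.
have i1 k : mu.-integrable D (EFin \o (fun x => `|g x - k|)).
  by apply: integrable_norm; exact: (integrableB_EFin mD ig (icst k)).
apply: (@le_trans _ _ (\int[mu]_(x in D) (`|g x - c| + cst `|a - c| x))).
  apply: le_Rintegral => //.
    exact: (integrableD_EFin mD (i1 c) (icst _)).
  move=> x _ /=; rewrite (_ : g x - a = (g x - c) - (a - c)); last by ring.
  exact: ler_normB.
rewrite RintegralD// Rintegral_cst// mulr2n mulrDl mul1r lerD2l.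
exact: measure_avg_dist.
Qed.

End ge0_real_integrals.

(** * Weighted oscillation over a nested family of cells *)

Section tree.
Context (R : realType) (disp : measure_display) (X : measurableType disp)
  (rho : X -> X -> R) (mu : {measure set X -> \bar R}) (w : X -> R).
Hypothesis hX : homogeneous_type rho mu.
Hypothesis hw : A2_weight rho mu w.
Variable pi : nat -> X -> X.
Hypothesis cpi : forall i, countable (range (pi i)).
Hypothesis mpi : forall i S, measurable (pi i @^-1` S).
Hypothesis nest : forall i x y, pi i x = pi i y -> pi i.+1 x = pi i.+1 y.
Variables C1 C2 K : R.
Hypothesis C1_ge1 : 1 <= C1.
Hypothesis C2_ge1 : 1 <= C2.
Hypothesis K_ge1 : 1 <= K.
Hypothesis hC1 : forall i x, exists z r, [/\ 0 < r,
  cell (pi i) x `<=` qball rho z r &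
  fine (mu (qball rho z r)) <= C1 * fine (mu (cell (pi i) x))].
Hypothesis hC2 : forall i x,
  fine (mu (cell (pi i.+1) x)) <= C2 * fine (mu (cell (pi i) x)).
Hypothesis pi_pos : forall i x, (0 < mu (cell (pi i) x) < +oo)%E.
Hypothesis hK : forall x r, 0 < r ->
  (\int[mu]_(y in qball rho x r) w y) *
  (\int[mu]_(y in qball rho x r) (w y)^-1) <=
  K * fine (mu (qball rho x r)) ^+ 2.
Variables (g : X -> R) (N : R).
Hypothesis hg : loc_integrable rho mu g.
Hypothesis N0 : 0 < N.
Hypothesis hN : forall x r, 0 < r ->
  exists c, \int[mu]_(y in qball rho x r) `|g y - c| <=
  N * \int[mu]_(y in qball rho x r) w y.

Local Notation Q i x := (cell (pi i) x).
Local Notation m D := (fine (mu D)).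
Local Notation W D := (\int[mu]_(y in D) w y).
Local Notation V D := (\int[mu]_(y in D) (w y)^-1).
Local Notation gQ i x := (cell_avg mu (pi i) g x).

(** The A_infinity constant: [K] comes from A_2 on a ball, and [(2 * C1) ^+ 2] from comparing the
    squared measure of that ball with that of a subset filling half of a cell. *)
Let Theta := 4 * K * C1 ^+ 2.
Let K0 : 0 < K. Proof. exact: lt_le_trans K_ge1. Qed.
Let C10 : 0 < C1. Proof. exact: lt_le_trans C1_ge1. Qed.
Let C20 : 0 < C2. Proof. exact: lt_le_trans C2_ge1. Qed.
Let Theta0 : 0 < Theta. Proof. by rewrite !mulr_gt0// exprn_gt0. Qed.
Let mQ i x : measurable (Q i x). Proof. exact: measurable_cell. Qed.
Let mB x r : 0 < r -> measurable (qball rho x r).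
Proof. exact: measurable_qball hX _ _. Qed.
Let mw : measurable_fun setT w. Proof. exact: measurable_weight hX hw. Qed.
Let mv : measurable_fun setT (fun y => (w y)^-1).
Proof. exact: measurable_weightV hX hw. Qed.
Let w0 x : 0 <= w x. Proof. exact: weight_ge0 hw x. Qed.
Let v0 x : 0 <= (w x)^-1. Proof. by rewrite invr_ge0. Qed.
Let mg : measurable_fun setT g.
Proof. exact (loc_integrable_measurable hX hg). Qed.
Let mpos i x : 0 < m (Q i x). Proof. by rewrite fine_gt0. Qed.

Let intQ (f : X -> R) i x :
  (forall z r, 0 < r -> mu.-integrable (qball rho z r) (EFin \o f)) ->
  mu.-integrable (Q i x) (EFin \o f).
Proof.
move=> hf; have [z [r [r0 QB _]]] := hC1 i x.
by apply: integrableS (hf z r r0) => //; exact: mB.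
Qed.

Let intw i x : mu.-integrable (Q i x) (EFin \o w).
Proof. by apply: intQ => z r; exact: weight_integrable hw z r. Qed.
Let intv i x : mu.-integrable (Q i x) (EFin \o (fun y => (w y)^-1)).
Proof. by apply: intQ => z r; exact: weightV_integrable hX hw z r. Qed.
Let intg i x : mu.-integrable (Q i x) (EFin \o g).
Proof. by apply: intQ => z r r0; apply: hg; exists z, r. Qed.
Let intgc i x c : mu.-integrable (Q i x) (EFin \o (fun y => `|g y - c|)).
Proof.
have ic : mu.-integrable (Q i x) (EFin \o cst c).
  by apply: integrable_cst_lty => //; case/andP: (pi_pos i x).
apply: integrable_norm; exact: (integrableB_EFin (mQ i x) (intg i x) ic).
Qed.

(** With [B] the ball, [W B * V B <= K * m B ^+ 2], the measure of [B] is at most [2 * C1 * m E],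
    and [m E ^+ 2 <= W E * V E <= W E * V B]. Cancelling [V B] gives the claim. *)
Lemma tree_Ainfty i x z r (E : set X) : 0 < r ->
  Q i x `<=` qball rho z r -> m (qball rho z r) <= C1 * m (Q i x) ->
  measurable E -> E `<=` Q i x -> m (Q i x) <= 2 * m E ->
  W (qball rho z r) <= Theta * W E.
Proof.
move=> r0 QB hm mE EQ hE; set B := qball _ _ _ in QB hm *.
have EB : E `<=` B by exact: subset_trans QB.
have iw := weight_integrable hw z r0.
have iv := weightV_integrable hX hw z r0.
have h1 := measure_sq_le hX hw (mB z r0) mE EB (qball_lty hX z r0) iw iv.
have VB0 := weightV_ball_gt0 hX hw z r0; rewrite -/B in VB0.
have h2 : V E <= V B.
  by apply: Rintegral_subset => //; exact: mB.
have WE0 : 0 <= W E by apply: Rintegral_ge0 => y _.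
rewrite -(ler_pM2r VB0); apply: (le_trans (hK z r0)).
rewrite -mulrA; apply: (@le_trans _ _ (Theta * (W E * V E))); last first.
  by rewrite ler_pM2l// ler_wpM2l.
apply: (@le_trans _ _ (Theta * m E ^+ 2)); last by rewrite ler_pM2l.
rewrite -/B (_ : Theta * _ = K * (C1 * (2 * m E)) ^+ 2); last by rewrite /Theta; ring.
rewrite ler_pM2l// lerXn2r//.
- by rewrite nnegrE fine_ge0.
- by rewrite nnegrE !mulr_ge0 ?fine_ge0// ltW.
- by apply: le_trans hm _; rewrite ler_wpM2l// ltW.
Qed.

(** [L] bounds the unweighted mean oscillation; it is [2 * N * W B / m (Q i x)] for a ball [B]
    comparable to the cell. A_2 turns [W B * V B] into a squared measure, so [L ^+ 2 * V] of the
    cell is controlled by [N ^+ 2 * W B], and [tree_Ainfty] replaces [B] by the cell. *)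
Lemma tree_osc i x : exists L, [/\ 0 < L,
  \int[mu]_(y in Q i x) `|g y - gQ i x| <= L * m (Q i x) &
  L ^+ 2 * V (Q i x) <= Theta ^+ 2 * (N ^+ 2 * W (Q i x))].
Proof.
have [z [r [r0 QB hm]]] := hC1 i x; set B := qball _ _ _ in QB hm.
have WB0 := weight_ball_gt0 hX hw z r0; rewrite -/B in WB0.
have VB0 := weightV_ball_gt0 hX hw z r0; rewrite -/B in VB0.
have m0 := mpos i x.
exists (2 * N * W B / m (Q i x)); split.
- by rewrite divr_gt0// !mulr_gt0.
- rewrite divfK ?gt_eqF//; have [c hc] := hN z r0; rewrite -/B in hc.
  apply: le_trans (measure_avg_osc c (mQ i x) (pi_pos i x) (intg i x)) _.
  rewrite -mulrA ler_pM2l//; apply: le_trans hc; apply: Rintegral_subset => //.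
    exact: mB.
  have ic : mu.-integrable B (EFin \o cst c).
    by apply: integrable_cst_lty; [exact: mB|exact: qball_lty hX _ _ _].
  have ig : mu.-integrable B (EFin \o g) by apply: hg; exists z, r.
  apply: integrable_norm.
  exact: (integrableB_EFin (mB z r0) ig ic).
- have hW : W B <= Theta * W (Q i x).
    apply: (tree_Ainfty r0 QB hm) => //.
    by rewrite ler_peMl ?fine_ge0// ler1n.
  have hVQ : V (Q i x) <= V B.
    apply: Rintegral_subset => //; first exact: mB.
    exact: weightV_integrable hX hw _ _ r0.
  apply: (@le_trans _ _ ((2 * N * W B / m (Q i x)) ^+ 2 * V B)).
    by rewrite ler_wpM2l// sqr_ge0.
  rewrite (_ : _ * _ = 4 * N ^+ 2 * W B * (W B * V B) / m (Q i x) ^+ 2); last first.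
    by field; rewrite gt_eqF.
  rewrite ler_pdivrMr ?exprn_gt0//.
  apply: (@le_trans _ _ (4 * N ^+ 2 * W B * (K * (C1 * m (Q i x)) ^+ 2))).
    rewrite ler_wpM2l//; first by rewrite !mulr_ge0 ?sqr_ge0// ltW.
    apply: (le_trans (hK z r0)); rewrite ler_pM2l// lerXn2r//.
    + by rewrite nnegrE fine_ge0.
    + by rewrite nnegrE mulr_ge0 ?fine_ge0// ltW.
  rewrite (_ : 4 * _ * _ * _ =
    Theta * N ^+ 2 * W B * m (Q i x) ^+ 2); last by rewrite /Theta; ring.
  rewrite ler_pM2r ?exprn_gt0// expr2 -mulrA.
  rewrite (_ : _ * (N ^+ 2 * W B) = (Theta * N ^+ 2) * W B); last by ring.
  rewrite (_ : Theta * Theta * _ = (Theta * N ^+ 2) * (Theta * W (Q i x))); last by ring.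
  by rewrite ler_pM2l// mulr_gt0// exprn_gt0.
Qed.

Lemma tree_nested i j x : (i <= j)%N -> Q i x `<=` Q j x.
Proof.
move=> /subnKC <-; elim: (j - i)%N => [|k ih]; first by rewrite addn0.
by rewrite addnS => y /ih; rewrite /cell /=; exact: nest.
Qed.

(** By nesting a cell is a union of cells of the previous level; this is the form to which
    [le_integral_cells] applies. *)
Lemma tree_cell_preimage i x : Q i.+1 x = pi i @^-1` (pi i @` Q i.+1 x).
Proof.
apply/seteqP; split => [y xy|y [z xz /nest yz]]; first by exists y.
by rewrite /cell /= -yz.
Qed.

(** The finest averages stand in for [g]. Being constant on the cells of level 0, they are bounded
    pointwise as soon as such a cell does not stop. *)
Let e := cell_avg mu (pi 0%N) g.
Let me : measurable_fun setT e.
Proof. exact: (measurable_cell_avg mu (@mpi 0%N)). Qed.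

Definition tree_osc2 c (y : X) := (e y - c) ^+ 2 * (w y)^-1.

Let mF c : measurable_fun setT (tree_osc2 c).
Proof.
by apply: measurable_funM => //; apply: measurable_funX;
  apply: measurable_funB.
Qed.

Let F0 c y : 0 <= tree_osc2 c y.
Proof. by rewrite mulr_ge0// sqr_ge0. Qed.

Section stopping.
Variables (i : nat) (x0 : X) (t a : R).
Hypothesis t0 : 0 < t.
Hypothesis a0 : 0 <= a.

Let c := gQ i x0.
Let h y := `|g y - c|.
Let mh : measurable_fun setT h.
Proof. by apply: measurableT_comp => //; exact: measurable_funB. Qed.

(* A cell is encoded by the common value [z] of [pi j] on it. *)
Let Sj j : set X := [set z |
  t * m (pi j @^-1` [set z]) < \int[mu]_(u in pi j @^-1` [set z]) h u].

Let stop j y := t * m (Q j y) < \int[mu]_(u in Q j y) h u.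

(** All stopping cells of level at most [k], maximal or not. The inductions on [k] below select the
    maximal ones implicitly: they descend from a cell to its subcells only when the cell does not
    stop. *)
Let Om k : set X := \bigcup_(j in [set j | (j <= k)%N]) (pi j @^-1` (Sj j)).

Let mOm k : measurable (Om k).
Proof. by apply: bigcup_measurable => j _. Qed.

Let stopP j y z : Q j y z -> stop j y -> Sj j (pi j z).
Proof. by rewrite /cell /Sj /stop /= => ->. Qed.

Let Om_stop k y : stop k y -> Q k y `<=` Om k.
Proof. by move=> sy z yz; exists k => //=; exact: stopP sy. Qed.

Let OmS k : Om k `<=` Om k.+1.
Proof. by move=> y [j /= jk h1]; exists j => //=; exact: leqW. Qed.

Let Om0 y : ~ stop 0 y -> forall z, Q 0 y z -> ~ Om 0 z.
Proof.
move=> ns z yz [j /=]; rewrite leqn0 => /eqP -> sz; apply: ns.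
by move: sz yz; rewrite /Sj /stop /cell /= => + zy; rewrite zy.
Qed.

Let OmSn k y : ~ stop k.+1 y -> forall z, Q k.+1 y z -> Om k.+1 z -> Om k z.
Proof.
move=> ns z yz [j /=]; rewrite leq_eqVlt => /orP[/eqP ->|jk] sz; last first.
  by exists j.
case: ns; move: sz yz; rewrite /Sj /stop /cell /= => + zy.
by rewrite zy.
Qed.

Let intgh k y : mu.-integrable (Q k y) (EFin \o h).
Proof. exact: intgc. Qed.

(* The weak (1,1) bound of the maximal function over cells of level at most
   [k]. *)
Lemma stopping_weak k y :
  (\int[mu]_(z in Q k y) (t * \1_(Om k) z)%:E <=
   \int[mu]_(z in Q k y) (h z)%:E)%E.
Proof.
have mt k' : measurable_fun setT (fun z : X => t * \1_(Om k') z).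
  by apply: measurable_funM => //; exact: measurable_indic.
have t1 k' z : 0 <= t * \1_(Om k') z :> R by rewrite mulr_ge0// ltW.
have hs k' y' : stop k' y' ->
    (\int[mu]_(z in Q k' y') (t * \1_(Om k') z)%:E <=
     \int[mu]_(z in Q k' y') (h z)%:E)%E.
  move=> sy; apply: (@le_trans _ _ (\int[mu]_(z in Q k' y') (cst t%:E z))%E).
    apply: (@le_ge0_integral _ _ _ mu _ _ (cst t)) => //.
    by move=> z _; rewrite /= -[leRHS]mulr1 ler_pM2l.
  rewrite integral_cst// -EFin_Rintegral// -(fineK (cell_fin_num (@pi_pos k') y')).
  by rewrite -EFinM lee_fin ltW.
elim: k y => [|k ih] y.
  have [/hs//|ns] := pselect (stop 0 y).
  apply: le_ge0_integral => // z yz; rewrite indicE memNset ?mulr0 ?normr_ge0//.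
  exact: Om0 ns _ yz.
have [/hs//|ns] := pselect (stop k.+1 y).
rewrite [leLHS](_ : _ = \int[mu]_(z in Q k.+1 y) (t * \1_(Om k) z)%:E)%E; last first.
  apply: eq_integral => z; rewrite inE => yz; congr (_ * _)%:E.
  rewrite !indicE; congr (_%:R); congr nat_of_bool; apply/idP/idP.
    by move=> /set_mem/(OmSn ns yz)/mem_set.
  by move=> /set_mem/OmS/mem_set.
rewrite tree_cell_preimage; apply: (le_integral_cells (@cpi k) (mpi k)).
- exact/measurable_EFinP.
- exact/measurable_EFinP.
- by move=> z; rewrite lee_fin.
- by move=> z; rewrite lee_fin normr_ge0.
- by move=> z _; exact: ih.
Qed.

(** Parameters of the inequality [(u + v) ^+ 2 <= (1 + ep) * u ^+ 2 + (1 + ep^-1) * v ^+ 2]. The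
    factor [1 + ep] must stay close enough to 1 to be absorbed by the loss [1 - Theta^-1] of weight
    on the stopping set. *)
Let ep := Theta^-1.
Let Ce := 1 + Theta.
Let ep0 : 0 < ep. Proof. by rewrite invr_gt0. Qed.

Hypothesis IH : forall j x, (j < i)%N ->
  (\int[mu]_(y in Q j x) (tree_osc2 (gQ j x) y)%:E <=
   a%:E * \int[mu]_(y in Q j x) (w y)%:E)%E.

(** The majorant of the squared oscillation: everywhere a jump of size at most [C2 * t], and on the
    stopping set in addition the bound inherited from lower levels. *)
Let G k y := (Ce * (C2 * t) ^+ 2) * (w y)^-1 +
  ((1 + ep) * a) * (w y * \1_(Om k) y).

Let Ce0 : 0 < Ce. Proof. by rewrite addr_gt0. Qed.
Let e1 : 0 < 1 + ep. Proof. by rewrite addr_gt0. Qed.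

Let mw1 k : measurable_fun setT (fun y => w y * \1_(Om k) y).
Proof. by apply: measurable_funM => //; exact: measurable_indic. Qed.

Let w10 k y : 0 <= w y * \1_(Om k) y.
Proof. by rewrite mulr_ge0. Qed.

Let CC0 : 0 <= Ce * (C2 * t) ^+ 2.
Proof. by rewrite mulr_ge0 ?sqr_ge0// ltW. Qed.

Let ea0 : 0 <= (1 + ep) * a.
Proof. by rewrite mulr_ge0// ltW. Qed.

Let mG k : measurable_fun setT (G k).
Proof.
by apply: measurable_funD; apply: measurable_funM => //; exact: mw1.
Qed.

Let G0 k y : 0 <= G k y.
Proof. by rewrite addr_ge0// mulr_ge0. Qed.

Lemma sq_split (u v : R) :
  (u + v) ^+ 2 <= (1 + ep) * u ^+ 2 + Ce * v ^+ 2.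
Proof.
have eT : ep * Theta = 1 by rewrite mulVf// gt_eqF.
rewrite -subr_ge0 (_ : _ - _ = ep * (u - Theta * v) ^+ 2).
  by rewrite mulr_ge0 ?sqr_ge0// ltW.
have -> : ep * (u - Theta * v) ^+ 2 = ep * u ^+ 2 - 2 * (ep * Theta) * u * v +
  (ep * Theta) * Theta * v ^+ 2 by ring.
by rewrite eT /Ce; ring.
Qed.

(* A maximal stopping cell has a parent that does not stop, so that the average
   of [h] over it is at most [C2 * t]; inside it the induction hypothesis
   applies. *)
Lemma stopping_osc k y : (k <= i)%N ->
  (stop k y -> (k < i)%N /\
     \int[mu]_(z in Q k y) h z <= C2 * t * m (Q k y)) ->
  (\int[mu]_(z in Q k y) (tree_osc2 c z)%:E <=
   \int[mu]_(z in Q k y) (G k z)%:E)%E.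
Proof.
have hs k' y' : stop k' y' -> (k' < i)%N ->
    \int[mu]_(z in Q k' y') h z <= C2 * t * m (Q k' y') ->
    (\int[mu]_(z in Q k' y') (tree_osc2 c z)%:E <=
     \int[mu]_(z in Q k' y') (G k' z)%:E)%E.
  move=> sy ki hy.
  have hc : `|gQ k' y' - c| <= C2 * t.
    rewrite -(ler_pM2r (mpos k' y')); apply: le_trans hy.
    exact: (measure_avg_dist c (mQ k' y') (pi_pos k' y') (intg k' y')).
  apply: (@le_trans _ _ (\int[mu]_(z in Q k' y')
     ((1 + ep) * tree_osc2 (gQ k' y') z + (Ce * (C2 * t) ^+ 2) * (w z)^-1)%:E)%E).
    apply: le_ge0_integral => //.
      apply: measurable_funD; apply: measurable_funM => //; exact: mF.
    move=> z _; rewrite /tree_osc2 (mulrA (1 + ep)) -mulrDl ler_wpM2r//.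
    rewrite (_ : e z - c = (e z - gQ k' y') + (gQ k' y' - c)); last by ring.
    apply: le_trans (sq_split _ _) _; rewrite lerD2l ler_pM2l//.
    rewrite -[leLHS]real_normK ?num_real// lerXn2r ?nnegrE// mulr_ge0//.
      exact: ltW.
    exact: ltW.
  rewrite ge0_integral_lin//; [|exact: ltW].
  rewrite (_ : (\int[mu]_(z in Q k' y') (G k' z)%:E)%E =
    ((Ce * (C2 * t) ^+ 2)%:E * \int[mu]_(z in Q k' y') ((w z)^-1)%:E +
     ((1 + ep) * a)%:E * \int[mu]_(z in Q k' y') (w z * \1_(Om k') z)%:E)%E); last first.
    exact: ge0_integral_lin.
  rewrite addeC leeD// (_ : (\int[mu]_(z in Q k' y') (w z * _)%:E)%E =
    (\int[mu]_(z in Q k' y') (w z)%:E)%E); last first.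
    apply: eq_integral => z; rewrite inE => yz; congr EFin.
    by rewrite indicE mem_set ?mulr1//; exact: Om_stop yz.
  rewrite [((1 + ep) * a)%:E]EFinM -muleA; apply: lee_wpmul2l.
    by rewrite lee_fin ltW.
  exact: IH.
elim: k y => [|k ih] y ki hy.
  have [sy|ns] := pselect (stop 0 y); first by have [] := hy sy; exact: hs.
  (* On a finest cell that does not stop, [e] is constant and within [t] of [c], so the first term
     of [G] suffices. *)
  apply: le_ge0_integral => // z yz.
  apply: (@le_trans _ _ (Ce * (C2 * t) ^+ 2 * (w z)^-1)); last first.
    by rewrite lerDl mulr_ge0.
  rewrite ler_wpM2r//.
  have -> : e z = gQ 0 y by rewrite /e (cell_avg_eq _ _ yz).
  have hc : `|gQ 0 y - c| <= t.
    rewrite -(ler_pM2r (mpos 0%N y)).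
    apply: le_trans (measure_avg_dist c (mQ 0%N y) (pi_pos 0%N y) (intg 0%N y)) _.
    by rewrite leNgt; exact/negP.
  rewrite -[leLHS]real_normK ?num_real//.
  apply: (@le_trans _ _ ((C2 * t) ^+ 2)).
    rewrite lerXn2r//.
    - by rewrite nnegrE mulr_ge0// ltW.
    - by apply: (le_trans hc); rewrite ler_peMl// ltW.
  by rewrite ler_peMl ?sqr_ge0// lerDl ltW.
have [sy|ns] := pselect (stop k.+1 y); first by have [] := hy sy; exact: hs.
(* When the cell does not stop, it is split into cells of level [k]. Passing from [G k] to [G k.+1]
   only enlarges the majorant, since [Om] increases. *)
apply: (@le_trans _ _ (\int[mu]_(z in Q k.+1 y) (G k z)%:E)%E); last first.
  apply: le_ge0_integral => // z _; rewrite lerD2l ler_wpM2l// ler_wpM2l//.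
  rewrite !indicE; case: (boolP (z \in Om k)) => [/set_mem/OmS/mem_set -> //|_].
  by case: (_ \in _).
rewrite tree_cell_preimage; apply: (le_integral_cells (@cpi k) (mpi k)).
- exact/measurable_EFinP.
- exact/measurable_EFinP.
- by move=> z; rewrite lee_fin.
- by move=> z; rewrite lee_fin.
move=> z [u yu uz]; have -> : Q k z = Q k u by rewrite /cell uz.
apply: ih; first exact: ltnW.
move=> _; split => //.
have uy : Q k.+1 u = Q k.+1 y by exact: cell_eq.
apply: (@le_trans _ _ (\int[mu]_(v in Q k.+1 y) h v)).
  apply: Rintegral_subset => //; last by move=> v; exact: normr_ge0.
  by rewrite -uy; exact: tree_nested.
apply: (@le_trans _ _ (t * m (Q k.+1 y))); first by rewrite leNgt; exact/negP.
by rewrite -uy mulrAC [leRHS]mulrC ler_pM2l.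
Qed.

End stopping.

(** The solution [a] of the absorption equation, up to the factor [N ^+ 2]. The jumps contribute
    [(1 + Theta) * (2 * C2) ^+ 2 * Theta ^+ 2], the stopping set contributes [(1 - Theta ^- 2) * a],
    and the sum has to equal [a]. *)
Definition tree_const := Theta ^+ 2 * ((1 + Theta) * (2 * C2) ^+ 2 * Theta ^+ 2).

(* Stopping at twice the mean oscillation, [Om] fills at most half of the cell,
   hence carries at most the fraction [1 - Theta^-1] of its weight, and
   [(1 + Theta^-1) * (1 - Theta^-1) < 1] closes the induction. *)
Lemma tree_john_nirenberg i x :
  (\int[mu]_(y in Q i x) (tree_osc2 (gQ i x) y)%:E <=
   (tree_const * N ^+ 2)%:E * \int[mu]_(y in Q i x) (w y)%:E)%E.
Proof.
set a := tree_const * N ^+ 2.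
have A0 : 0 < tree_const by rewrite !mulr_gt0 ?exprn_gt0 ?mulr_gt0// addr_gt0.
have a0 : 0 <= a by rewrite mulr_ge0 ?sqr_ge0// ltW.
elim/ltn_ind: i x => i IH x.
have [L [L0 hL LV]] := tree_osc i x.
have t0 : 0 < 2 * L by rewrite mulr_gt0.
pose h y := `|g y - gQ i x|.
pose Om := \bigcup_(j in [set j | (j <= i)%N]) (pi j @^-1` [set z |
  2 * L * m (pi j @^-1` [set z]) < \int[mu]_(u in pi j @^-1` [set z]) h u]).
have mOm : measurable Om by apply: bigcup_measurable => j _; exact: mpi.
have mq := mpos i x.
(* The top cell does not stop at the height [2 * L], so the condition that [stopping_osc] puts on a
   stopping cell is vacuous for it. *)
have ns : ~ (2 * L * m (Q i x) < \int[mu]_(u in Q i x) h u).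
  apply/negP; rewrite -leNgt; apply: (le_trans hL).
  by rewrite ler_pM2r//; lra.
apply: le_trans (@stopping_osc i x _ _ t0 a0 (fun j x ji => IH j ji x) i x
  (leqnn _) (fun s => False_ind _ (ns s))) _.
rewrite -/Om.
have mE : measurable (Q i x `\` Om) by exact: measurableD.
have mI : measurable (Q i x `&` Om) by exact: measurableI.
have fin D : measurable D -> D `<=` Q i x -> mu D \is a fin_num.
  move=> mD DQ; rewrite ge0_fin_numE//; case/andP: (pi_pos i x) => _.
  by apply: le_lt_trans; apply: le_measure; rewrite ?inE.
have mQE : m (Q i x) = m (Q i x `&` Om) + m (Q i x `\` Om).
  rewrite -fineD; [|by apply: fin => // y []|by apply: fin => // y []].
  rewrite -measureU//; last by rewrite setDE setICA -setIA setICr setI0 setI0.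
  by rewrite setUIDK.
have half : m (Q i x `&` Om) * 2 <= m (Q i x).
  have := @stopping_weak i x _ t0 i x; rewrite -/Om.
  rewrite (_ : (\int[mu]_(z in Q i x) (2 * L * \1__ z)%:E)%E =
    (2 * L * m (Q i x `&` Om))%:E); last first.
    rewrite (eq_integral (fun z => (2 * L)%:E * (\1_Om z)%:E)%E); last first.
      by move=> z _; rewrite EFinM.
    rewrite ge0_integralZl//; [|by apply/measurable_EFinP;
      exact: measurable_indic|by rewrite lee_fin ltW].
    by rewrite integral_indic// setIC [RHS]EFinM fineK// fin.
  rewrite -(EFin_Rintegral (mQ i x) (intgc i x (gQ i x))) lee_fin.
  move=> /le_trans/(_ hL); rewrite (mulrC 2) -mulrA ler_pM2l//.
  by rewrite mulrC.
have WE : W (Q i x) <= Theta * W (Q i x `\` Om).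
  have [z [r [r0 QB hm]]] := hC1 i x.
  apply: (@le_trans _ _ (W (qball rho z r))).
    apply: Rintegral_subset => //; first exact: mB.
    exact: weight_integrable hw z r r0.
  apply: (tree_Ainfty r0 QB hm) => //.
  by move: half; rewrite mQE => ?; lra.
have WQE : W (Q i x) = W (Q i x `&` Om) + W (Q i x `\` Om).
  rewrite -Rintegral_setU//.
  - by rewrite setUIDK.
  - by rewrite setUIDK.
  - by apply/disj_set2P; rewrite setDE setICA -setIA setICr setI0 setI0.
rewrite ge0_integral_lin//; last 4 first.
- by apply: measurable_funM => //; exact: measurable_indic.
- by move=> y; rewrite mulr_ge0.
- by rewrite mulr_ge0 ?sqr_ge0// addr_ge0// ltW.
- by rewrite mulr_ge0// addr_ge0// invr_ge0 ltW.
rewrite (_ : (\int[mu]_(y in Q i x) (w y * \1__ y)%:E)%E =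
    (W (Q i x `&` Om))%:E); last first.
  rewrite EFin_Rintegral//; last by apply: integrableS (intw i x) => // y [].
  rewrite setIC [RHS]integral_mkcondl; apply: eq_integral => y _.
  rewrite /restrict indicE; case: ifPn => _; first by rewrite mulr1.
  by rewrite mulr0.
rewrite -!EFin_Rintegral// -!EFinM -EFinD lee_fin.
have T0 := Theta0.
apply: (@le_trans _ _ ((1 + Theta) * (2 * C2) ^+ 2 * (L ^+ 2 * V (Q i x)) +
   (1 + Theta^-1) * a * (W (Q i x) - Theta^-1 * W (Q i x)))).
  apply: lerD; first by rewrite le_eqVlt; apply/orP; left; apply/eqP; ring.
  rewrite ler_wpM2l//; first by rewrite mulr_ge0// addr_ge0// invr_ge0 ltW.
  have : Theta^-1 * W (Q i x) <= W (Q i x `\` Om) by rewrite ler_pdivrMl.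
  by rewrite [X in _ <= X - _]WQE => ?; lra.
apply: (@le_trans _ _ ((1 + Theta) * (2 * C2) ^+ 2 * (Theta ^+ 2 * (N ^+ 2 * W (Q i x))) +
   (1 + Theta^-1) * a * (W (Q i x) - Theta^-1 * W (Q i x)))).
  rewrite lerD2r ler_pM2l// mulr_gt0// ?exprn_gt0// ?mulr_gt0//.
  by rewrite addr_gt0.
rewrite le_eqVlt; apply/orP; left; apply/eqP.
by rewrite /a /tree_const; field; rewrite gt_eqF.
Qed.

End tree.

(** * From cells to balls, and from averages to the function *)

Section ball_john_nirenberg.
Context (R : realType) (disp : measure_display) (X : measurableType disp)
  (rho : X -> X -> R) (mu : {measure set X -> \bar R}) (w : X -> R).
Hypothesis hX : homogeneous_type rho mu.
Hypothesis hw : A2_weight rho mu w.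

Local Notation m D := (fine (mu D)).
Local Notation W D := (\int[mu]_(y in D) w y).
Local Notation V D := (\int[mu]_(y in D) (w y)^-1).

Let mB x r : 0 < r -> measurable (qball rho x r).
Proof. exact: measurable_qball hX _ _. Qed.
Let w0 x : 0 <= w x. Proof. exact: weight_ge0 hw x. Qed.
Let v0 x : 0 <= (w x)^-1. Proof. by rewrite invr_ge0. Qed.
Let mw : measurable_fun setT w. Proof. exact: measurable_weight hX hw. Qed.
Let mv : measurable_fun setT (fun y => (w y)^-1).
Proof. exact: measurable_weightV hX hw. Qed.

(** A_2 on the large ball, doubling of [mu], and [measure_sq_le] on the small ball chain together;
    the factor [V] of the large ball then cancels. *)
Lemma weight_doubling t : 1 <= t -> exists2 C : R, 0 < C & forall x r, 0 < r ->
  W (qball rho x (t * r)) <= C * W (qball rho x r).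
Proof.
move=> t1; have t0 : 0 < t by exact: lt_le_trans t1.
have [K K1 hK] := A2_ball hX hw; have [C C1 hC] := qball_scale hX t0.
have K0 : 0 < K by exact: lt_le_trans K1.
have C0 : 0 < C by exact: lt_le_trans C1.
exists (K * C ^+ 2) => [|x r r0]; first by rewrite mulr_gt0// exprn_gt0.
have tr0 : 0 < t * r by rewrite mulr_gt0.
have sub : qball rho x r `<=` qball rho x (t * r).
  by apply: qball_le; rewrite ler_peMl// ltW.
have VB0 := weightV_ball_gt0 hX hw x tr0.
rewrite -(ler_pM2r VB0); apply: (le_trans (hK x _ tr0)).
rewrite -(mulrA K) -(mulrA K) ler_pM2l// -mulrA.
have h1 := measure_sq_le hX hw (mB x r0) (mB x r0) (@subset_refl _ _)
  (qball_lty hX x r0) (weight_integrable hw x r0)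
  (weightV_integrable hX hw x r0).
have h2 : V (qball rho x r) <= V (qball rho x (t * r)).
  apply: Rintegral_subset; [exact: mB|exact: mB|exact: sub| |exact: v0].
  exact: weightV_integrable hX hw x _ tr0.
apply: (@le_trans _ _ (C ^+ 2 * m (qball rho x r) ^+ 2)).
  rewrite -exprMn lerXn2r//; last exact: hC.
  - by rewrite nnegrE fine_ge0.
  - by rewrite nnegrE mulr_ge0 ?fine_ge0// ltW.
rewrite ler_pM2l ?exprn_gt0//; apply: (le_trans h1).
rewrite ler_wpM2l//; apply: Rintegral_ge0 => y _; exact: w0.
Qed.

Section partition_geometry.
Variables (A s : R) (pi : nat -> X -> X).
Hypothesis A1 : 1 <= A.
Hypothesis hA : forall x y z, rho x y <= A * (rho x z + rho z y).
Hypothesis s0 : 0 < s.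
Hypothesis hpi : nested_partitions rho A s pi.

Let A0 : 0 < A. Proof. exact: lt_le_trans A1. Qed.
Let r i := s * (8 * A ^+ 3) ^+ i.
Let r0 i : 0 < r i.
Proof. by rewrite mulr_gt0// exprn_gt0// mulr_gt0// exprn_gt0. Qed.
Let c0 i : 0 < r i / (4 * A ^+ 2).
Proof. by rewrite divr_gt0// mulr_gt0// exprn_gt0. Qed.

Lemma cell_sub_qball i x : cell (pi i) x `<=` qball rho (pi i x) (2 * A * r i).
Proof.
case: hpi => _ _ _ far _ y; rewrite /cell /qball /= => yx.
by rewrite (rho_sym hX) -yx; exact: far.
Qed.

Lemma qball_sub_cell i x :
  qball rho (pi i x) (r i / (4 * A ^+ 2)) `<=` cell (pi i) x.
Proof.
case: hpi => _ _ _ _ near y; rewrite /qball /= (rho_sym hX) => /near.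
by rewrite /cell /=.
Qed.

Lemma partition_measurable_cell i x : measurable (cell (pi i) x).
Proof. by case: hpi => _ mpi _ _ _; exact: mpi. Qed.

Lemma partition_cell_lty i x : (mu (cell (pi i) x) < +oo)%E.
Proof.
have h : 0 < 2 * A * r i by apply: mulr_gt0 => //; exact: mulr_gt0.
apply: (@le_lt_trans _ _ (mu (qball rho (pi i x) (2 * A * r i)))); last first.
  exact (qball_lty hX (pi i x) h).
apply: le_measure.
- by rewrite inE; exact: partition_measurable_cell.
- by rewrite inE; exact: mB.
- exact: cell_sub_qball.
Qed.

Lemma partition_cell_gt0 i x : (0 < mu (cell (pi i) x))%E.
Proof.
apply: lt_le_trans (qball_gt0 hX (pi i x) (c0 i)) _; apply: le_measure.
- by rewrite inE; exact: mB.
- by rewrite inE; exact: partition_measurable_cell.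
- exact: qball_sub_cell.
Qed.

Lemma partition_cell_ge i x :
  m (qball rho (pi i x) (r i / (4 * A ^+ 2))) <= m (cell (pi i) x).
Proof.
have h := partition_cell_lty i x.
apply: fine_le.
- exact: qball_fin_num hX _ _ (c0 i).
- by rewrite ge0_fin_numE.
- apply: le_measure; rewrite ?inE; [exact: mB|
    exact: partition_measurable_cell|exact: qball_sub_cell].
Qed.

(* [z] lies at distance [O(r i)] of [x], so a ball of radius [O(r i)] around
   it has measure comparable with that of the cell of [x]. *)
Lemma partition_cell_compare i x z a b (C : R) : 0 < a -> 0 < b ->
  (forall x r, 0 < r -> m (qball rho x (A * (a + b) * (4 * A ^+ 2) * r)) <=
    C * m (qball rho x r)) -> 0 <= C ->
  rho z (pi i x) <= a * r i ->
  m (qball rho z (b * r i)) <= C * m (cell (pi i) x).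
Proof.
move=> a0 b0 hC C0 hz.
have ab : 0 < A * (a * r i + b * r i).
  by apply: mulr_gt0 => //; apply: addr_gt0; exact: mulr_gt0.
apply: (@le_trans _ _ (m (qball rho (pi i x) (A * (a * r i + b * r i))))).
  apply: le_fine_qball => //; first by apply: mB; exact: mulr_gt0.
  exact: (qball_sub_scale hX hA A0).
rewrite (_ : A * _ = A * (a + b) * (4 * A ^+ 2) * (r i / (4 * A ^+ 2))); last first.
  by field; rewrite gt_eqF.
apply: le_trans (hC _ _ (c0 i)) _; rewrite ler_wpM2l//.
exact: partition_cell_ge.
Qed.

End partition_geometry.

(** Truncation at [J] makes squaring Lipschitz with constant [2 * J], so that an L^1 error controls
    a difference of squares. *)
Lemma min_sq_le (a b J : R) : 0 <= a -> 0 <= b -> 0 <= J ->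
  Num.min a J ^+ 2 <= Num.min b J ^+ 2 + 2 * J * `|a - b|.
Proof.
move=> a0 b0 J0; have h : Num.min a J - Num.min b J <= `|a - b|.
  have h0 := ler_norm (a - b); have h1 := normr_ge0 (a - b).
  by have [?|?] := ltP a J; have [?|?] := ltP b J; lra.
have [hl|hl] := leP (Num.min a J) (Num.min b J).
  rewrite (@le_trans _ _ (Num.min b J ^+ 2))//.
    by rewrite lerXn2r// nnegrE le_min ?a0 ?b0.
  by rewrite lerDl !mulr_ge0.
rewrite -lerBlDl subr_sqr mulrC.
have ha : Num.min a J <= J by rewrite ge_min lexx orbT.
have hb : Num.min b J <= J by rewrite ge_min lexx orbT.
have hm : 0 <= Num.min a J + Num.min b J.
  by rewrite addr_ge0// le_min ?a0 ?b0.
by apply: ler_pM => //; lra.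
Qed.

(* Lower semicontinuity of the weighted L^2 norm under L^1 approximation. *)
Lemma L2_approx_le (B : set X) (g : X -> R) (c M : R) : measurable B ->
  measurable_fun setT g ->
  (forall d : R, 0 < d -> exists e : X -> R, [/\ measurable_fun setT e,
    (\int[mu]_(y in B) ((e y - c) ^+ 2 * (w y)^-1)%:E <= M%:E)%E &
    (\int[mu]_(y in B) `|g y - e y|%:E <= d%:E)%E]) ->
  (\int[mu]_(y in B) ((g y - c) ^+ 2 * (w y)^-1)%:E <= M%:E)%E.
Proof.
move=> mBB mg H.
(* Both the oscillation and the inverse weight are truncated at [k]. For fixed [k] the L^1
   approximation passes through, and monotone convergence then removes the truncation. *)
pose f (k : nat) y := Num.min `|g y - c| k%:R ^+ 2 * Num.min (w y)^-1 k%:R.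
have mgc : measurable_fun setT (fun y => `|g y - c|).
  by apply: measurableT_comp => //; exact: measurable_funB.
have mf k : measurable_fun setT (f k).
  apply: measurable_funM; last by apply: measurable_minr.
  by apply: measurable_funX; exact: measurable_minr.
have f0 k y : 0 <= f k y.
  by rewrite mulr_ge0 ?sqr_ge0// le_min v0 ler0n.
have fM k : (\int[mu]_(y in B) (f k y)%:E <= M%:E)%E.
  apply/lee_addgt0Pr => d d0.
  pose J : R := k.+1%:R.
  have J0 : 0 < J by rewrite ltr0n.
  (* One factor [2 * J] is the Lipschitz constant of the truncated square, the other [J] bounds the
     truncated inverse weight. Taking [J = k + 1] keeps [J] positive when [k = 0]. *)
  have dJ : 0 < d / (2 * J ^+ 2) by rewrite divr_gt0// mulr_gt0// exprn_gt0.
  have [e [me eM ge]] := H _ dJ.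
  have m1 : measurable_fun setT (fun y => (e y - c) ^+ 2 * (w y)^-1).
    by apply: measurable_funM => //; apply: measurable_funX;
      exact: measurable_funB.
  have m2 : measurable_fun setT (fun y => `|g y - e y|).
    by apply: measurableT_comp => //; exact: measurable_funB.
  apply: (@le_trans _ _ (\int[mu]_(y in B)
    (1 * ((e y - c) ^+ 2 * (w y)^-1) + (2 * J ^+ 2) * `|g y - e y|)%:E)%E).
    apply: le_ge0_integral => //.
      by apply: measurable_funD; apply: measurable_funM.
    move=> y _; rewrite mul1r.
    have kJ : k%:R <= J by rewrite ler_nat.
    have h1 : f k y <= Num.min `|g y - c| J ^+ 2 * Num.min (w y)^-1 J.
      apply: ler_pM; rewrite ?sqr_ge0 ?le_min ?v0 ?ler0n//.
      - rewrite lerXn2r ?nnegrE ?le_min ?normr_ge0 ?ler0n ?(ltW J0)//=.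
        by rewrite !ge_min lexx/= kJ orbT.
      - by rewrite !ge_min lexx/= kJ orbT.
    apply: (le_trans h1).
    have h2 := @min_sq_le `|g y - c| `|e y - c| J (normr_ge0 _) (normr_ge0 _) (ltW J0).
    have v1 : 0 <= Num.min (w y)^-1 J by rewrite le_min v0 ltW.
    apply: (le_trans (ler_wpM2r v1 h2)); rewrite mulrDl lerD//.
      apply: ler_pM; rewrite ?sqr_ge0//; last by rewrite ge_min lexx.
      rewrite -[leRHS]real_normK ?num_real// lerXn2r//.
      - by rewrite nnegrE le_min normr_ge0 ltW.
      - by rewrite ge_min lexx.
    have h3 : `| `|g y - c| - `|e y - c| | <= `|g y - e y|.
      apply: le_trans (ler_dist_dist _ _) _.
      by rewrite (_ : _ - _ = g y - e y)//; ring.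
    apply: (@le_trans _ _ (2 * J * `|g y - e y| * J)); last first.
      by rewrite le_eqVlt; apply/orP; left; apply/eqP; ring.
    apply: ler_pM => //.
    - by rewrite mulr_ge0// mulr_ge0// ltW.
    - by rewrite ler_pM2l// mulr_gt0.
    - by rewrite ge_min lexx orbT.
  rewrite ge0_integral_lin// ?mulr_ge0 ?sqr_ge0//; last first.
    by move=> y; rewrite mulr_ge0// sqr_ge0.
  rewrite mul1e leeD//.
  apply: (@le_trans _ _ ((2 * J ^+ 2)%:E * (d / (2 * J ^+ 2))%:E)%E).
    by apply: lee_wpmul2l => //; rewrite lee_fin mulr_ge0 ?sqr_ge0.
  by rewrite -EFinM lee_fin mulrC divfK// gt_eqF// mulr_gt0// exprn_gt0.
have := @cvg_monotone_convergence _ _ _ mu B mBB (fun k y => (f k y)%:E).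
have fcvg y : (f k y)%:E @[k --> \oo] --> ((g y - c) ^+ 2 * (w y)^-1)%:E.
  apply: cvg_near_cst; near=> k.
  congr EFin; rewrite /f !min_l.
  - by rewrite real_normK ?num_real.
  - near: k; exact: nbhs_infty_ger.
  - near: k; exact: nbhs_infty_ger.
move=> /(_ _ _ _) hcv.
rewrite (eq_integral (fun y => limn (fun k => (f k y)%:E))); last first.
  by move=> y _; apply/esym/cvg_lim => //; exact: fcvg.
have {}hcv := hcv _ _ _.
have {}hcv : ((fun k => \int[mu]_(y in B) (f k y)%:E) @ \oo -->
    \int[mu]_(y in B) limn (fun k => (f k y)%:E))%E.
  apply: hcv.
  - by move=> k; apply/measurable_EFinP; exact: measurable_funTS.
  - by move=> k y _; rewrite lee_fin.
  - move=> y _ k l kl; rewrite lee_fin.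
    have kl' : k%:R <= l%:R :> R by rewrite ler_nat.
    apply: ler_pM; rewrite ?sqr_ge0 ?le_min ?v0 ?ler0n//.
    + rewrite lerXn2r ?nnegrE ?le_min ?normr_ge0 ?ler0n//=.
      by rewrite !ge_min lexx/= kl' orbT.
    + by rewrite !ge_min lexx/= kl' orbT.
rewrite -(cvg_lim _ hcv)//; apply: lime_le; first exact: cvgP hcv.
by apply: nearW => k; exact: fM.
Unshelve. all: by end_near.
Qed.

(** The ball is covered by cells of scale [r], all inside a fixed dilate [B']. On each of them the
    estimate over nested cells controls the averages around the mean of the cell, and A_2 on [B']
    controls the distance from that mean to [c]. The bound is uniform in the finest mesh, which is
    then sent to 0. *)
Theorem bmo_L2 : exists2 C : R, 0 < C & forall (g : X -> R) (N : R),
  loc_integrable rho mu g -> 0 < N ->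
  (forall x r, 0 < r -> exists c, \int[mu]_(y in qball rho x r) `|g y - c| <=
    N * W (qball rho x r)) ->
  forall x r, 0 < r -> exists c,
  (\int[mu]_(y in qball rho x r) ((g y - c) ^+ 2 * (w y)^-1)%:E <=
   (C * (N ^+ 2 * W (qball rho x r)))%:E)%E.
Proof.
have [A A1 hA] := quasi_metric_const hX.
have A0 : 0 < A by exact: lt_le_trans A1.
have A20 : 0 < A ^+ 2 by rewrite exprn_gt0.
pose D := 8 * A ^+ 3.
have D0 : 0 < D by rewrite mulr_gt0// exprn_gt0.
have A31 : 1 <= A ^+ 3 by exact: exprn_ege1.
have D2 : 2 <= D by rewrite /D; lra.
have scale a b : 0 < a -> 0 < b -> exists2 C : R, 1 <= C &
    forall x r, 0 < r -> m (qball rho x (A * (a + b) * (4 * A ^+ 2) * r)) <=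
    C * m (qball rho x r).
  by move=> a0 b0; apply: (qball_scale hX); rewrite !mulr_gt0// addr_gt0.
have twoA : 0 < 2 * A by rewrite mulr_gt0.
have [C1 C11 hC1] := scale _ _ ltr01 twoA.
(* Distance from the centre of a cell to the centre of its parent, in units of the scale of the
   cell. *)
pose a2 := A * (2 * A * D + 2 * A).
have a20 : 0 < a2 by rewrite mulr_gt0// addr_gt0// mulr_gt0.
have b20 : 0 < 2 * A * D by rewrite mulr_gt0.
have [C2 C21 hC2] := scale _ _ a20 b20.
(* Distance from the centre of the given ball to the centre of a top cell that meets the ball, in
   units of [r]. *)
pose a3 := A * (1 + 2 * A).
have a30 : 0 < a3 by rewrite mulr_gt0// addr_gt0.
(* A top cell through a point of the ball stays within [4 * A ^+ 2 * r] of that point, hence within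
   [kap * r] of the centre of the ball. *)
pose kap := A * (1 + 4 * A ^+ 2).
have kap0 : 0 < kap by rewrite mulr_gt0// addr_gt0// mulr_gt0.
have kap1 : 1 <= kap.
  by rewrite /kap mulr_ege1// lerDl ltW// mulr_gt0.
have [C3 C31 hC3] := scale _ _ a30 kap0.
have C30 : 0 < C3 by exact: lt_le_trans C31.
have [K K1 hK] := A2_ball hX hw.
have K0 : 0 < K by exact: lt_le_trans K1.
have [C4 C40 hC4] := weight_doubling kap1.
pose T := tree_const C1 C2 K.
have T0 : 0 < T.
  have C10 : 0 < C1 by exact: lt_le_trans C11.
  have C20 : 0 < C2 by exact: lt_le_trans C21.
  have th0 : 0 < 4 * K * C1 ^+ 2 by rewrite !mulr_gt0// exprn_gt0.
  by rewrite /T /tree_const !mulr_gt0 ?exprn_gt0 ?mulr_gt0// addr_gt0.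
have TC0 : 0 < 2 * T + 2 * (C3 ^+ 2 * K).
  have h1 : 0 < C3 ^+ 2 * K by rewrite mulr_gt0// exprn_gt0.
  by lra.
exists ((2 * T + 2 * (C3 ^+ 2 * K)) * C4); first exact: mulr_gt0.
move=> g N hg N0 hN x0 r r0.
have kr0 : 0 < kap * r by rewrite mulr_gt0.
set B := qball rho x0 r; pose B' := qball rho x0 (kap * r).
have mBB : measurable B by exact: mB.
have mB' : measurable B' by exact: mB.
have [c hc] := hN x0 _ kr0; rewrite -/B' in hc.
exists c.
have mg : measurable_fun setT g by exact (loc_integrable_measurable hX hg).
have ig : mu.-integrable B' (EFin \o g) by apply: hg; exists x0, (kap * r).
(* The differentiation theorem asks for a globally integrable function. The cut-off changes no
   average over a cell of a point of [B], since such cells lie in [B']. *)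
pose f := g \_ B'.
have hf : mu.-integrable setT (EFin \o f).
  have := (integrable_mkcond (EFin \o g) mB').1 ig.
  by apply: eq_integrable => // y _; rewrite /f /patch /=; case: ifP.
(* With this finest scale, level [n] has scale exactly [r] for every [n], while level 0 shrinks. *)
pose s n := r * D ^- n.
have s0 n : 0 < s n by rewrite divr_gt0// exprn_gt0.
have [pi hpi] := choice (fun n => nested_partitions_exist hX A1 hA (s0 n)).
have sn n : s n * D ^+ n = r by rewrite /s divfK// gt_eqF// exprn_gt0.
have WB'0 : 0 < W B' by exact: weight_ball_gt0 hX hw _ _ kr0.
have VB'0 : 0 < V B' by exact: weightV_ball_gt0 hX hw _ _ kr0.
have mB'0 : 0 < m B' by exact: fine_qball_gt0 hX _ _ kr0.
have cellB' n x : B x -> cell (pi n n) x `<=` B'.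
  move=> Bx y yx; rewrite /B' /qball /=.
  have h1 : rho x (pi n n x) < 2 * A * r.
    by case: (hpi n) => _ _ _ + _ => /(_ n x); rewrite -/D sn.
  have h2 : rho (pi n n x) y < 2 * A * r.
    have := cell_sub_qball (hpi n) yx.
    by rewrite /qball /= -/D sn.
  apply: le_lt_trans (hA _ _ x) _; rewrite /kap -mulrA ltr_pM2l// mulrDl mul1r.
  rewrite ltrD//; apply: le_lt_trans (hA _ _ (pi n n x)) _.
  rewrite (_ : 4 * A ^+ 2 * r = A * (2 * A * r + 2 * A * r)); last by ring.
  by rewrite ltr_pM2l// ltrD.
have geo n : [/\ (forall i, countable (range (pi n i))),
    (forall i S, measurable (pi n i @^-1` S)) &
    (forall i x y, pi n i x = pi n i y -> pi n i.+1 x = pi n i.+1 y)].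
  by case: (hpi n).
have pos n i x : (0 < mu (cell (pi n i) x) < +oo)%E.
  rewrite (partition_cell_gt0 A1 (s0 n) (hpi n))/=.
  exact: (partition_cell_lty A1 (s0 n) (hpi n)).
have tree n i x : (\int[mu]_(y in cell (pi n i) x)
     (tree_osc2 mu w (pi n) g (cell_avg mu (pi n i) g x) y)%:E <=
   (T * N ^+ 2)%:E * \int[mu]_(y in cell (pi n i) x) (w y)%:E)%E.
  have [cpi mpi nest] := geo n.
  apply: (tree_john_nirenberg hX hw cpi mpi nest C11 C21 K1 _ _ (pos n) hK hg N0 hN).
  - move=> j y; exists (pi n j y), (2 * A * (s n * D ^+ j)); split.
    + by rewrite mulr_gt0// mulr_gt0// exprn_gt0.
    + exact (cell_sub_qball (hpi n) (i:=j) (x:=y)).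
    + have C10 : 0 <= C1 by exact: le_trans C11.
      apply: (partition_cell_compare A1 hA (s0 n) (hpi n) ltr01 twoA hC1) => //.
      have := qball_center hX (pi n j y) ltr01.
      case: (is_quasi_metric hX) => _ _ hz _ _.
      have /hz -> := erefl (pi n j y).
      by rewrite mul1r ltW// mulr_gt0// exprn_gt0.
  - move=> j y; set rj := s n * D ^+ j.
    have rj0 : 0 < rj by rewrite mulr_gt0// exprn_gt0.
    have rS : s n * D ^+ j.+1 = D * rj by rewrite /rj exprS; ring.
    have C20 : 0 <= C2 by exact: le_trans C21.
    have [_ _ _ far _] := hpi n.
    apply: (@le_trans _ _ (m (qball rho (pi n j.+1 y) (2 * A * D * rj)))).
      apply: le_fine_qball => //; first by rewrite mulr_gt0.
        exact: mpi.
      have := @cell_sub_qball _ _ _ (hpi n) j.+1 y.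
      by rewrite -/D rS !mulrA.
    apply: (partition_cell_compare A1 hA (s0 n) (hpi n) a20 b20 hC2) => //.
    apply: le_trans (hA _ _ y) _; rewrite -/D -/rj.
    rewrite (_ : a2 * rj = A * (2 * A * (D * rj) + 2 * A * rj)); last first.
      by rewrite /a2; ring.
    rewrite ler_pM2l// lerD//; last exact: ltW (far j y).
    by rewrite (rho_sym hX) ltW// -rS; exact: far.
(* A top cell has measure comparable to that of [B'], so its average is within a multiple of
   [N * W B' / m B'] of [c]; A_2 on [B'] absorbs the factor [V B'] after squaring. *)
have avg_close n x : B x ->
    (cell_avg mu (pi n n) g x - c) ^+ 2 * V B' <= C3 ^+ 2 * K * (N ^+ 2 * W B').
  move=> Bx; have [cpi mpi nest] := geo n.
  have mQ : measurable (cell (pi n n) x) by exact: mpi.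
  have m0 : 0 < m (cell (pi n n) x) by rewrite fine_gt0.
  have icB : mu.-integrable B' (EFin \o (fun y => `|g y - c|)).
    apply: integrable_norm.
    have ic : mu.-integrable B' (EFin \o cst c).
      by apply: integrable_cst_lty => //; exact: qball_lty hX _ _ kr0.
    exact: (integrableB_EFin mB' ig ic).
  have hm : m B' <= C3 * m (cell (pi n n) x).
    have C30' : 0 <= C3 by exact: ltW.
    have := @partition_cell_compare A (s n) (pi n) A1 hA (s0 n) (hpi n) n x x0
      a3 kap C3 a30 kap0 hC3 C30'.
    rewrite -/D sn; apply.
    apply: le_trans (hA _ _ x) _.
    rewrite (_ : a3 * r = A * (r + 2 * A * r)); last by rewrite /a3; ring.
    rewrite ler_pM2l// lerD// ltW//.
    by have [_ _ _ /(_ n x) + _] := hpi n; rewrite -/D sn.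
  have h1 : `|cell_avg mu (pi n n) g x - c| * m (cell (pi n n) x) <= N * W B'.
    apply: le_trans hc; have igQ : mu.-integrable (cell (pi n n) x) (EFin \o g).
      by apply: integrableS ig => //; exact: cellB'.
    apply: le_trans (measure_avg_dist c mQ (pos n n x) igQ) _.
    by apply: Rintegral_subset => //; exact: cellB'.
  have h2 : `|cell_avg mu (pi n n) g x - c| <= C3 * N * W B' / m B'.
    rewrite ler_pdivlMr//; apply: le_trans (ler_wpM2l (normr_ge0 _) hm) _.
    by rewrite mulrCA -mulrA ler_pM2l.
  rewrite -real_normK ?num_real//.
  apply: (@le_trans _ _ ((C3 * N * W B' / m B') ^+ 2 * V B')).
    rewrite ler_pM2r// lerXn2r// ?nnegrE//.
    by rewrite divr_ge0 ?fine_ge0// mulr_ge0 ?ltW// mulr_gt0.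
  rewrite (_ : _ * V B' = C3 ^+ 2 * N ^+ 2 * W B' * (W B' * V B') / m B' ^+ 2); last first.
    by field; rewrite gt_eqF.
  rewrite ler_pdivrMr ?exprn_gt0//.
  apply: le_trans (ler_wpM2l _ (hK x0 _ kr0)) _.
    by rewrite mulr_ge0 ?ltW// mulr_gt0// exprn_gt0.
  by rewrite le_eqVlt; apply/orP; left; apply/eqP; ring.
have est n : (\int[mu]_(y in B)
    ((cell_avg mu (pi n 0%N) g y - c) ^+ 2 * (w y)^-1)%:E <=
    ((2 * T + 2 * (C3 ^+ 2 * K)) * C4 * (N ^+ 2 * W B))%:E)%E.
  have [cpi mpi nest] := geo n.
  have mosc d : measurable_fun setT (tree_osc2 mu w (pi n) g d).
    apply: measurable_funM => //; apply: measurable_funX.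
    by apply: measurable_funB => //; exact: (measurable_cell_avg mu (mpi 0%N)).
  have osc0 d y : 0 <= tree_osc2 mu w (pi n) g d y.
    by rewrite mulr_ge0// sqr_ge0.
  pose kv := C3 ^+ 2 * K * (N ^+ 2 * W B') / V B'.
  have kv0 : 0 <= kv.
    by rewrite divr_ge0 ?ltW// mulr_gt0// mulr_gt0// exprn_gt0.
  have TN0 : 0 <= 2 * (T * N ^+ 2).
    by rewrite mulr_ge0// mulr_ge0 ?sqr_ge0// ltW.
  have kv20 : 0 <= 2 * kv by rewrite mulr_ge0.
  pose G y := (2 * (T * N ^+ 2)) * w y + (2 * kv) * (w y)^-1.
  have mG : measurable_fun setT G.
    by apply: measurable_funD; apply: measurable_funM.
  have G0 y : 0 <= G y by rewrite addr_ge0// mulr_ge0.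
  (* The union of the top cells that meet [B]: it is saturated, so the integrals can be compared
     cell by cell, and it stays inside [B']. *)
  pose U := pi n n @^-1` (pi n n @` B).
  have BU : B `<=` U by move=> y By; exists y.
  have UB' : U `<=` B'.
    move=> y [z Bz zy]; apply: (cellB' n z Bz).
    by rewrite /cell /= zy.
  have mU : measurable U by exact: mpi.
  apply: (@le_trans _ _ (\int[mu]_(y in U) (tree_osc2 mu w (pi n) g c y)%:E)%E).
    have h : measurable_fun U (EFin \o tree_osc2 mu w (pi n) g c).
      by apply/measurable_EFinP; apply: measurable_funTS; exact: mosc.
    apply: ge0_subset_integral => //.
    by move=> y _; rewrite lee_fin; exact: osc0.
  apply: (@le_trans _ _ (\int[mu]_(y in U) (G y)%:E)%E).
    apply: (le_integral_cells (cpi n) (mpi n)).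
    - exact/measurable_EFinP.
    - exact/measurable_EFinP.
    - by move=> y; rewrite lee_fin.
    - by move=> y; rewrite lee_fin.
    move=> x [z Bz zx].
    have -> : cell (pi n n) x = cell (pi n n) z by rewrite /cell -zx.
    have mQ : measurable (cell (pi n n) z) by exact: mpi.
    set d := cell_avg mu (pi n n) g z.
    apply: (@le_trans _ _ (\int[mu]_(y in cell (pi n n) z)
       (2 * tree_osc2 mu w (pi n) g d y + (2 * kv) * (w y)^-1)%:E)%E).
      apply: le_ge0_integral => //.
        by apply: measurable_funD; apply: measurable_funM => //; exact: mosc.
      move=> y _; rewrite /tree_osc2 (mulrA 2) -mulrDl ler_wpM2r//.
      set e := cell_avg _ _ _ y.
      apply: (@le_trans _ _ (2 * (e - d) ^+ 2 + 2 * (d - c) ^+ 2)).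
        rewrite -subr_ge0 (_ : _ - _ = (e - d - (d - c)) ^+ 2) ?sqr_ge0//.
        by ring.
      rewrite lerD2l ler_pM2l// /kv ler_pdivlMr//.
      exact: avg_close.
    rewrite ge0_integral_lin// ge0_integral_lin// leeD2r//.
    by rewrite EFinM -muleA; apply: lee_wpmul2l => //; exact: tree.
  apply: (@le_trans _ _ (\int[mu]_(y in B') (G y)%:E)%E).
    have h : measurable_fun B' (EFin \o G).
      by apply/measurable_EFinP; exact: measurable_funTS.
    apply: ge0_subset_integral => //.
    by move=> y _; rewrite lee_fin; exact: G0.
  rewrite ge0_integral_lin//.
  rewrite -EFin_Rintegral//; last exact: weight_integrable hw _ _ kr0.
  rewrite -EFin_Rintegral//; last exact: weightV_integrable hX hw _ _ kr0.
  rewrite -!EFinM -EFinD lee_fin.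
  rewrite (_ : 2 * kv * V B' = 2 * (C3 ^+ 2 * K * (N ^+ 2 * W B'))); last first.
    by rewrite /kv; field; rewrite gt_eqF.
  rewrite (_ : 2 * (T * N ^+ 2) * W B' + 2 * (C3 ^+ 2 * K * (N ^+ 2 * W B')) =
    (2 * T + 2 * (C3 ^+ 2 * K)) * N ^+ 2 * W B'); last by ring.
  rewrite (_ : _ * C4 * _ =
     (2 * T + 2 * (C3 ^+ 2 * K)) * N ^+ 2 * (C4 * W B)); last by ring.
  rewrite ler_pM2l; first exact: hC4.
  by apply: mulr_gt0 => //; rewrite exprn_gt0.
apply: L2_approx_le => // d d0.
have mesh e : 0 < e -> exists n0, forall n, (n0 <= n)%N ->
    forall x, cell (pi n 0%N) x `<=` qball rho x e.
  move=> e0; pose q := 4 * A ^+ 2 * r / e.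
  have q0 : 0 < q by rewrite divr_gt0// !mulr_gt0.
  have [n0 hn0] : exists n0, forall n, (n0 <= n)%N -> q < D ^+ n.
    exists (Num.Def.archi_bound q) => n qn.
    apply: (lt_le_trans (archi_boundP (ltW q0))).
    apply: (@le_trans _ _ (2 ^+ n)); last by apply: lerXn2r => //; rewrite nnegrE ltW.
    by rewrite -natrX ler_nat (leq_trans qn)// ltnW// ltn_expl.
  exists n0 => n /hn0 qn x y xy.
  have sne : 4 * A ^+ 2 * s n < e.
    rewrite /s mulrA ltr_pdivrMr ?exprn_gt0//.
    by move: qn; rewrite /q ltr_pdivrMr// (mulrC _ e).
  have h1 : rho x (pi n 0%N x) < 2 * A * s n.
    by case: (hpi n) => _ _ _ + _ => /(_ 0%N x); rewrite expr0 mulr1.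
  have h2 : rho (pi n 0%N x) y < 2 * A * s n.
    by have := cell_sub_qball (hpi n) xy; rewrite /qball /= expr0 mulr1.
  apply: lt_trans sne; apply: le_lt_trans (hA _ _ (pi n 0%N x)) _.
  rewrite (_ : 4 * A ^+ 2 * s n = A * (2 * A * s n + 2 * A * s n)); last by ring.
  by rewrite ltr_pM2l// ltrD.
have [_ /(_ d d0)[n0 /(_ n0 (leqnn _)) hn0]] := @integrable_avg_cvg _ _ _ _ _ hX
  (fun n => pi n 0%N) (fun n => let: And3 h _ _ := geo n in h 0%N)
  (fun n => let: And3 _ h _ := geo n in h 0%N) (fun n => pos n 0%N) mesh _ hf.
have [cpi mpi nest] := geo n0.
have ma h : measurable_fun setT (cell_avg mu (pi n0 0%N) h).
  exact: (measurable_cell_avg mu (mpi 0%N)).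
exists (cell_avg mu (pi n0 0%N) g); split => //.
apply: le_trans hn0; rewrite /norm1.
apply: (@le_trans _ _
    (\int[mu]_(y in B) `|f y - cell_avg mu (pi n0 0%N) f y|%:E)%E).
  rewrite le_eqVlt; apply/orP; left; apply/eqP; apply: eq_integral => y.
  rewrite inE => By.
  have fg : forall z, B' z -> f z = g z by move=> z B'z; rewrite /f patchE mem_set.
  have cB z : cell (pi n0 0%N) y z -> B' z.
    move=> yz; apply: (cellB' n0 y By).
    exact (tree_nested nest (leq0n n0) yz).
  rewrite fg; last exact: cB.
  rewrite /cell_avg (_ : \int[mu]_(z in cell (pi n0 0%N) y) f z =
     \int[mu]_(z in cell (pi n0 0%N) y) g z)//.
  by apply: eq_Rintegral => z; rewrite inE => /cB/fg.
have mf : measurable_fun setT f by apply/measurable_EFinP; exact: (measurable_int _ hf).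
apply: ge0_subset_integral => //.
by apply: measurable_EFin_normr; exact: measurable_funB.
Qed.

End ball_john_nirenberg.

(** * Atoms and the atomic space *)

Section atoms.
Context (R : realType) (disp : measure_display) (X : measurableType disp)
  (rho : X -> X -> R) (mu : {measure set X -> \bar R}) (w : X -> R).
Hypothesis hX : homogeneous_type rho mu.
Hypothesis hw : A2_weight rho mu w.

Local Notation m D := (fine (mu D)).
Local Notation W D := (\int[mu]_(y in D) w y).

Let mB x r : 0 < r -> measurable (qball rho x r).
Proof. exact: measurable_qball hX _ _. Qed.
Let w0 x : 0 <= w x. Proof. exact: weight_ge0 hw x. Qed.
Let v0 x : 0 <= (w x)^-1. Proof. by rewrite invr_ge0. Qed.
Let mw : measurable_fun setT w. Proof. exact: measurable_weight hX hw. Qed.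
Let mv : measurable_fun setT (fun y => (w y)^-1).
Proof. exact: measurable_weightV hX hw. Qed.

Lemma wmeas_ball x r : 0 < r ->
  wmeas mu w (qball rho x r) = (W (qball rho x r))%:E.
Proof.
move=> r0; rewrite EFin_Rintegral//; first exact: mB.
exact: weight_integrable hw x r r0.
Qed.

Lemma eaverage_ball (b : X -> R) x r : loc_integrable rho mu b -> 0 < r ->
  fine (eaverage mu (qball rho x r) (EFin \o b)) =
  (m (qball rho x r))^-1 * \int[mu]_(y in qball rho x r) b y.
Proof.
move=> hb r0; rewrite /eaverage -(fineK (qball_fin_num hX x r0)) inver.
rewrite gt_eqF ?(fine_qball_gt0 hX)//.
have ib : mu.-integrable (qball rho x r) (EFin \o b) by apply: hb; exists x, r.
by rewrite -EFin_Rintegral//; exact: mB.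
Qed.

Definition ball_avg (b : X -> R) x r :=
  (m (qball rho x r))^-1 * \int[mu]_(y in qball rho x r) b y.

Lemma bmo_osc_integrable (b : X -> R) x r c : loc_integrable rho mu b ->
  0 < r -> mu.-integrable (qball rho x r) (EFin \o (fun y => `|b y - c|)).
Proof.
move=> hb r0.
have ib : mu.-integrable (qball rho x r) (EFin \o b) by apply: hb; exists x, r.
have ic : mu.-integrable (qball rho x r) (EFin \o cst c).
  by apply: integrable_cst_lty; [exact: mB|exact: qball_lty hX x r r0].
by apply: integrable_norm; exact: (integrableB_EFin (mB x r0) ib ic).
Qed.

Lemma bmo_normP (b : X -> R) (N : R) : loc_integrable rho mu b ->
  (bmo_norm rho mu w b <= N%:E)%E <->
  (forall x r, 0 < r ->
    \int[mu]_(y in qball rho x r) `|b y - ball_avg b x r| <=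
    N * W (qball rho x r)).
Proof.
move=> hb.
have E x r : 0 < r -> ((wmeas mu w (qball rho x r))^-1 *
    \int[mu]_(y in qball rho x r)
      `|b y - fine (eaverage mu (qball rho x r) (EFin \o b))|%:E =
    ((W (qball rho x r))^-1 *
    \int[mu]_(y in qball rho x r) `|b y - ball_avg b x r|)%:E)%E.
  move=> r0; rewrite eaverage_ball// wmeas_ball// inver.
  rewrite gt_eqF ?(weight_ball_gt0 hX hw)// -EFin_Rintegral//; first exact: mB.
  exact: bmo_osc_integrable.
split.
- move=> h x r r0; rewrite mulrC -ler_pdivrMl ?(weight_ball_gt0 hX hw)//.
  rewrite -lee_fin -E//; apply: le_trans h; apply: ereal_sup_ubound.
  by exists (qball rho x r) => //; exists x, r.
- move=> h; apply: ge_ereal_sup => _ [B [x [r [r0 ->]]] <-].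
  by rewrite E// lee_fin ler_pdivrMl ?(weight_ball_gt0 hX hw)// mulrC h.
Qed.

Lemma bmo_norm_ge0 (b : X -> R) : loc_integrable rho mu b ->
  (0 <= bmo_norm rho mu w b)%E.
Proof.
move=> hb; apply: (@le_trans _ _ ((wmeas mu w (qball rho point 1))^-1 *
    \int[mu]_(y in qball rho point 1)
      `|b y - fine (eaverage mu (qball rho point 1) (EFin \o b))|%:E)%E).
  rewrite mule_ge0// ?inve_ge0; apply: integral_ge0 => y _;
    by rewrite lee_fin.
apply: ereal_sup_ubound; exists (qball rho point 1) => //.
by exists point, 1.
Qed.

Definition atom_on x r (a : X -> R) : Prop :=
  [/\ measurable_fun setT a, forall y, a y != 0 -> qball rho x r y,
    (\int[mu]_(y in qball rho x r) (a y)%:E = 0)%E &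
    (\int[mu]_(y in qball rho x r) (a y ^+ 2 * w y)%:E <=
       ((W (qball rho x r))^-1)%:E)%E].

Lemma L2w_norm_le B (a : X -> R) (V : R) : 0 < V ->
  (L2w_norm mu w B a <= V%:E `^ (- 2^-1))%E <->
  (\int[mu]_(y in B) (a y ^+ 2 * w y)%:E <= (V^-1)%:E)%E.
Proof.
move=> V0; rewrite /L2w_norm.
have -> : (\int[mu]_(x in B) (`|a x| ^+ 2 * w x)%:E =
    \int[mu]_(y in B) (a y ^+ 2 * w y)%:E)%E.
  by apply: eq_integral => y _; rewrite real_normK ?num_real.
have I0 : (0 <= \int[mu]_(y in B) (a y ^+ 2 * w y)%:E)%E.
  by apply: integral_ge0 => y _; rewrite lee_fin mulr_ge0// sqr_ge0.
rewrite poweR12_sqrt// poweR_EFin powRN (powR12_sqrt (ltW V0)).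
rewrite -(sqrtrV (ltW V0)); case: (integral _ _ _) I0 => [t| |]//= t0.
by rewrite !lee_fin ler_sqrt// invr_ge0 ltW.
Qed.

Lemma atomP (a : X -> R) :
  atom rho mu w a <-> exists x r, 0 < r /\ atom_on x r a.
Proof.
split.
- move=> [ma [B [[x [r [r0 ->]]] sB aB La]]]; exists x, r; split => //.
  split => //; apply/L2w_norm_le; first exact: weight_ball_gt0 hX hw _ _ r0.
  by rewrite -wmeas_ball.
- move=> [x [r [r0 [ma sB aB La]]]]; split => //.
  exists (qball rho x r); split => //; first by exists x, r.
  rewrite wmeas_ball//; apply/L2w_norm_le => //.
  exact: weight_ball_gt0 hX hw _ _ r0.
Qed.

Lemma supported_integral (B : set X) (f : X -> \bar R) :
  (forall y, f y != 0%E -> B y) -> measurable B ->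
  (\int[mu]_y f y = \int[mu]_(y in B) f y)%E.
Proof.
move=> fB mBB; rewrite [RHS]integral_mkcond; apply: eq_integral => y _.
rewrite patchE; case: ifPn => // /negP yB; apply/eqP.
by apply: contra_notT yB => /fB; rewrite inE.
Qed.

Lemma supported_integrable (B : set X) (f : X -> R) :
  (forall y, f y != 0 -> B y) -> measurable B ->
  mu.-integrable B (EFin \o f) -> mu.-integrable setT (EFin \o f).
Proof.
move=> fB mBB /(integrable_mkcond _ mBB).
apply: eq_integrable => // y _; rewrite patchE; case: ifPn => //= /negP yB.
congr EFin; apply/esym/eqP.
by apply: contra_notT yB => /fB; rewrite inE.
Qed.

Lemma supported_Rintegral (B : set X) (f : X -> R) :
  (forall y, f y != 0 -> B y) -> measurable B ->
  \int[mu]_y f y = \int[mu]_(y in B) f y.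
Proof.
by move=> fB mBB; congr fine; exact: supported_integral.
Qed.

Section pairing_on_ball.
Variables (x : X) (r : R) (a h : X -> R).
Hypothesis r0 : 0 < r.
Local Notation B := (qball rho x r).
Hypothesis ma : measurable_fun setT a.
Hypothesis mh : measurable_fun setT h.
Hypothesis ia : (\int[mu]_(y in B) (a y ^+ 2 * w y)%:E < +oo)%E.
Hypothesis ih : (\int[mu]_(y in B) (h y ^+ 2 * (w y)^-1)%:E < +oo)%E.

Let ma2 : measurable_fun setT (fun y => a y ^+ 2 * w y).
Proof. by apply: measurable_funM => //; exact: measurable_funX. Qed.
Let mh2 : measurable_fun setT (fun y => h y ^+ 2 * (w y)^-1).
Proof. by apply: measurable_funM => //; exact: measurable_funX. Qed.
Let a20 y : 0 <= a y ^+ 2 * w y. Proof. by rewrite mulr_ge0// sqr_ge0. Qed.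
Let h20 y : 0 <= h y ^+ 2 * (w y)^-1.
Proof. by rewrite mulr_ge0// sqr_ge0. Qed.

(** Where [w > 0], hence almost everywhere, the difference of the integrands is the square
    [(s * w * p - q) ^+ 2 / (2 * (s * w))] with [p] and [q] the absolute values of [a] and [h]. The
    free parameter [s] does the work of the Cauchy-Schwarz inequality. *)
Lemma amgm_integral s : 0 < s ->
  (\int[mu]_(y in B) `|a y * h y|%:E <=
   (2^-1 * s)%:E * \int[mu]_(y in B) (a y ^+ 2 * w y)%:E +
   (2^-1 * s^-1)%:E * \int[mu]_(y in B) (h y ^+ 2 * (w y)^-1)%:E)%E.
Proof.
move=> s0; have s20 : 0 <= 2^-1 * s by rewrite mulr_ge0// ltW.
have sV20 : 0 <= 2^-1 * s^-1 by rewrite mulr_ge0// invr_ge0 ltW.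
rewrite -ge0_integral_lin//; last exact: mB.
have mah : measurable_fun setT (fun y => `|a y * h y|).
  by apply: measurableT_comp => //; exact: measurable_funM.
apply: ae_ge0_le_integral; first exact: mB.
- by move=> y _; rewrite lee_fin.
- by apply/measurable_EFinP; exact: measurable_funTS.
- by move=> y _; rewrite lee_fin addr_ge0// mulr_ge0.
- apply/measurable_EFinP; apply: measurable_funTS.
  by apply: measurable_funD; exact: measurable_funM.
apply: filterS (weight_gt0_ae hX hw) => y wy _; rewrite lee_fin.
have sw : 0 < s * w y by rewrite mulr_gt0.
rewrite normrM -(real_normK (num_real (a y))) -(real_normK (num_real (h y))).
set p := `|a y|; set q := `|h y|.
rewrite -subr_ge0 (_ : _ - _ = (s * w y * p - q) ^+ 2 / (2 * (s * w y))).
  by rewrite divr_ge0 ?sqr_ge0// mulr_ge0// ltW.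
by field; rewrite !gt_eqF.
Qed.

Lemma duality_integrable : mu.-integrable B (EFin \o (fun y => a y * h y)).
Proof.
apply/integrableP; split.
  by apply/measurable_EFinP; apply: measurable_funTS; exact: measurable_funM.
apply: le_lt_trans (amgm_integral ltr01) _.
rewrite lte_add_pinfty// lte_mul_pinfty// ?lee_fin//.
all: by rewrite ?mulr_ge0 ?invr_ge0.
Qed.

End pairing_on_ball.

Lemma const_L2_lty x r c : 0 < r ->
  (\int[mu]_(y in qball rho x r) (cst c y ^+ 2 * (w y)^-1)%:E < +oo)%E.
Proof.
move=> r0; rewrite (eq_integral (fun y => (c ^+ 2)%:E * ((w y)^-1)%:E)%E);
  last by move=> y _; rewrite EFinM.
rewrite ge0_integralZl ?lee_fin ?sqr_ge0//; last 3 first.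
- exact: mB.
- by apply/measurable_EFinP; exact: measurable_funTS.
- by move=> y _; rewrite lee_fin.
rewrite -EFin_Rintegral; [by rewrite -EFinM ltry|exact: mB|].
exact: weightV_integrable hX hw x r r0.
Qed.

Lemma L2w_integrable x r (a : X -> R) : 0 < r -> measurable_fun setT a ->
  (\int[mu]_(y in qball rho x r) (a y ^+ 2 * w y)%:E < +oo)%E ->
  mu.-integrable (qball rho x r) (EFin \o a).
Proof.
move=> r0 ma aoo.
have := @duality_integrable x r a (cst 1) r0 ma (measurable_cst _) aoo
  (const_L2_lty x 1 r0).
by apply: eq_integrable; [exact: mB|move=> y _ /=; rewrite mulr1].
Qed.

(* Weighted John-Nirenberg puts [g - c] in L^2(w^-1); the AM-GM parameter
   [N * w(B)] balances it against the normalization of the atom. *)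
Theorem atom_pairing_le : exists2 C : R, 0 < C & forall (g a : X -> R) (N : R),
  loc_integrable rho mu g -> 0 < N -> (bmo_norm rho mu w g <= N%:E)%E ->
  atom rho mu w a ->
  mu.-integrable setT (EFin \o (fun y => a y * g y)) /\
  `|pairing mu a g| <= C * N.
Proof.
have [C0 C00 hC0] := bmo_L2 hX hw.
exists (2^-1 * (1 + C0)) => [|g a N hg N0 gN]; first by rewrite mulr_gt0// addr_gt0.
move=> /atomP[x [r [r0 [ma sB aB La]]]].
have [c hc] : exists c, (\int[mu]_(y in qball rho x r)
    ((g y - c) ^+ 2 * (w y)^-1)%:E <=
    (C0 * (N ^+ 2 * W (qball rho x r)))%:E)%E.
  apply: hC0 => // z s s0; exists (ball_avg g z s).
  by apply: (bmo_normP N hg).1.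
set B := qball rho x r in sB aB La hc *.
have W0 : 0 < W B by exact: weight_ball_gt0 hX hw _ _ r0.
have mBB : measurable B by exact: mB.
have mg : measurable_fun setT g by exact (loc_integrable_measurable hX hg).
have mgc : measurable_fun setT (fun y => g y - c) by exact: measurable_funB.
have aoo : (\int[mu]_(y in B) (a y ^+ 2 * w y)%:E < +oo)%E.
  by apply: le_lt_trans La _; rewrite ltry.
have goo : (\int[mu]_(y in B) ((g y - c) ^+ 2 * (w y)^-1)%:E < +oo)%E.
  by apply: le_lt_trans hc _; rewrite ltry.
have i1 : mu.-integrable B (EFin \o (fun y => a y * (g y - c))).
  exact: (duality_integrable r0 ma mgc aoo goo).
have i2 := duality_integrable r0 ma (measurable_cst c) aoo (const_L2_lty x c r0).
have iag : mu.-integrable B (EFin \o (fun y => a y * g y)).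
  have := integrableD_EFin mBB i1 i2.
  by apply: eq_integrable => // y _ /=; rewrite -mulrDr subrK.
have sag y : a y * g y != 0 -> B y.
  by rewrite mulf_eq0 negb_or => /andP[/sB].
split; first exact: supported_integrable sag mBB iag.
rewrite /pairing (supported_Rintegral sag mBB).
(* The atom has integral zero, so [g] may be replaced by [g - c]. *)
have -> : \int[mu]_(y in B) (a y * g y) = \int[mu]_(y in B) (a y * (g y - c)).
  rewrite (_ : \int[mu]_(y in B) (a y * g y) =
      \int[mu]_(y in B) (a y * (g y - c) + a y * cst c y)); last first.
    by apply: eq_Rintegral => y _ /=; rewrite -mulrDr subrK.
  rewrite RintegralD//.
  have ia := L2w_integrable r0 ma aoo.
  rewrite (_ : \int[mu]_(y in B) (a y * cst c y) = 0) ?addr0//.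
  rewrite RintegralZr//.
  have -> : \int[mu]_(y in B) a y = 0 by rewrite /Rintegral aB.
  by rewrite mul0r.
apply: (@le_trans _ _ (\int[mu]_(y in B) `|a y * (g y - c)|)).
  exact: le_normr_Rintegral.
have i1n := integrable_norm i1.
rewrite -lee_fin EFin_Rintegral//.
have s0 : 0 < N * W B by rewrite mulr_gt0.
apply: (le_trans (amgm_integral x r0 ma mgc s0)).
apply: (@le_trans _ _ ((2^-1 * (N * W B))%:E * ((W B)^-1)%:E +
   (2^-1 * (N * W B)^-1)%:E * (C0 * (N ^+ 2 * W B))%:E)%E).
  apply: leeD; apply: lee_wpmul2l => //.
  - by rewrite lee_fin mulr_ge0// ltW.
  - by rewrite lee_fin mulr_ge0// invr_ge0 ltW.
rewrite -!EFinM -EFinD lee_fin le_eqVlt; apply/orP; left; apply/eqP.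
by field; rewrite !gt_eqF.
Qed.

End atoms.

(** * Atomic series and bounded functionals *)

Section H1_space.
Context (R : realType) (disp : measure_display) (X : measurableType disp)
  (rho : X -> X -> R) (mu : {measure set X -> \bar R}) (w : X -> R).
Hypothesis hX : homogeneous_type rho mu.
Hypothesis hw : A2_weight rho mu w.

Implicit Types (F G : BMO rho mu w -> R) (l : (BMO rho mu w -> R) -> R).
Local Notation atf := (@atom_fun R disp X rho mu w).
Local Notation sumn lam := (\sum_(0 <= j <oo) `|lam j|%:E)%E.

Lemma atom_integrable (a : X -> R) (g : X -> R) : BMO rho mu w g ->
  atom rho mu w a -> mu.-integrable setT (EFin \o (fun y => a y * g y)).
Proof.
move=> [hg gb] ha; have [C _ hC] := atom_pairing_le hX hw.
have g0 := bmo_norm_ge0 hw hg.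
pose N := fine (bmo_norm rho mu w g) + 1.
have [] := hC g a N hg _ _ ha => //.
- by rewrite /N ltr_wpDl// fine_ge0.
- by rewrite /N EFinD fineK ?leeDl// ge0_fin_numE.
Qed.

Lemma bigger_bmo_norm (g : X -> R) : BMO rho mu w g ->
  exists2 N : R, 0 < N & (bmo_norm rho mu w g <= N%:E)%E.
Proof.
by move=> [hg gb]; exact: ge0_lty_bound (bmo_norm_ge0 hw hg) gb.
Qed.

Lemma atomic_decomposition_single k a : atom rho mu w a ->
  atomic_decomposition (k *: atf a) (fun n => if n is 0%N then k else 0)
    (fun=> a) /\
  sumn (fun n => if n is 0%N then k else 0) = `|k|%:E.
Proof.
move=> ha; set lam := fun n : nat => if n is 0%N then k else 0.
have s : sumn lam = `|k|%:E.
  rewrite nneseries_recl//.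
  rewrite eseries0; first by rewrite adde0.
  by case=> [|n] // _ _; rewrite normr0.
split=> //; split => //; first by rewrite s ltry.
move=> g; apply: cvg_near_cst; near=> n.
have n0 : (0 < n)%N by near: n; exact: nbhs_infty_gt.
rewrite -(prednK n0) big_nat_recl// big1 ?addr0// => i _.
by rewrite mul0r.
Unshelve. all: by end_near.
Qed.

Lemma H1_single k a : atom rho mu w a -> H1 (k *: atf a).
Proof.
by move=> /(atomic_decomposition_single k)[h _]; do 2 eexists; exact: h.
Qed.

Lemma atom0 : atom rho mu w (fun=> 0).
Proof.
apply/(atomP hX hw); exists point, 1; split => //; split => //.
- by move=> y; rewrite eqxx.
- by rewrite integral0.
- rewrite (eq_integral (cst 0%E)); last first.
    by move=> y _; rewrite expr0n/= mul0r.
  by rewrite integral0 lee_fin invr_ge0 ltW// (weight_ball_gt0 hX hw).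
Qed.

Lemma H1_0 : H1 (0 : BMO rho mu w -> R).
Proof.
by have := H1_single 0 atom0; rewrite scale0r.
Qed.

Lemma H1_dual0 l : H1_dual l -> l 0 = 0.
Proof.
move=> [lin _]; have := lin 1 0 0 H1_0 H1_0.
rewrite scale1r addr0 mul1r => /eqP.
by rewrite -subr_eq subrr eq_sym => /eqP.
Qed.

Lemma H1_dualZ l k F : H1_dual l -> H1 F -> l (k *: F) = k * l F.
Proof.
move=> hl hF; have [lin _] := hl.
by have := lin k F 0 hF H1_0; rewrite addr0 H1_dual0// addr0.
Qed.

Lemma dual_norm_ge0 l : H1_dual l -> (0 <= dual_norm l)%E.
Proof.
move=> hl; apply: ereal_sup_ubound; exists 0; last by rewrite H1_dual0// normr0.
split; first exact: H1_0.
have [h1 h2] := atomic_decomposition_single 0 atom0.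
apply: ereal_inf_le; exists 0%E; last by rewrite lee01.
exists (fun n => if n is 0%N then 0 else 0), (fun=> fun=> 0).
by split; [rewrite -[0](scale0r (atf (fun=> 0)))|rewrite h2 normr0].
Qed.

Lemma atomic_decompositionZ k F lam a : atomic_decomposition F lam a ->
  atomic_decomposition (k *: F) (fun n => k * lam n) a /\
  sumn (fun n => k * lam n) = (`|k|%:E * sumn lam)%E.
Proof.
move=> [ha hs hF]; have s : sumn (fun n => k * lam n) = (`|k|%:E * sumn lam)%E.
  rewrite -nneseriesZl//.
  by apply: eq_eseriesr => n _; rewrite normrM EFinM.
split=> //; split => //.
  by rewrite s lte_mul_pinfty.
move=> g; rewrite (_ : (fun n => _) =
    (fun n => k * \sum_(0 <= j < n) lam j * atf (a j) g)); last first.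
  by apply/funext => n; rewrite mulr_sumr; apply: eq_bigr => j _; rewrite mulrA.
by apply: cvgMr; exact: hF.
Qed.

(** Dividing [F] by the sum of its coefficients puts it in the unit ball of H^1_w. If the sum is
    zero, all coefficients vanish and so does [F]. *)
Lemma H1_dual_le l F lam a : H1_dual l -> atomic_decomposition F lam a ->
  (`|l F|%:E <= dual_norm l * sumn lam)%E.
Proof.
move=> hl hF; have [ha hs hc] := hF.
have HF : H1 F by exists lam, a.
have s0 : (0 <= sumn lam)%E by apply: nneseries_ge0 => n _ _; rewrite lee_fin.
have [s_eq0|sn0] := eqVneq (sumn lam) 0%E.
  have lam0 n : lam n = 0.
    apply/eqP; rewrite -normr_le0 -lee_fin.
    apply: (@le_trans _ _ (sumn lam)); last by rewrite s_eq0.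
    apply: le_trans (nneseries_lim_ge n.+1 _); last by move=> k _ _; rewrite lee_fin.
    by rewrite big_nat_recr//= leeDr// sume_ge0.
  have -> : F = 0.
    apply/funext => g; apply: (cvg_unique _ (hc g)) => //.
    rewrite (_ : (fun n => _) = (fun=> 0)); first exact: cvg_cst.
    by apply/funext => n; rewrite big1// => j _; rewrite lam0 mul0r.
  by rewrite H1_dual0// normr0 s_eq0 mule0.
have sf : sumn lam \is a fin_num by rewrite ge0_fin_numE.
set S := fine (sumn lam); have SE : sumn lam = S%:E by rewrite fineK.
have S0 : 0 < S by rewrite -lte_fin -SE lt0e sn0.
have [h1 h2] := atomic_decompositionZ S^-1 hF.
have : (`|l (S^-1 *: F)|%:E <= dual_norm l)%E.
  apply: ereal_sup_ubound; exists (S^-1 *: F) => //; split.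
    by exists (fun n => S^-1 * lam n), a.
  apply: ereal_inf_le; exists (sumn (fun n => S^-1 * lam n)).
    by exists (fun n => S^-1 * lam n), a.
  by rewrite h2 SE ger0_norm ?invr_ge0 ?(ltW S0)// -EFinM mulVf ?gt_eqF.
rewrite H1_dualZ// normrM ger0_norm ?invr_ge0 ?(ltW S0)// SE => h.
have S0e : (0 <= S%:E)%E by rewrite lee_fin ltW.
by have := lee_wpmul2r S0e h; rewrite -EFinM mulrAC mulVf ?gt_eqF// mul1r.
Qed.

(** The coefficients are padded with zeros, so that a finite sum is an atomic series with the same
    atoms. *)
Lemma H1_partial lam a n : (forall j, atom rho mu w (a j)) ->
  H1 (fun g => \sum_(0 <= j < n) lam j * atf (a j) g).
Proof.
move=> ha; exists (fun j => if (j < n)%N then lam j else 0), a; split => //.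
  rewrite (nneseries_split 0 n)// add0n eseries0 ?adde0; last first.
    by move=> j nj _; rewrite ltnNge nj/= normr0.
  apply: lte_sum_pinfty => j _; exact: ltry.
move=> g; apply: cvg_near_cst; near=> k.
have nk : (n <= k)%N by near: k; exact: nbhs_infty_ge.
rewrite (@big_cat_nat _ _ _ n)//= [X in _ + X]big1_seq ?addr0.
  by apply: eq_big_nat => j /andP[_ ->].
move=> j /=; rewrite mem_index_iota => /andP[nj _].
by rewrite ltnNge nj/= mul0r.
Unshelve. all: by end_near.
Qed.

Lemma atomic_decomposition_tail F lam a n : atomic_decomposition F lam a ->
  atomic_decomposition (fun g => F g - \sum_(0 <= j < n) lam j * atf (a j) g)
    (fun j => lam (j + n)%N) (fun j => a (j + n)%N).
Proof.
move=> [ha hs hF]; split => //.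
  rewrite (nneseries_addn (f := fun j => `|lam j|%:E))//.
  apply: le_lt_trans hs; rewrite [leRHS](nneseries_split 0 n)//.
  by rewrite add0n leeDr// sume_ge0.
move=> g; rewrite (_ : (fun m => _) = (fun m =>
    \sum_(0 <= j < (m + n)%N) lam j * atf (a j) g -
    \sum_(0 <= j < n) lam j * atf (a j) g)); last first.
  apply/funext => m.
  rewrite [in RHS](@big_cat_nat _ _ _ n)//= ?leq_addl// addrAC subrr add0r.
  have := @big_addn R 0 +%R 0 (m + n) n xpredT (fun j => lam j * atf (a j) g).
  by rewrite add0n addnK => ->.
apply: cvgB; last exact: cvg_cst.
by rewrite (cvg_shiftn n (fun m => \sum_(0 <= j < m) lam j * atf (a j) g)).
Qed.

Lemma H1_dual_partial l lam a n : H1_dual l -> (forall j, atom rho mu w (a j)) ->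
  l (fun g => \sum_(0 <= j < n) lam j * atf (a j) g) =
  \sum_(0 <= j < n) lam j * l (atf (a j)).
Proof.
move=> hl ha; elim: n => [|n ih].
  rewrite (_ : (fun g => _) = 0) ?big_geq ?H1_dual0//.
  by apply/funext => g; rewrite big_geq.
rewrite big_nat_recr//= -ih addrC.
rewrite -(hl.1 (lam n)).
- by congr l; apply/funext => g; rewrite big_nat_recr//= addrC.
- by rewrite -[atf _]scale1r; exact: H1_single.
- exact: H1_partial.
Qed.

(** Linearity only reaches finite sums. The remainder is itself an element of H^1_w whose
    decomposition is the tail, so its image is bounded by the dual norm times a tail of a convergent
    series. *)
Lemma H1_dual_series l F lam a : H1_dual l -> atomic_decomposition F lam a ->
  (fun n => \sum_(0 <= j < n) lam j * l (atf (a j))) @ \oo --> l F.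
Proof.
move=> hl hF; have [ha hs _] := hF.
have d0 := dual_norm_ge0 hl.
have dE : (dual_norm l = (fine (dual_norm l))%:E)%E.
  by rewrite fineK// ge0_fin_numE//; case: hl.
(* The added 1 makes the division by [M] legitimate when the dual norm is zero. *)
pose M := fine (dual_norm l) + 1.
have M0 : 0 < M by rewrite ltr_wpDl// fine_ge0.
have tail : (\sum_(n <= j <oo) `|lam j|%:E)%E @[n --> \oo] --> 0%E.
  by apply: nneseries_tail_cvg => // j _; rewrite lee_fin.
apply/cvgrPdist_le => e e0.
have eM : 0 < e / M by rewrite divr_gt0.
move/fine_cvgP : tail => [tfin /cvgrPdist_le/(_ _ eM) tl].
near=> n.
have tn : `|0 - fine (\sum_(n <= j <oo) `|lam j|%:E)%E| <= e / M.
  by near: n; exact: tl.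
have tf : (\sum_(n <= j <oo) `|lam j|%:E)%E \is a fin_num by near: n; exact: tfin.
have hT := atomic_decomposition_tail n hF.
have hP := H1_partial lam n ha.
have HT : H1 (fun g => F g - \sum_(0 <= j < n) lam j * atf (a j) g).
  by exists (fun j => lam (j + n)%N), (fun j => a (j + n)%N).
have -> : l F = l (fun g => F g - \sum_(0 <= j < n) lam j * atf (a j) g) +
    \sum_(0 <= j < n) lam j * l (atf (a j)).
  rewrite -(H1_dual_partial lam n hl ha) -[X in X + _]mul1r -(hl.1 1)//.
  by congr l; apply/funext => g; rewrite scale1r /= subrK.
rewrite addrK -lee_fin; apply: le_trans (H1_dual_le hl hT) _.
rewrite (nneseries_addn (f := fun j => `|lam j|%:E))//.
rewrite dE -(fineK tf) -EFinM lee_fin.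
move: tn; rewrite sub0r normrN => tn.
apply: (@le_trans _ _ (M * (e / M))); last by rewrite mulrC divfK ?gt_eqF.
apply: ler_pM; rewrite ?fine_ge0//.
- by apply: nneseries_ge0 => j _ _; rewrite lee_fin.
- by rewrite /M lerDl.
- exact: le_trans (ler_norm _) tn.
Unshelve. all: by end_near.
Qed.

Lemma decomposition_le (p : nat -> R) (lam : nat -> R) (K L : R) : 0 <= K ->
  (sumn lam < +oo)%E -> (forall j, `|p j| <= K) ->
  (fun n => \sum_(0 <= j < n) lam j * p j) @ \oo --> L ->
  (`|L|%:E <= K%:E * sumn lam)%E.
Proof.
move=> K0 soo pK hL.
have s0 : (0 <= sumn lam)%E by apply: nneseries_ge0 => n _ _; rewrite lee_fin.
have bnd n : (`|\sum_(0 <= j < n) lam j * p j|%:E <= K%:E * sumn lam)%E.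
  apply: (@le_trans _ _ (K%:E * (\sum_(0 <= j < n) `|lam j|)%:E)%E).
    rewrite -EFinM lee_fin mulr_sumr; apply: le_trans (ler_norm_sum _ _ _) _.
    by apply: ler_sum => j _; rewrite normrM mulrC ler_wpM2r.
  apply: lee_wpmul2l; rewrite ?lee_fin// -sumEFin.
  by apply: nneseries_lim_ge => j _ _; rewrite lee_fin.
have sE : (sumn lam = (fine (sumn lam))%:E)%E by rewrite fineK// ge0_fin_numE.
rewrite sE in bnd *.
rewrite -EFinM lee_fin.
have hLn : (fun n => `|\sum_(0 <= j < n) lam j * p j|) @ \oo --> `|L|.
  exact: cvg_norm.
rewrite -(cvg_lim _ hLn)//.
apply: limr_le; first exact: cvgP hLn.
by apply: nearW => n; rewrite -lee_fin EFinM; exact: bnd.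
Qed.

End H1_space.

(** * Representation of functionals *)

Section test_function.
Context (R : realType) (disp : measure_display) (X : measurableType disp)
  (rho : X -> X -> R) (mu : {measure set X -> \bar R}) (w : X -> R).
Hypothesis hX : homogeneous_type rho mu.
Hypothesis hw : A2_weight rho mu w.

Local Notation m D := (fine (mu D)).
Local Notation W D := (\int[mu]_(y in D) w y).

Lemma integrable_bounded_mul (D : set X) (f h : X -> R) (M : R) :
  measurable D -> measurable_fun setT f -> (forall y, `|f y| <= M) ->
  mu.-integrable D (EFin \o h) ->
  mu.-integrable D (EFin \o (fun y => f y * h y)).
Proof.
move=> mD mf fM ih.
have mh : measurable_fun D h by apply/measurable_EFinP; exact: measurable_int ih.
have M0 : 0 <= M by exact: le_trans (fM point).
apply: le_integrable (integrableZ_EFin M mD (integrable_norm ih)) => //.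
  by apply/measurable_EFinP; apply: measurable_funM => //; exact: measurable_funTS.
move=> y _ /=; rewrite lee_fin !normrM normr_id (ger0_norm M0).
exact: ler_wpM2r.
Qed.

Lemma integrable_mul_indic (D A : set X) (h : X -> R) : measurable D ->
  measurable A -> mu.-integrable D (EFin \o h) ->
  mu.-integrable D (EFin \o (fun y => \1_A y * h y)).
Proof.
move=> mD mA; have mi : measurable_fun setT (\1_A : X -> R).
  exact: measurable_indic.
apply: (@integrable_bounded_mul D \1_A h 1) => // y.
by rewrite indicE; case: (_ \in _); rewrite ?normr1 ?normr0.
Qed.

Lemma Rintegral_indic (D A : set X) : measurable D -> measurable A ->
  A `<=` D -> \int[mu]_(y in D) \1_A y = m A.
Proof.
by move=> mD mA AD; rewrite /Rintegral integral_indic// setIidl.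
Qed.

Section test_on_ball.
Variables (h : X -> R) (x : X) (r : R).
Hypothesis hh : loc_integrable rho mu h.
Hypothesis r0 : 0 < r.
Local Notation B := (qball rho x r).

Let c := ball_avg rho mu h x r.

Definition above : set X := B `&` [set y | c < h y].
Definition below : set X := B `&` [set y | h y < c].
Definition imbalance : R := (m above - m below) / m B.

(* [sign (h - c)] on the ball, recentred to have mean zero. *)
Definition test_fun y : R := \1_above y - \1_below y - imbalance * \1_B y.

Let mB : measurable B. Proof. exact: measurable_qball hX x r r0. Qed.
Let mh : measurable_fun setT h.
Proof. exact (loc_integrable_measurable hX hh). Qed.

Lemma measurable_above : measurable above.
Proof.
apply: measurableI => //; rewrite -[X in measurable X]setTI.
have := @measurable_fun_ltr _ _ _ setT _ _ (measurable_cst c) mh.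
by move=> /(_ measurableT [set true] I); congr measurable; apply/seteqP; split.
Qed.

Lemma measurable_below : measurable below.
Proof.
apply: measurableI => //; rewrite -[X in measurable X]setTI.
have := @measurable_fun_ltr _ _ _ setT _ _ mh (measurable_cst c).
by move=> /(_ measurableT [set true] I); congr measurable; apply/seteqP; split.
Qed.

Let mabove := measurable_above.
Let mbelow := measurable_below.
Let aB : above `<=` B. Proof. by move=> y []. Qed.
Let bB : below `<=` B. Proof. by move=> y []. Qed.
Let m0 : 0 < m B. Proof. exact: fine_qball_gt0 hX x r r0. Qed.
Let Boo : (mu B < +oo)%E. Proof. exact: qball_lty hX x r r0. Qed.

Let mle (A : set X) : measurable A -> A `<=` B -> m A <= m B.
Proof. exact: (le_fine_qball hX r0). Qed.

Let i1 (A : set X) : measurable A -> A `<=` B ->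
  mu.-integrable B (EFin \o \1_A).
Proof.
move=> mA AB; apply: (@integrableS _ _ _ _ setT) => //.
apply: integrable_indic_lty => //; apply: le_lt_trans Boo.
by apply: le_measure; rewrite ?inE.
Qed.

Let iB : mu.-integrable B (EFin \o (fun y => imbalance * \1_B y)).
Proof. by apply: integrableZ_EFin => //; exact: i1. Qed.

Let iab : mu.-integrable B (EFin \o (fun y => \1_above y - \1_below y)).
Proof. by apply: integrableB_EFin => //; exact: i1. Qed.

Lemma measurable_test_fun : measurable_fun setT test_fun.
Proof.
apply: measurable_funB; first by apply: measurable_funB; exact: measurable_indic.
by apply: measurable_funM => //; exact: measurable_indic.
Qed.

Lemma test_fun_support y : test_fun y != 0 -> B y.
Proof.
apply: contraNP => nB; rewrite /test_fun !indicE.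
rewrite (memNset nB) (memNset (_ : ~ above y)); last by move=> /aB.
by rewrite (memNset (_ : ~ below y)) ?mulr0 ?subrr// => /bB.
Qed.

Lemma test_fun_integral : \int[mu]_(y in B) test_fun y = 0.
Proof.
rewrite /test_fun RintegralB// RintegralB//; [|exact: i1|exact: i1].
rewrite RintegralZl//; last exact: i1.
by rewrite !Rintegral_indic// /imbalance divfK ?gt_eqF// subrr.
Qed.

Let test_integrable : mu.-integrable B (EFin \o test_fun).
Proof. exact: integrableB_EFin. Qed.

Lemma test_fun_eintegral : (\int[mu]_(y in B) (test_fun y)%:E = 0)%E.
Proof. by rewrite -EFin_Rintegral// test_fun_integral. Qed.

Lemma test_fun_le2 y : `|test_fun y| <= 2.
Proof.
have hk : `|imbalance| <= 1.
  rewrite /imbalance normrM normfV (gtr0_norm m0) ler_pdivrMr// mul1r.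
  have h1 := mle mabove aB; have h2 := mle mbelow bB.
  have h3 : 0 <= m above by rewrite fine_ge0.
  have h4 : 0 <= m below by rewrite fine_ge0.
  by rewrite ler_norml; apply/andP; split; lra.
have ind (A : set X) : 0 <= (\1_A y : R) <= 1.
  by rewrite indicE; case: (y \in A); rewrite !lexx ?ler01.
apply: le_trans (ler_normB _ _) _.
have h5 : `|\1_above y - \1_below y : R| <= 1.
  move: (ind above) (ind below) => /andP[? ?] /andP[? ?].
  by rewrite ler_norml; apply/andP; split; lra.
have h6 : `|imbalance * \1_B y| <= 1.
  move: (ind B) => /andP[b0 b1]; rewrite normrM (ger0_norm b0).
  by rewrite mulr_ile1.
lra.
Qed.

(** The test function has integral zero, so [h] may be replaced by [h - c]. The sign then produces
    [|h - c|], and the recentring term integrates to zero because [c] is the mean of [h]. *)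
Lemma test_fun_osc :
  \int[mu]_(y in B) (test_fun y * h y) = \int[mu]_(y in B) `|h y - c|.
Proof.
have ih : mu.-integrable B (EFin \o h) by apply: hh; exists x, r.
have ic : mu.-integrable B (EFin \o cst c) by exact: integrable_cst_lty.
have ihc : mu.-integrable B (EFin \o (fun y => h y - c)).
  exact: (integrableB_EFin mB ih ic).
have ihn : mu.-integrable B (EFin \o (fun y => `|h y - c|)).
  exact: integrable_norm.
have ith := integrable_bounded_mul mB measurable_test_fun test_fun_le2 ih.
transitivity (\int[mu]_(y in B) (test_fun y * h y - c * test_fun y)).
  rewrite RintegralB//; last exact: integrableZ_EFin.
  by rewrite RintegralZl// test_fun_integral mulr0 subr0.
transitivity (\int[mu]_(y in B) (`|h y - c| - imbalance * (h y - c))).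
  apply: eq_Rintegral => y; rewrite inE => By.
  rewrite /test_fun !indicE (mem_set By).
  have [hc|hc|hc] := ltgtP (h y) c.
  - rewrite (mem_set (_ : below y))// (memNset (_ : ~ above y)); last first.
      by move=> [_ /=]; rewrite ltNge ltW.
    by rewrite ltr0_norm ?subr_lt0//=; ring.
  - rewrite (mem_set (_ : above y))// (memNset (_ : ~ below y)); last first.
      by move=> [_ /=]; rewrite ltNge ltW.
    by rewrite gtr0_norm ?subr_gt0//=; ring.
  - rewrite (memNset (_ : ~ above y)); last by move=> [_ /=]; rewrite hc ltxx.
    rewrite (memNset (_ : ~ below y)); last by move=> [_ /=]; rewrite hc ltxx.
    by rewrite hc (subrr c) normr0 /=; ring.
rewrite RintegralB//; last exact: integrableZ_EFin.
rewrite RintegralZl// RintegralB// Rintegral_cst//.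
have -> : c * m B = \int[mu]_(y in B) h y.
  by rewrite /c /ball_avg mulrAC mulVf ?gt_eqF// mul1r.
by rewrite subrr mulr0 subr0.
Qed.

Let W0 : 0 < W B. Proof. exact: weight_ball_gt0 hX hw x r r0. Qed.

(** The test function is bounded by 2, so its squared norm against [w] is at most [4 * W B]; the
    factor [(2 * W B)^-1] brings this to [(W B)^-1]. *)
Lemma test_atom : atom rho mu w (fun y => (2 * W B)^-1 * test_fun y).
Proof.
have W20 : 0 < 2 * W B by rewrite mulr_gt0.
apply/(atomP hX hw); exists x, r; split => //; split.
- by apply: measurable_funM => //; exact: measurable_test_fun.
- by move=> y; rewrite mulf_eq0 negb_or => /andP[_ /test_fun_support].
- rewrite -EFin_Rintegral//; last exact: integrableZ_EFin.
  by rewrite RintegralZl// test_fun_integral mulr0.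
- have iw := weight_integrable hw x r0.
  apply: (@le_trans _ _ (\int[mu]_(y in B) ((W B ^- 2) * w y)%:E)%E).
    have mw := measurable_weight hX hw; have mt := measurable_test_fun.
    apply: le_ge0_integral => //.
    + by apply: measurable_funM => //; apply: measurable_funX;
        apply: measurable_funM.
    + exact: measurable_funM.
    + by move=> y; rewrite mulr_ge0 ?sqr_ge0// (weight_ge0 hw).
    + move=> y _; rewrite ler_wpM2r ?(weight_ge0 hw)// exprMn.
      rewrite -[X in _ * X]real_normK ?num_real//.
      have h4 : `|test_fun y| ^+ 2 <= 2 ^+ 2.
        by rewrite lerXn2r ?nnegrE// test_fun_le2.
      apply: (le_trans (ler_wpM2l (sqr_ge0 _) h4)).
      rewrite le_eqVlt; apply/orP; left; apply/eqP.
      by field; rewrite gt_eqF.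
  rewrite -EFin_Rintegral//; last exact: integrableZ_EFin.
  rewrite RintegralZl// lee_fin le_eqVlt; apply/orP; left; apply/eqP.
  by field; rewrite gt_eqF.
Qed.

Lemma test_pairing : \int[mu]_(y in B) `|h y - c| =
  2 * W B * pairing mu (fun y => (2 * W B)^-1 * test_fun y) h.
Proof.
have ih : mu.-integrable B (EFin \o h) by apply: hh; exists x, r.
have W20 : 0 < 2 * W B by rewrite mulr_gt0.
have ith := integrable_bounded_mul mB measurable_test_fun test_fun_le2 ih.
rewrite /pairing (@supported_Rintegral _ _ _ mu B)//; last first.
  by move=> y; rewrite -mulrA !mulf_eq0 !negb_or => /and3P[_ /test_fun_support].
rewrite (_ : \int[mu]_(y in B) (_ * test_fun y * h y) =
   \int[mu]_(y in B) ((2 * W B)^-1 * (test_fun y * h y))); last first.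
  by apply: eq_Rintegral => y _; rewrite mulrA.
by rewrite RintegralZl// mulrA divff ?gt_eqF// mul1r test_fun_osc.
Qed.

End test_on_ball.

(** The test atoms force the oscillation of [h] to vanish on each ball of an exhaustion. The
    resulting constants agree because the balls are nested and the smallest has positive measure. *)
Lemma annihilated_const (h : X -> R) : loc_integrable rho mu h ->
  (forall a, atom rho mu w a -> pairing mu a h = 0) ->
  exists k, {ae mu, forall y, h y = k}.
Proof.
move=> hh h0; pose b k := ball_avg rho mu h point (2 ^+ k * 1).
have pow0 k : 0 < 2 ^+ k * 1 :> R by rewrite mulr_gt0// exprn_gt0.
have mB k : measurable (qball rho point (2 ^+ k * 1)).
  exact: measurable_qball hX _ _ (pow0 k).
have mh : measurable_fun setT h by exact (loc_integrable_measurable hX hh).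
have ae k : {ae mu, forall y, qball rho point (2 ^+ k * 1) y -> h y = b k}.
  have := test_pairing point hh (pow0 k).
  rewrite h0 ?mulr0; last exact: (test_atom point hh (pow0 k)).
  move=> osc0.
  have mhb : measurable_fun setT (fun y => h y - b k) by exact: measurable_funB.
  have : ae_eq mu (qball rho point (2 ^+ k * 1))
      (EFin \o (fun y => h y - b k)) (cst 0%E).
    apply/ae_eq_integral_abs => //.
      by apply/measurable_EFinP; exact: measurable_funTS.
    have := EFin_Rintegral (mB k) (bmo_osc_integrable hX point (b k) hh (pow0 k)).
    by rewrite osc0 => <-.
  by apply: filterS => y h1 /h1[] /eqP; rewrite subr_eq0 => /eqP.
have bE k : b k = b 0%N.
  have : mu (qball rho point (2 ^+ 0 * 1)) != 0%E.
    by rewrite gt_eqF// (qball_gt0 hX).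
  apply: contra_neq_eq => bk; apply/negligibleP => //.
  apply: negligibleS (_ : _ `<=` ~` [set y |
    (qball rho point (2 ^+ k * 1) y -> h y = b k) /\
    (qball rho point (2 ^+ 0 * 1) y -> h y = b 0%N)]) _.
    move=> y By [hk h00]; move/eqP: bk; apply.
    rewrite -(h00 By); apply/esym/hk.
    by apply: qball_le By; rewrite !mulr1 ler_weXn2l// ler1n.
  exact: filterI (ae k) (ae 0%N).
exists (b 0%N).
have : {ae mu, forall y, forall k, qball rho point (2 ^+ k * 1) y -> h y = b 0%N}.
  apply/ae_foralln => k; apply: filterS (ae k) => y h1 /h1 ->; exact: bE.
apply: filterS => y hy.
have [k _ yk] : (\bigcup_k qball rho point (2 ^+ k * 1)) y.
  by rewrite (bigcup_qball hX point ltr01).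
exact: hy yk.
Qed.

End test_function.

Import HBSimple HBNNSimple.

(** * A real-valued Radon-Nikodym density *)

Section radon_nikodym_real.
Context (R : realType) (d : measure_display) (X : measurableType d)
  (mu : {measure set X -> \bar R}) (nu : set X -> \bar R).
Hypothesis mu_sigma : sigma_finite setT mu.
Hypothesis nu0 : nu set0 = 0%E.
Hypothesis nu_fin : forall A, measurable A -> nu A \is a fin_num.
Hypothesis nu_additive : semi_sigma_additive nu.
Hypothesis nu_dom : forall A, measurable A -> mu A = 0%E -> nu A = 0%E.

(** Copies of [nu], and below of [mu], that carry the structures of charge and of sigma-finite
    measure obtained from the section hypotheses. *)
Let nu' : set X -> \bar R := nu.
HB.instance Definition _ := isCharge.Build _ _ _ nu' nu0 nu_fin nu_additive.

Let mu' : set X -> \bar R := mu.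
HB.instance Definition _ := isMeasure.Build _ _ _ mu' (measure0 mu)
  (measure_ge0 mu) (@measure_semi_sigma_additive _ _ _ mu).
HB.instance Definition _ := @Measure_isSigmaFinite.Build _ _ _ mu' mu_sigma.

Lemma radon_nikodym_real : exists2 f : X -> R,
  mu.-integrable setT (EFin \o f) &
  forall A, measurable A -> nu A = (\int[mu]_(x in A) (f x)%:E)%E.
Proof.
have dom : nu' `<< mu' by apply/null_content_dominatesP; exact: nu_dom.
pose f := Radon_Nikodym nu' mu'.
have fE x : (fine (f x))%:E = f x by rewrite fineK// Radon_Nikodym_fin_num.
exists (fine \o f).
- have := Radon_Nikodym_integrable dom.
  by apply: eq_integrable => // x _ /=; rewrite fE.
- move=> A mA; rewrite -[LHS]/(nu' A) (Radon_Nikodym_integral dom mA).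
  by apply: eq_integral => x _; rewrite fE.
Qed.

End radon_nikodym_real.

Lemma bigsetU_setI0 (T : Type) (F : nat -> set T) k : trivIset setT F ->
  \big[setU/set0]_(i < k) F i `&` F k = set0.
Proof.
move=> tF; rewrite -(bigcup_mkord k F) -subset0 => y [[i /= ik Fi] Fk].
by move: ik; rewrite (tF i k)// ?ltnn//; exists y.
Qed.

(** * Extension of a functional to L^2_w and its density *)

Section representation.
Context (R : realType) (disp : measure_display) (X : measurableType disp)
  (rho : X -> X -> R) (mu : {measure set X -> \bar R}) (w : X -> R).
Hypothesis hX : homogeneous_type rho mu.
Hypothesis hw : A2_weight rho mu w.
Variable l : (BMO rho mu w -> R) -> R.
Hypothesis hl : H1_dual l.

Local Notation m D := (fine (mu D)).
Local Notation W D := (\int[mu]_(y in D) w y).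
Local Notation atf := (@atom_fun R disp X rho mu w).

Let w0 y : 0 <= w y. Proof. exact: weight_ge0 hw y. Qed.
Let mw : measurable_fun setT w. Proof. exact: measurable_weight hX hw. Qed.

Let Bn (n : nat) : set X := qball rho point (2 ^+ n * 1).
Let pow0 n : 0 < 2 ^+ n * 1 :> R.
Proof. by rewrite mulr_gt0// exprn_gt0. Qed.
Let mBn n : measurable (Bn n). Proof. exact: measurable_qball hX _ _ (pow0 n). Qed.
Let Bnoo n : (mu (Bn n) < +oo)%E. Proof. exact: qball_lty hX _ _ (pow0 n). Qed.
Let WB0 n : 0 < W (Bn n). Proof. exact: weight_ball_gt0 hX hw _ _ (pow0 n). Qed.
Let iw n : mu.-integrable (Bn n) (EFin \o w).
Proof. exact: weight_integrable hw _ _ (pow0 n). Qed.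
Let subB i j : (i <= j)%N -> Bn i `<=` Bn j.
Proof. by move=> ij; apply: qball_le; rewrite !mulr1 ler_weXn2l// ler1n. Qed.
Let m0 : 0 < m (Bn 0). Proof. exact: fine_qball_gt0 hX _ _ (pow0 0%N). Qed.
Let M := fine (dual_norm l).
Let M0 : 0 <= M. Proof. by rewrite fine_ge0// (dual_norm_ge0 hX hw hl). Qed.
Let ME : dual_norm l = M%:E.
Proof.
by rewrite fineK// ge0_fin_numE ?(dual_norm_ge0 hX hw hl)//; case: hl.
Qed.

(* Multiples of atoms supported in the [n]-th ball of an exhaustion. *)
Definition cancelling n (f : X -> R) : Prop :=
  [/\ measurable_fun setT f, forall y, f y != 0 -> Bn n y,
    (\int[mu]_(y in Bn n) (f y)%:E = 0)%E &
    (\int[mu]_(y in Bn n) (f y ^+ 2 * w y)%:E < +oo)%E].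

(** Dividing by [sqrt (T * W (Bn n))] turns the bound [T] into the normalization [(W (Bn n))^-1] of
    an atom. A positive upper bound [T] replaces the norm itself, so that [f = 0] is not a special
    case. *)
Lemma cancelling_atom n f T : cancelling n f -> 0 < T ->
  (\int[mu]_(y in Bn n) (f y ^+ 2 * w y)%:E <= T%:E)%E ->
  exists2 a, atom rho mu w a &
    f = (fun y => Num.sqrt (T * W (Bn n)) * a y).
Proof.
move=> [mf sf if0 foo] T0 fT; set c := Num.sqrt _.
have c0 : 0 < c by rewrite sqrtr_gt0 mulr_gt0.
exists (fun y => c^-1 * f y); last first.
  by apply/funext => y; rewrite mulrA divff ?mul1r// gt_eqF.
have iF := L2w_integrable hX hw (pow0 n) mf foo.
apply/(atomP hX hw); exists point, (2 ^+ n * 1); split => //.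
rewrite /atom_on -/(Bn n); split.
- exact: measurable_funM.
- by move=> y; rewrite mulf_eq0 negb_or => /andP[_ /sf].
- rewrite -EFin_Rintegral//; last exact: (integrableZ_EFin c^-1 (mBn n) iF).
  by rewrite RintegralZl// /Rintegral if0 mulr0.
- rewrite (eq_integral (fun y => (c ^- 2)%:E * (f y ^+ 2 * w y)%:E)%E); last first.
    by move=> y _; rewrite -EFinM; congr EFin; rewrite exprMn exprVn; ring.
  have mfw : measurable_fun setT (fun y => f y ^+ 2 * w y).
    by apply: measurable_funM => //; exact: measurable_funX.
  rewrite ge0_integralZl//; last 3 first.
  + by apply/measurable_EFinP; exact: measurable_funTS.
  + by move=> y _; rewrite lee_fin mulr_ge0// sqr_ge0.
  + by rewrite lee_fin invr_ge0 sqr_ge0.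
  apply: (@le_trans _ _ ((c ^- 2)%:E * T%:E)%E).
    by apply: lee_wpmul2l => //; rewrite lee_fin invr_ge0 sqr_ge0.
  rewrite -EFinM lee_fin /c sqr_sqrtr; last by rewrite mulr_ge0 ?ltW.
  by rewrite le_eqVlt; apply/orP; left; apply/eqP; field; rewrite !gt_eqF ?WB0.
Qed.

Lemma cancelling_bound n f : cancelling n f -> exists2 T, 0 < T &
  (\int[mu]_(y in Bn n) (f y ^+ 2 * w y)%:E <= T%:E)%E.
Proof.
move=> [_ _ _ foo].
by apply: ge0_lty_bound => //; apply: integral_ge0 => y _;
  rewrite lee_fin mulr_ge0// sqr_ge0.
Qed.

Lemma cancelling_integrable n f g : cancelling n f -> BMO rho mu w g ->
  mu.-integrable setT (EFin \o (fun y => f y * g y)).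
Proof.
move=> hf hg; have [T T0 fT] := cancelling_bound hf.
have [a ha ->] := cancelling_atom hf T0 fT.
have := integrableZ_EFin (Num.sqrt (T * W (Bn n))) measurableT
  (atom_integrable hX hw hg ha).
by apply: eq_integrable => // y _ /=; rewrite mulrA.
Qed.

Lemma atom_funZ k a : atom rho mu w a ->
  atf (fun y => k * a y) = k *: atf a.
Proof.
move=> ha; apply/funext => g.
transitivity (k * \int[mu]_y (a y * val g y)); last by [].
rewrite /atom_fun /pairing.
have hg : BMO rho mu w (val g) by exact: (set_mem (valP g)).
rewrite -RintegralZl//; last exact: (atom_integrable hX hw hg ha).
by apply: eq_Rintegral => y _; rewrite mulrA.
Qed.

Lemma cancelling_H1 n f : cancelling n f -> H1 (atf f).
Proof.
move=> hf; have [T T0 fT] := cancelling_bound hf.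
have [a ha ->] := cancelling_atom hf T0 fT.
by rewrite atom_funZ//; exact: H1_single.
Qed.

Lemma cancelling_le n f T : cancelling n f -> 0 < T ->
  (\int[mu]_(y in Bn n) (f y ^+ 2 * w y)%:E <= T%:E)%E ->
  `|l (atf f)| <= M * Num.sqrt (T * W (Bn n)).
Proof.
move=> hf T0 fT; have [a ha ->] := cancelling_atom hf T0 fT.
rewrite atom_funZ//; set k := Num.sqrt _.
have [h1 h2] := atomic_decomposition_single k ha.
have := H1_dual_le hX hw hl h1; rewrite h2 ME -EFinM lee_fin.
by rewrite (ger0_norm (sqrtr_ge0 _)).
Qed.

Lemma sq_lin_lty n (f h : X -> R) k : measurable_fun setT f -> measurable_fun setT h ->
  (\int[mu]_(y in Bn n) (f y ^+ 2 * w y)%:E < +oo)%E ->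
  (\int[mu]_(y in Bn n) (h y ^+ 2 * w y)%:E < +oo)%E ->
  (\int[mu]_(y in Bn n) ((k * f y + h y) ^+ 2 * w y)%:E < +oo)%E.
Proof.
move=> mf mh foo hoo.
have mkf : measurable_fun setT (fun y => k * f y + h y).
  by apply: measurable_funD => //; exact: measurable_funM.
have mfw : measurable_fun setT (fun y => f y ^+ 2 * w y).
  by apply: measurable_funM => //; exact: measurable_funX.
have mhw : measurable_fun setT (fun y => h y ^+ 2 * w y).
  by apply: measurable_funM => //; exact: measurable_funX.
have f2 y : 0 <= f y ^+ 2 * w y by rewrite mulr_ge0// sqr_ge0.
have h2 y : 0 <= h y ^+ 2 * w y by rewrite mulr_ge0// sqr_ge0.
have k2 : 0 <= 2 * k ^+ 2 by rewrite mulr_ge0// sqr_ge0.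
apply: (@le_lt_trans _ _ (\int[mu]_(y in Bn n)
    ((2 * k ^+ 2) * (f y ^+ 2 * w y) + 2 * (h y ^+ 2 * w y))%:E)%E).
  apply: le_ge0_integral => //.
  + by apply: measurable_funM => //; exact: measurable_funX.
  + by apply: measurable_funD; exact: measurable_funM.
  + by move=> y; rewrite mulr_ge0// sqr_ge0.
  + move=> y _; rewrite !mulrA -mulrDl ler_wpM2r// -subr_ge0.
    by rewrite (_ : _ - _ = (k * f y - h y) ^+ 2) ?sqr_ge0//; ring.
by rewrite ge0_integral_lin// lte_add_pinfty// lte_mul_pinfty.
Qed.

Lemma cancelling_lin n f h k : cancelling n f -> cancelling n h ->
  cancelling n (fun y => k * f y + h y) /\
  atf (fun y => k * f y + h y) = k *: atf f + atf h.
Proof.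
move=> hf hh; split; last first.
  apply/funext => g.
  transitivity (k * \int[mu]_y (f y * val g y) + \int[mu]_y (h y * val g y));
    last by [].
  rewrite /atom_fun /pairing.
  have hg : BMO rho mu w (val g) by exact: (set_mem (valP g)).
  have i1 := cancelling_integrable hf hg; have i2 := cancelling_integrable hh hg.
  rewrite -RintegralZl// -RintegralD//; last exact: integrableZ_EFin.
  by apply: eq_Rintegral => y _; rewrite mulrDl mulrA.
have [mf sf if0 foo] := hf; have [mh sh ih0 hoo] := hh.
have jf := L2w_integrable hX hw (pow0 n) mf foo.
have jh := L2w_integrable hX hw (pow0 n) mh hoo.
split => //.
- by apply: measurable_funD => //; exact: measurable_funM.
- move=> y; apply: contraNP => nB.
  have f0 : f y = 0 by apply/eqP; apply: contra_notT nB => /sf.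
  have h0 : h y = 0 by apply/eqP; apply: contra_notT nB => /sh.
  by rewrite f0 h0 mulr0 addr0.
- have jkf := integrableZ_EFin k (mBn n) jf.
  rewrite -EFin_Rintegral//; last exact: integrableD_EFin.
  rewrite RintegralD// RintegralZl//.
  by rewrite /Rintegral if0 ih0 mulr0 addr0.
- exact: sq_lin_lty.
Qed.

Definition L2_on n (f : X -> R) : Prop :=
  [/\ measurable_fun setT f, forall y, f y != 0 -> Bn n y &
    (\int[mu]_(y in Bn n) (f y ^+ 2 * w y)%:E < +oo)%E].

(* Correcting the mean on the fixed ball [Bn 0] lets [l] act on every function
   of L^2_w with bounded support. *)
Definition recentre (f : X -> R) y :=
  f y - (\int[mu]_x f x / m (Bn 0)) * \1_(Bn 0) y.

Let ind1 (A : set X) y : 0 <= (\1_A y : R) <= 1.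
Proof. by rewrite indicE; case: (y \in A); rewrite !lexx ?ler01. Qed.

Lemma L2_on_integrable n f : L2_on n f ->
  mu.-integrable (Bn n) (EFin \o f) /\ mu.-integrable setT (EFin \o f).
Proof.
move=> [mf sf foo]; have i1 := L2w_integrable hX hw (pow0 n) mf foo.
by split => //; exact: (supported_integrable sf (mBn n) i1).
Qed.

Lemma L2_on_Rintegral n f : L2_on n f ->
  \int[mu]_x f x = \int[mu]_(x in Bn n) f x.
Proof. by move=> [_ sf _]; exact: supported_Rintegral. Qed.

Lemma L2_on_indic n A : measurable A -> A `<=` Bn n -> L2_on n \1_A /\
  \int[mu]_x (\1_A x : R) = m A /\
  (\int[mu]_(y in Bn n) (\1_A y ^+ 2 * w y)%:E = (W A)%:E)%E.
Proof.
move=> mA AB.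
have E : (\int[mu]_(y in Bn n) (\1_A y ^+ 2 * w y)%:E = (W A)%:E)%E.
  rewrite EFin_Rintegral//; last by apply: integrableS (iw n).
  rewrite -{2}(setIidr AB) [RHS]integral_mkcondr; apply: eq_integral => y _.
  rewrite /patch indicE; case: ifP => _; first by rewrite expr1n mul1r.
  by rewrite expr0n /= mul0r.
split; last first.
  by split => //; rewrite Rintegral_indic.
split.
- exact: measurable_indic.
- by move=> y; rewrite indicE pnatr_eq0 eqb0 negbK => /set_mem/AB.
- by rewrite E ltry.
Qed.

(** The square of a difference is at most twice the sum of the squares, and the correction is a
    multiple of the indicator of [Bn 0], whose squared norm is [W (Bn 0)]. *)
Lemma recentre_le n f s t : L2_on n f ->
  (\int[mu]_(y in Bn n) (f y ^+ 2 * w y)%:E <= s%:E)%E ->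
  `|\int[mu]_x f x| <= t ->
  (\int[mu]_(y in Bn n) (recentre f y ^+ 2 * w y)%:E <=
     (2 * s + 2 * (t / m (Bn 0)) ^+ 2 * W (Bn 0))%:E)%E.
Proof.
move=> [mf sf foo] fs ft; set k := \int[mu]_x f x in ft *.
have mfw : measurable_fun setT (fun y => f y ^+ 2 * w y).
  by apply: measurable_funM => //; exact: measurable_funX.
have mbw : measurable_fun setT (fun y => \1_(Bn 0) y ^+ 2 * w y).
  by apply: measurable_funM => //; exact: measurable_funX.
have f2 y : 0 <= f y ^+ 2 * w y by rewrite mulr_ge0// sqr_ge0.
have b2 y : 0 <= (\1_(Bn 0) y : R) ^+ 2 * w y by rewrite mulr_ge0// sqr_ge0.
pose c := 2 * (t / m (Bn 0)) ^+ 2.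
have c0 : 0 <= c by rewrite mulr_ge0// sqr_ge0.
apply: (@le_trans _ _ (\int[mu]_(y in Bn n)
    (2 * (f y ^+ 2 * w y) + c * (\1_(Bn 0) y ^+ 2 * w y))%:E)%E).
  apply: le_ge0_integral => //.
  - apply: measurable_funM => //; apply: measurable_funX.
    by apply: measurable_funB => //; exact: measurable_funM.
  - by apply: measurable_funD; exact: measurable_funM.
  - by move=> y; rewrite mulr_ge0// sqr_ge0.
  - move=> y _; rewrite (mulrA 2) (mulrA c) -mulrDl ler_wpM2r// /recentre -/k.
    set u := \1_(Bn 0) y; set q := k / m (Bn 0).
    apply: (@le_trans _ _ (2 * f y ^+ 2 + 2 * (q * u) ^+ 2)).
      rewrite -subr_ge0 (_ : _ - _ = (f y + q * u) ^+ 2) ?sqr_ge0//.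
      by ring.
    rewrite lerD2l exprMn mulrA /c ler_wpM2r ?sqr_ge0// ler_pM2l//.
    rewrite -[leLHS]real_normK ?num_real// lerXn2r//.
    + by rewrite nnegrE divr_ge0 ?fine_ge0// (le_trans _ ft).
    + by rewrite /q normrM normfV (gtr0_norm m0) ler_pM2r ?invr_gt0.
rewrite ge0_integral_lin// [leRHS]EFinD; apply: leeD.
  by rewrite EFinM; exact: lee_wpmul2l.
have [_ [_ ->]] := L2_on_indic (mBn 0) (subB (leq0n n)).
by rewrite -EFinM.
Qed.

Lemma recentre_cancelling n f : L2_on n f -> cancelling n (recentre f).
Proof.
move=> hf; have [mf sf foo] := hf; split.
- by apply: measurable_funB => //; exact: measurable_funM.
- move=> y; apply: contraNP => nB; rewrite /recentre.
  have f0 : f y = 0 by apply/eqP; apply: contra_notT nB => /sf.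
  have nB0 : ~ Bn 0 y by move=> By; apply: nB; exact: subB By.
  by rewrite f0 indicE (memNset nB0) mulr0 subr0.
- have [i1 _] := L2_on_integrable hf.
  have [hb [hb1 _]] := L2_on_indic (mBn 0) (subB (leq0n n)).
  have [i2 _] := L2_on_integrable hb.
  have i3 := integrableZ_EFin (\int[mu]_x f x / m (Bn 0)) (mBn n) i2.
  rewrite -EFin_Rintegral//; last exact: (integrableB_EFin (mBn n) i1 i3).
  rewrite /recentre RintegralB// RintegralZl//.
  rewrite -(L2_on_Rintegral hf) -(L2_on_Rintegral hb) hb1.
  by rewrite divfK ?gt_eqF// subrr.
- have [s s0 fs] : exists2 s, 0 < s &
      (\int[mu]_(y in Bn n) (f y ^+ 2 * w y)%:E <= s%:E)%E.
    by apply: ge0_lty_bound => //; apply: integral_ge0 => y _;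
      rewrite lee_fin mulr_ge0// sqr_ge0.
  by apply: le_lt_trans (recentre_le hf fs (lexx _)) _; rewrite ltry.
Qed.

Lemma L2_on_lin n f h k : L2_on n f -> L2_on n h ->
  L2_on n (fun y => k * f y + h y).
Proof.
move=> [mf sf foo] [mh sh hoo]; split.
- by apply: measurable_funD => //; exact: measurable_funM.
- move=> y; apply: contraNP => nB.
  have f0 : f y = 0 by apply/eqP; apply: contra_notT nB => /sf.
  have h0 : h y = 0 by apply/eqP; apply: contra_notT nB => /sh.
  by rewrite f0 h0 mulr0 addr0.
- exact: sq_lin_lty.
Qed.

Definition extension f := l (atf (recentre f)).

Lemma extension_lin n f h k : L2_on n f -> L2_on n h ->
  extension (fun y => k * f y + h y) = k * extension f + extension h.
Proof.
move=> hf hh; have cf := recentre_cancelling hf; have ch := recentre_cancelling hh.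
have [_ i1] := L2_on_integrable hf; have [_ i2] := L2_on_integrable hh.
rewrite /extension -(hl.1 k _ _ (cancelling_H1 cf) (cancelling_H1 ch)).
have [_ <-] := cancelling_lin k cf ch.
congr (l (atf _)); apply/funext => y; rewrite /recentre.
rewrite RintegralD//; last exact: integrableZ_EFin.
by rewrite RintegralZl//; field; rewrite gt_eqF.
Qed.

(** Continuity at 0. The integral of [f] is made small separately because recentring subtracts a
    multiple of it. *)
Lemma extension_small n e : 0 < e -> exists2 d, 0 < d & forall f, L2_on n f ->
  (\int[mu]_(y in Bn n) (f y ^+ 2 * w y)%:E <= d%:E)%E ->
  `|\int[mu]_x f x| <= d -> `|extension f| <= e.
Proof.
move=> e0; have M10 : 0 < M + 1 by rewrite ltr_wpDl.
(* Chosen so that the square root in [cancelling_le] equals [e / (M + 1)]. *)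
pose T := (e / (M + 1)) ^+ 2 / W (Bn n).
have T0 : 0 < T by rewrite divr_gt0// exprn_gt0// divr_gt0.
pose q := 2 + 2 / m (Bn 0) ^+ 2 * W (Bn 0).
have q0 : 0 < q.
  by rewrite /q ltr_wpDr// mulr_ge0// ?divr_ge0 ?sqr_ge0// ltW.
(* From [d <= 1] one has [d ^+ 2 <= d], so the bound of [recentre_le] is at most [d * q], hence at
   most [T]. *)
pose d := Num.min 1 (T / q).
have d0 : 0 < d by rewrite lt_min ltr01 divr_gt0.
exists d => // f hf fd fd1.
have := cancelling_le (recentre_cancelling hf) T0 _.
have -> : Num.sqrt (T * W (Bn n)) = e / (M + 1).
  rewrite /T divfK ?gt_eqF// sqrtr_sqr ger0_norm// divr_ge0// ltW//.
move=> h; apply: (le_trans (h _)); last first.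
  by rewrite mulrCA ger_pMr// ler_pdivrMr// mul1r lerDl.
apply: (le_trans (recentre_le hf fd fd1)); rewrite lee_fin.
apply: (@le_trans _ _ (d * q)).
  have d1 : d <= 1 by rewrite ge_min lexx.
  rewrite /q mulrDr mulrC lerD2l.
  rewrite (_ : 2 * _ * _ = d * (d * (2 / m (Bn 0) ^+ 2 * W (Bn 0)))).
    rewrite ler_pM2l// ler_piMl// mulr_ge0// ?divr_ge0 ?sqr_ge0// ltW//.
  by field; rewrite gt_eqF.
by rewrite -ler_pdivlMr// ge_min lexx orbT.
Qed.

Lemma L2_on0 n : L2_on n (fun=> 0).
Proof.
split => //; first by move=> y; rewrite eqxx.
rewrite (eq_integral (cst 0%E)) ?integral0//.
by move=> y _; rewrite expr0n /= mul0r.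
Qed.

Lemma extension0 : extension (fun=> 0) = 0.
Proof.
have h0 := L2_on0 0; have := extension_lin 1 h0 h0.
rewrite (_ : (fun y : X => 1 * 0 + 0) = fun=> 0); last first.
  by apply/funext => y; rewrite mulr0 addr0.
by rewrite mul1r => /eqP; rewrite -subr_eq subrr eq_sym => /eqP.
Qed.

Lemma L2_on_sub n f h : L2_on n f -> L2_on n h -> L2_on n (fun y => f y - h y) /\
  extension (fun y => f y - h y) = extension f - extension h.
Proof.
move=> hf hh; have E : (fun y => f y - h y) = (fun y => (-1) * h y + f y).
  by apply/funext => y; rewrite mulN1r addrC.
rewrite E (extension_lin (-1) hh hf) mulN1r addrC; split => //.
exact: L2_on_lin.
Qed.

(** Dominated convergence is applied twice, to the squared difference against [w] and to the
    difference itself; these are the two smallness conditions of [extension_small]. *)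
Lemma extension_cvg n (u : nat -> X -> R) f h : (forall k, L2_on n (u k)) ->
  L2_on n f -> L2_on n h -> (forall k y, `|u k y| <= h y) ->
  (forall y, `|f y| <= h y) -> (forall y, u k y @[k --> \oo] --> f y) ->
  (fun k => extension (u k)) @ \oo --> extension f.
Proof.
move=> hu hf hh uh fh ucv.
have h0 y : 0 <= h y by exact: le_trans (fh y).
have [mh _ hoo] := hh; have [mf _ _] := hf.
have [ih _] := L2_on_integrable hh.
have hd k := (L2_on_sub (hu k) hf).1.
have md k : measurable_fun setT (fun y => u k y - f y) by case: (hd k).
have dh k y : `|u k y - f y| <= 2 * h y.
  apply: le_trans (ler_normB _ _) _; rewrite mulr_natl mulr2n.
  by apply: lerD; [exact: uh|exact: fh].
have dcv y : (u k y - f y) @[k --> \oo] --> (0 : R).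
  by rewrite -(subrr (f y)); apply: cvgB; [exact: ucv|exact: cvg_cst].
have i4 : mu.-integrable (Bn n) (EFin \o (fun y => 4 * (h y ^+ 2 * w y))).
  apply: integrableZ_EFin => //; apply: integrable_ge0_lty => //.
    by apply: measurable_funTS; apply: measurable_funM => //; exact: measurable_funX.
  by move=> y; rewrite mulr_ge0// sqr_ge0.
have c1 : (\int[mu]_(y in Bn n) ((u k y - f y) ^+ 2 * w y)%:E @[k --> \oo] -->
    \int[mu]_(y in Bn n) (cst 0 y))%E.
  apply: (@dominated_cvg _ _ _ mu _ (mBn n)
    (fun k y => ((u k y - f y) ^+ 2 * w y)%:E) _
    (EFin \o (fun y => 4 * (h y ^+ 2 * w y)))) => //.
  - move=> j; apply/measurable_EFinP; apply: measurable_funTS.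
    by apply: measurable_funM => //; exact: measurable_funX.
  - move=> y _; apply: cvg_EFin; first exact: nearW.
    rewrite -(mul0r (w y)); apply: cvgMl.
    rewrite [X in _ --> X](_ : 0 = 0 * 0 :> R); last by rewrite mul0r.
    by apply: cvgM; exact: dcv.
  - move=> j y _ /=; rewrite lee_fin ger0_norm; last first.
      by rewrite mulr_ge0// sqr_ge0.
    rewrite mulrA ler_wpM2r//.
    rewrite (_ : 4 * h y ^+ 2 = (2 * h y) ^+ 2); last by ring.
    rewrite -(real_normK (num_real (u j y - f y))) lerXn2r//.
    by rewrite nnegrE mulr_ge0.
have c2 : (\int[mu]_(y in Bn n) `|u k y - f y|%:E @[k --> \oo] -->
    \int[mu]_(y in Bn n) (cst 0 y))%E.
  apply: (@dominated_cvg _ _ _ mu _ (mBn n)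
    (fun k y => (`|u k y - f y|)%:E) _ (EFin \o (fun y => 2 * h y))) => //.
  - move=> j; apply/measurable_EFinP; apply: measurable_funTS.
    exact: measurableT_comp.
  - move=> y _; apply: cvg_EFin; first exact: nearW.
    by rewrite -(normr0 R); apply: cvg_norm; exact: dcv.
  - exact: integrableZ_EFin.
  - by move=> j y _ /=; rewrite lee_fin normr_id.
rewrite integral0 in c1; rewrite integral0 in c2.
apply/cvgrPdist_le => e e0; have [d d0 hde] := extension_small n e0.
move/fine_cvgP : c1 => [f1 /cvgrPdist_le/(_ _ d0) c1].
move/fine_cvgP : c2 => [f2 /cvgrPdist_le/(_ _ d0) c2].
near=> k.
have f1' : (\int[mu]_(y in Bn n) ((u k y - f y) ^+ 2 * w y)%:E)%E \is a fin_num.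
  by near: k; exact: f1.
have f2' : (\int[mu]_(y in Bn n) `|u k y - f y|%:E)%E \is a fin_num.
  by near: k; exact: f2.
rewrite distrC -(L2_on_sub (hu k) hf).2; apply: hde => //.
- rewrite -(fineK f1') lee_fin; apply: le_trans (ler_norm _) _.
  by rewrite -normrN -sub0r; near: k; exact: c1.
- rewrite (L2_on_Rintegral (hd k)).
  apply: le_trans (le_normr_Rintegral (mBn n) (L2_on_integrable (hd k)).1) _.
  rewrite /Rintegral; apply: le_trans (ler_norm _) _.
  by rewrite -normrN -sub0r; near: k; exact: c2.
Unshelve. all: by end_near.
Qed.

Lemma extension_indic_null n A : measurable A -> A `<=` Bn n -> mu A = 0%E ->
  extension \1_A = 0.
Proof.
move=> mA AB A0; apply/eqP; rewrite -normr_le0; apply/ler_addgt0Pr => e e0.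
rewrite add0r; have [d d0 hd] := extension_small n e0.
have [h1 [h2 h3]] := L2_on_indic mA AB.
apply: hd => //.
- rewrite h3 (_ : W A = 0) ?lee_fin ?ltW//.
  rewrite /Rintegral null_set_integral//.
  by apply/measurable_EFinP; exact: measurable_funTS.
- by rewrite h2 A0 normr0 ltW.
Qed.

Lemma extension_indicU n A B : measurable A -> measurable B -> A `<=` Bn n ->
  B `<=` Bn n -> A `&` B = set0 ->
  extension \1_(A `|` B) = extension \1_A + extension \1_B.
Proof.
move=> mA mB AB BB AB0.
have [h1 _] := L2_on_indic mA AB; have [h2 _] := L2_on_indic mB BB.
rewrite -[extension \1_A]mul1r -(extension_lin 1 h1 h2).
congr extension; apply/funext => y.
rewrite mul1r !indicE in_setU.
have [/set_mem Ay|_] := boolP (y \in A); last by rewrite add0r.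
have [/set_mem By|_] := boolP (y \in B); last by rewrite addr0.
by have : (A `&` B) y by []; rewrite AB0.
Qed.

Section local_charge.
Variables (n : nat) (D : set X).
Hypothesis mD : measurable D.
Hypothesis DB : D `<=` Bn n.

(** Intersecting with the bounded set [D] gives a finite charge on all measurable sets, as
    Radon-Nikodym requires; on [X] itself the extension would only be defined on bounded sets. *)
Definition local_charge (A : set X) : \bar R := (extension \1_(A `&` D))%:E.

Let DI A : A `&` D `<=` Bn n. Proof. by move=> y [_ /DB]. Qed.

Lemma local_charge0 : local_charge set0 = 0%E.
Proof.
by rewrite /local_charge set0I (extension_indic_null (n := n))// => y [].
Qed.

Lemma local_charge_null A : measurable A -> mu A = 0%E -> local_charge A = 0%E.
Proof.
move=> mA A0; rewrite /local_charge (extension_indic_null (n := n))//.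
- exact: measurableI.
- apply/eqP; rewrite eq_le measure_ge0 andbT -A0.
  by apply: le_measure; rewrite ?inE//; exact: measurableI.
Qed.

(** Finite additivity is linearity on indicators. The indicators of the partial unions converge
    pointwise and are dominated by that of the whole union, so [extension_cvg] gives the countable
    case. *)
Lemma local_charge_additive : semi_sigma_additive local_charge.
Proof.
move=> F mF tF mUF.
pose G k : set X := \big[setU/set0]_(i < k) (F i `&` D).
have mFD i : measurable (F i `&` D) by exact: measurableI.
have mG k : measurable (G k) by exact: bigsetU_measurable.
have tFD : trivIset setT (fun i => F i `&` D).
  by apply: trivIset_setIr.
have GB k : G k `<=` Bn n.
  apply: (subset_trans (@bigsetU_bigcup _ (fun i => F i `&` D) k)).
  by move=> y [i _ /DI].
have LG k : extension \1_(G k) = \sum_(0 <= i < k) extension \1_(F i `&` D).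
  elim: k => [|k ih].
    by rewrite big_geq// /G big_ord0 (extension_indic_null (n := n)).
  have dis : G k `&` (F k `&` D) = set0 by exact: bigsetU_setI0 tFD.
  rewrite big_nat_recr//= -ih -(extension_indicU (mG k) (mFD k) (GB k) (@DI _) dis).
  by rewrite /G big_ord_recr.
rewrite [X in X @ _ --> _](_ : _ = (fun k => (extension \1_(G k))%:E)); last first.
  by apply/funext => k; rewrite LG -sumEFin.
apply: cvg_EFin; first exact: nearW.
have mUD : measurable (\bigcup_n F n `&` D) by exact: measurableI.
have [hU _] := L2_on_indic mUD (@DI _).
have GU k : G k `<=` \bigcup_n F n `&` D.
  apply: (subset_trans (@bigsetU_bigcup _ (fun i => F i `&` D) k)).
  by move=> y [i _ [Fy Dy]]; split => //; exists i.
apply: (@extension_cvg n (fun k => \1_(G k)) _ \1_(\bigcup_n F n `&` D)) => //.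
- by move=> k; exact: (L2_on_indic (mG k) (GB k)).1.
- move=> k y; rewrite ger0_norm ?indicE//.
  by case: (boolP (y \in G k)) => [/set_mem/GU/mem_set ->//|_].
- by move=> y; rewrite ger0_norm ?indicE.
move=> y; have [[[i _ Fy] Dy]|nU] := pselect ((\bigcup_n F n `&` D) y).
  apply: cvg_near_cst; near=> k.
  rewrite !indicE (mem_set (_ : (\bigcup_n F n `&` D) y)); last first.
    by split => //; exists i.
  rewrite mem_set// /G -(bigcup_mkord k (fun i => F i `&` D)).
  by exists i => //=; near: k; exact: nbhs_infty_gt.
apply: cvg_near_cst; apply: nearW => k.
by rewrite !indicE (memNset nU) memNset// => /GU.
Unshelve. all: by end_near.
Qed.

Lemma local_density : exists2 f : X -> R,
  mu.-integrable setT (EFin \o f) &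
  forall A, measurable A -> extension \1_(A `&` D) = \int[mu]_(x in A) f x.
Proof.
have sf : sigma_finite setT mu.
  by exists Bn => //; rewrite -[LHS](bigcup_qball hX point ltr01).
have [f intf fE] := @radon_nikodym_real _ _ _ mu local_charge sf
  local_charge0 (fun _ _ => erefl) local_charge_additive local_charge_null.
by exists f => // A mA; rewrite /Rintegral -fE.
Qed.

End local_charge.

(** The balls [Bn] are cut into disjoint layers, each with its own density, and [g] is glued from
    these. A bounded set meets only finitely many layers, so finite additivity suffices to identify
    the extension on it. *)
Lemma density : exists g : X -> R, forall n,
  mu.-integrable (Bn n) (EFin \o g) /\
  forall A, measurable A -> A `<=` Bn n -> extension \1_A = \int[mu]_(x in A) g x.
Proof.
pose D := seqDU Bn.
have mD i : measurable (D i).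
  by apply: measurableD => //; apply: bigsetU_measurable.
have DB i : D i `<=` Bn i by exact: subDsetl.
have tD : trivIset setT D by exact: trivIset_seqDU.
have [f hf] := choice (fun i =>
  let: ex_intro2 f h1 h2 := local_density (mD i) (@DB i) in
  ex_intro (fun f => mu.-integrable setT (EFin \o f) /\
    forall A, measurable A -> extension \1_(A `&` D i) = \int[mu]_(x in A) f x) f
    (conj h1 h2)).
have cov y : exists i, D i y.
  have : (\bigcup_i Bn i) y by rewrite (bigcup_qball hX point ltr01).
  by rewrite seqDU_bigcup_eq => -[i _ Dy]; exists i.
have [idx idxP] := choice cov.
pose g y := f (idx y) y.
have gE i y : D i y -> g y = f i y.
  by move=> Dy; rewrite /g (tD (idx y) i)//; exists y.
exists g => n.
(* A point of [Bn n] lies in a layer of index at most [n], so [S n.+1] agrees with [g] on [Bn n]. *)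
pose S k y : R := \sum_(i < k) f i y * \1_(D i) y.
have Sint k : mu.-integrable setT (EFin \o S k).
  elim: k => [|k ih].
    apply: eq_integrable (integrable0 mu setT) => // y _.
    by rewrite /S/= big_ord0.
  have hk := integrable_mul_indic measurableT (mD k) (hf k).1.
  have := integrableD_EFin measurableT ih hk.
  apply: eq_integrable => // y _ /=.
  by rewrite /S big_ord_recr/= (mulrC (f k y)).
have idx_le y i : Bn n y -> D i y -> (i < n.+1)%N.
  move=> By [_ nD]; rewrite ltnS leqNgt; apply/negP => ni.
  by apply: nD; rewrite -(bigcup_mkord i Bn); exists n.
have SE y : Bn n y -> S n.+1 y = g y.
  move=> By; have [i Dy] := cov y; have iN := idx_le _ _ By Dy.
  rewrite /S (bigD1 (Ordinal iN))//= big1 ?addr0 => [|j ji].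
    by rewrite indicE mem_set// mulr1 (gE _ _ Dy).
  rewrite indicE memNset ?mulr0// => Djy.
  move/eqP: ji; apply; apply: val_inj => /=.
  by apply: tD => //; exists y.
have igB : mu.-integrable (Bn n) (EFin \o g).
  apply: (@eq_integrable _ _ _ _ _ (mBn n) (EFin \o S n.+1)).
    by move=> y; rewrite inE => By /=; rewrite SE.
  exact: integrableS (Sint _).
split => // A mA AB.
have -> : \int[mu]_(x in A) g x = \int[mu]_(x in A) S n.+1 x.
  by apply: eq_Rintegral => y; rewrite inE => /AB By; rewrite SE.
have LS k : extension \1_(A `&` \big[setU/set0]_(i < k) D i) =
    \int[mu]_(x in A) S k x.
  elim: k => [|k ih].
    rewrite big_ord0 setI0 (extension_indic_null (n := n))//.
    rewrite (_ : \int[mu]_(x in A) S 0 x = \int[mu]_(x in A) (cst 0 x)).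
      by rewrite Rintegral_cst// mul0r.
    by apply: eq_Rintegral => y _; rewrite /S big_ord0.
  rewrite big_ord_recr/= setIUr (extension_indicU (n := n)).
  - rewrite ih (_ : \int[mu]_(x in A) S k.+1 x =
      \int[mu]_(x in A) (S k x + f k x * \1_(D k) x)); last first.
      by apply: eq_Rintegral => y _; rewrite /S big_ord_recr.
    have hk : mu.-integrable A (EFin \o (fun x => f k x * \1_(D k) x)).
      have := integrable_mul_indic mA (mD k)
        (integrableS measurableT mA (@subsetT _ _) (hf k).1).
      apply: eq_integrable => // y _ /=.
      by rewrite mulrC.
    rewrite RintegralD//; last exact: integrableS (Sint k).
    congr (_ + _).
    have -> : A `&` D k = (A `&` D k) `&` D k by rewrite -setIA setIid.
    rewrite (hf k).2; last exact: measurableI.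
    rewrite Rintegral_mkcondr; apply: eq_Rintegral => y _.
    by rewrite patchE indicE; case: ifP; rewrite ?mulr1 ?mulr0.
  - by apply: measurableI => //; exact: bigsetU_measurable.
  - exact: measurableI.
  - by move=> y [/AB].
  - by move=> y [/AB].
  - by rewrite setIACA bigsetU_setI0// setI0.
rewrite -LS; congr (extension \1__); apply/esym/setIidl => y /AB By.
have [i Dy] := cov y; rewrite -(bigcup_mkord n.+1 D); exists i => //=.
exact: idx_le Dy.
Qed.

End representation.

(** * The density belongs to BMO_w *)

Section bmo_representative.
Context (R : realType) (disp : measure_display) (X : measurableType disp)
  (rho : X -> X -> R) (mu : {measure set X -> \bar R}) (w : X -> R).
Hypothesis hX : homogeneous_type rho mu.
Hypothesis hw : A2_weight rho mu w.
Variable l : (BMO rho mu w -> R) -> R.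
Hypothesis hl : H1_dual l.

Local Notation W D := (\int[mu]_(y in D) w y).
Local Notation atf := (@atom_fun R disp X rho mu w).

Let Bn (n : nat) : set X := qball rho point (2 ^+ n * 1).
Let pow0 n : 0 < 2 ^+ n * 1 :> R.
Proof. by rewrite mulr_gt0// exprn_gt0. Qed.
Let mBn n : measurable (Bn n). Proof. exact: measurable_qball hX _ _ (pow0 n). Qed.
Let M := fine (dual_norm l).
Let ME : dual_norm l = M%:E.
Proof.
by rewrite fineK// ge0_fin_numE ?(dual_norm_ge0 hX hw hl)//; case: hl.
Qed.

Lemma qball_sub_exhaustion x r : 0 < r -> exists n, qball rho x r `<=` Bn n.
Proof.
move=> r0; have [A A1 hA] := quasi_metric_const hX.
have A0 : 0 < A by exact: lt_le_trans A1.
have h := @qball_sub_scale _ _ _ _ _ hX A x point r (rho x point) hA A0 (lexx _).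
pose t := A * (rho x point + r).
have t0 : 0 <= t by rewrite mulr_ge0 ?addr_ge0 ?(rho_ge0 hX)// ltW.
exists (Num.truncn t).+1; apply: (subset_trans h); apply: qball_le.
rewrite mulr1; apply: (@le_trans _ _ (Num.truncn t).+1%:R).
  exact/ltW/truncnS_gt.
by rewrite -natrX ler_nat ltnW// ltn_expl.
Qed.

(** A function of integral zero needs no correction; hence [extension l] does extend [l] from
    multiples of atoms. *)
Lemma recentre_id n f : cancelling rho mu w n f -> recentre rho mu f = f.
Proof.
move=> [mf sf f0 _]; apply/funext => y; rewrite /recentre.
rewrite (supported_Rintegral mu sf (mBn n)) /Rintegral [X in fine X]f0.
by rewrite mul0r mul0r subr0.
Qed.

Lemma test_fun_cancelling n h x (r : R) : loc_integrable rho mu h -> 0 < r ->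
  qball rho x r `<=` Bn n -> cancelling rho mu w n (test_fun rho mu h x r).
Proof.
move=> hh r0 BB; have mB := measurable_qball hX x r0.
have st y : test_fun rho mu h x r y != 0 -> qball rho x r y.
  exact: test_fun_support.
have ste y : (test_fun rho mu h x r y)%:E != 0%E -> qball rho x r y.
  by move=> e0; apply: st; apply: contra_neq e0 => ->.
have mt := measurable_test_fun hX x hh r0.
split => //.
- by move=> y /st/BB.
- rewrite -(supported_integral mu (fun y h => BB _ (ste y h)) (mBn n)).
  rewrite (supported_integral mu ste mB).
  exact: (test_fun_eintegral hX x hh r0).
- apply: (@le_lt_trans _ _ (\int[mu]_(y in Bn n) (4 * w y)%:E)%E).
    apply: le_ge0_integral; [exact: mBn|idtac|idtac|idtac|idtac].
    + apply: measurable_funM; last exact: measurable_weight hX hw.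
      exact: measurable_funX.
    + exact: measurable_funM (measurable_cst _) (measurable_weight hX hw).
    + by move=> y; rewrite mulr_ge0 ?sqr_ge0// (weight_ge0 hw).
    + move=> y _; rewrite ler_wpM2r ?(weight_ge0 hw)//.
      rewrite -(real_normK (num_real _)) (_ : 4 = 2 ^+ 2); last by ring.
      by rewrite lerXn2r ?nnegrE//; exact: (test_fun_le2 hX x hh r0).
  have := integrableZ_EFin 4 (mBn n) (weight_integrable hw _ (pow0 n)).
  by move=> /integrable_lty; apply.
Qed.

Lemma Rintegral_mul_indic (A B : set X) (g : X -> R) : A `<=` B ->
  \int[mu]_(y in B) (\1_A y * g y) = \int[mu]_(y in A) g y.
Proof.
move=> AB; rewrite -{2}(setIidr AB) Rintegral_mkcondr; apply: eq_Rintegral => y _.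
by rewrite patchE indicE; case: ifP; rewrite ?mul1r ?mul0r.
Qed.

(** The test function is a combination of three indicators, so knowing the extension on indicators
    is enough. The oscillation of [g] is thus reached before [g] is known to be in BMO_w or to
    represent [l] on atoms. *)
Lemma represented_osc g : loc_integrable rho mu g ->
  (forall n A, measurable A -> A `<=` Bn n ->
    extension l \1_A = \int[mu]_(x in A) g x) ->
  forall x (r : R), 0 < r -> l (atf (test_fun rho mu g x r)) =
    \int[mu]_(y in qball rho x r) `|g y - ball_avg rho mu g x r|.
Proof.
move=> hg Lg x r r0; have [n BB] := qball_sub_exhaustion x r0.
have ct := test_fun_cancelling hg r0 BB.
rewrite -(test_fun_osc hX x hg r0) -[in LHS](recentre_id ct) -/(extension l _).
set B := qball rho x r in BB *.
set P := above rho mu g x r; set N := below rho mu g x r.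
set k := imbalance rho mu g x r.
have mB : measurable B := measurable_qball hX x r0.
have mP : measurable P by exact: (measurable_above hX x hg r0).
have mN : measurable N by exact: (measurable_below hX x hg r0).
have PB : P `<=` B by move=> y [].
have NB : N `<=` B by move=> y [].
have BBn : B `<=` Bn n by [].
have [hP _] := L2_on_indic hX hw mP (subset_trans PB BBn).
have [hN _] := L2_on_indic hX hw mN (subset_trans NB BBn).
have [hB _] := L2_on_indic hX hw mB BBn.
have [hPN LPN] := L2_on_sub hX hw hl hP hN.
have tE y : test_fun rho mu g x r y = (- k) * \1_B y + (\1_P y - \1_N y).
  by rewrite /test_fun -/P -/N -/k mulNr addrC.
rewrite (_ : test_fun rho mu g x r = fun y => (- k) * \1_B y + (\1_P y - \1_N y));
  last by apply/funext.
rewrite (extension_lin hX hw hl (- k) hB hPN) LPN.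
rewrite (Lg n _ mB BBn) (Lg n _ mP (subset_trans PB BBn)).
rewrite (Lg n _ mN (subset_trans NB BBn)).
have ig : mu.-integrable B (EFin \o g) by apply: hg; exists x, r.
have iA (A : set X) : measurable A ->
    mu.-integrable B (EFin \o (fun y => \1_A y * g y)).
  by move=> mA; exact: integrable_mul_indic.
rewrite -[in LHS](Rintegral_mul_indic g (@subset_refl _ B)).
rewrite -(Rintegral_mul_indic g PB) -(Rintegral_mul_indic g NB).
rewrite -RintegralZl//; last exact: iA.
rewrite -RintegralB//; [|exact: iA|exact: iA].
rewrite -RintegralD//; last 2 first.
- exact: integrableZ_EFin (iA _ mB).
- exact: integrableB_EFin (iA _ mP) (iA _ mN).
by apply: eq_Rintegral => y _; rewrite mulrDl mulrBl mulrA.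
Qed.

(** The test function is [2 * W] times an atom, so its image, which is the oscillation of [g], is at
    most [2 * W] times the dual norm. *)
Lemma bmo_density : exists2 g, BMO rho mu w g & forall n A,
  measurable A -> A `<=` Bn n -> extension l \1_A = \int[mu]_(x in A) g x.
Proof.
have [g hg] := density hX hw hl; exists g; last by move=> n; exact: (hg n).2.
have lg : loc_integrable rho mu g.
  move=> _ [x [r [r0 ->]]]; have [n BB] := qball_sub_exhaustion x r0.
  exact (integrableS (mBn n) (measurable_qball hX x r0) BB (hg n).1).
split => //; apply: (@le_lt_trans _ _ (2 * M)%:E); last by rewrite ltry.
apply/(bmo_normP hX hw _ lg) => x r r0.
rewrite -(represented_osc lg (fun n => (hg n).2) x r0).
have ta := test_atom hX hw x lg r0.
have W20 : 0 < 2 * W (qball rho x r) by rewrite mulr_gt0// (weight_ball_gt0 hX hw).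
have [h1 h2] := atomic_decomposition_single (2 * W (qball rho x r)) ta.
rewrite -(atom_funZ hX hw _ ta) in h1.
rewrite (_ : (fun y => _ * (_ * _)) = test_fun rho mu g x r) in h1; last first.
  by apply/funext => y; rewrite mulrA divff ?mul1r// gt_eqF.
have := H1_dual_le hX hw hl h1; rewrite h2 ME -EFinM lee_fin (gtr0_norm W20).
move=> h; apply: le_trans (le_trans (ler_norm _) h) _.
by rewrite le_eqVlt; apply/orP; left; apply/eqP; ring.
Qed.

Lemma L2_on_le n (f h : X -> R) : L2_on rho mu w n h -> measurable_fun setT f ->
  (forall y, `|f y| <= `|h y|) -> L2_on rho mu w n f.
Proof.
move=> [mh sh hoo] mf fh; split => //.
- move=> y fy; apply: sh; apply: contra_neq fy => hy.
  by apply/eqP; rewrite -normr_le0; have := fh y; rewrite hy normr0.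
- apply: le_lt_trans hoo; apply: le_ge0_integral.
  + exact: mBn.
  + exact: measurable_funM (measurable_funX 2 mf) (measurable_weight hX hw).
  + exact: measurable_funM (measurable_funX 2 mh) (measurable_weight hX hw).
  + by move=> y; rewrite mulr_ge0 ?sqr_ge0// (weight_ge0 hw).
  + move=> y _; rewrite ler_wpM2r ?(weight_ge0 hw)//.
    rewrite -(real_normK (num_real (f y))) -(real_normK (num_real (h y))).
    by rewrite lerXn2r ?nnegrE.
Qed.

Section annihilated.
Hypothesis extension_indic : forall n A, measurable A -> A `<=` Bn n ->
  extension l \1_A = 0.

Lemma extension_nnsfun n (f : {nnsfun X >-> R}) : (forall y, f y != 0 -> Bn n y) ->
  L2_on rho mu w n f /\ extension l f = 0.
Proof.
move=> sf; suff H (s : seq R) :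
    L2_on rho mu w n (fun y => \sum_(c <- s) c * \1_(f @^-1` [set c]) y) /\
    extension l (fun y => \sum_(c <- s) c * \1_(f @^-1` [set c]) y) = 0.
  have -> : (f : X -> R) = (fun y => \sum_(c <- finmap.enum_fset (fset_set (range f)))
      c * \1_(f @^-1` [set c]) y).
    by apply/funext => y; rewrite [LHS]fimfunE fsbig_finite.
  exact: H.
elim: s => [|c s [ih1 ih2]].
  rewrite (_ : (fun _ => _) = fun=> 0); last by apply/funext => y; rewrite big_nil.
  by split; [exact: L2_on0|exact: extension0].
rewrite (_ : (fun _ => _) = fun y => c * \1_(f @^-1` [set c]) y +
    \sum_(c <- s) c * \1_(f @^-1` [set c]) y); last first.
  by apply/funext => y; rewrite big_cons.
have [->|c0] := eqVneq c 0.
  rewrite (_ : (fun _ => _) = fun y => \sum_(c <- s) c * \1_(f @^-1` [set c]) y)//.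
  by apply/funext => y; rewrite mul0r add0r.
have mA : measurable (f @^-1` [set c]) by exact: measurable_sfunP.
have AB : f @^-1` [set c] `<=` Bn n by move=> y /= fy; apply: sf; rewrite fy.
have [hA _] := L2_on_indic hX hw mA AB.
split; first exact: (L2_on_lin hX hw c hA ih1).
by rewrite (extension_lin hX hw hl c hA ih1) ih2 (extension_indic mA AB) mulr0 addr0.
Qed.

(** Increasing simple approximations stay below [f], so they vanish outside [Bn n] and are dominated
    by [f] itself in [extension_cvg]. *)
Lemma extension_ge0_eq0 n (f : X -> R) : L2_on rho mu w n f ->
  (forall y, 0 <= f y) -> extension l f = 0.
Proof.
move=> hf f0; have [mf sf _] := hf.
have mEf : measurable_fun setT (EFin \o f) by apply/measurable_EFinP.
have [g [g_nd gf]] := approximation measurableT mEf (fun y _ => f0 y).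
have gcv y : g k y @[k --> \oo] --> f y by have /fine_cvgP[] := gf y I.
have gle k y : g k y <= f y.
  rewrite -(cvg_lim _ (gcv y))//; apply: nondecreasing_cvgn_le.
    by move=> i j ij; have /lefP := g_nd i j ij; apply.
  by apply/cvg_ex; exists (f y).
have sg k y : g k y != 0 -> Bn n y.
  move=> gy; apply: sf; apply: contra_neq gy => fy.
  by apply/eqP; rewrite eq_le -{1}fy gle fun_ge0.
have H k := extension_nnsfun (sg k).
have h := @extension_cvg _ _ _ _ _ _ hX hw _ hl n (fun k => g k) f f
  (fun k => (H k).1) hf hf.
have {}h : extension l (g k) @[k --> \oo] --> extension l f.
  apply: h => //.
  - by move=> k y; rewrite ger0_norm ?fun_ge0.
  - by move=> y; rewrite ger0_norm.
rewrite -(cvg_lim (@Rhausdorff R) h) (_ : (fun k => _) = fun=> 0) ?lim_cst//.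
by apply/funext => k; rewrite (H k).2.
Qed.

Lemma extension_eq0 n f : L2_on rho mu w n f -> extension l f = 0.
Proof.
move=> hf; have [mf _ _] := hf.
pose p y := Num.max (f y) 0; pose q y := Num.max (- f y) 0.
have mp : measurable_fun setT p by exact: measurable_maxr.
have mq : measurable_fun setT q by apply: measurable_maxr => //; exact: measurableT_comp.
have pq y : f y = p y - q y.
  rewrite /p /q; have /orP[h|h] := le_total 0 (f y).
    by rewrite (max_l h) max_r ?oppr_le0// subr0.
  by rewrite (max_r h) max_l ?oppr_ge0// sub0r opprK.
have hp : L2_on rho mu w n p.
  apply: (L2_on_le hf) => // y; rewrite /p ger0_norm ?le_max ?lexx ?orbT//.
  by rewrite ge_max ler_norm normr_ge0.
have hq : L2_on rho mu w n q.
  apply: (L2_on_le hf) => // y; rewrite /q ger0_norm ?le_max ?lexx ?orbT//.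
  by rewrite ge_max -normrN ler_norm normr_ge0.
rewrite (_ : f = fun y => p y - q y); last by apply/funext.
rewrite (L2_on_sub hX hw hl hp hq).2 (extension_ge0_eq0 hp).
  by rewrite (extension_ge0_eq0 hq) ?subrr// => y; rewrite le_max lexx orbT.
by move=> y; rewrite le_max lexx orbT.
Qed.

Lemma atoms_eq0 a : atom rho mu w a -> l (atf a) = 0.
Proof.
move=> /(atomP hX hw)[x [r [r0 [ma sa a0 aL]]]].
have [n BB] := qball_sub_exhaustion x r0.
have mB := measurable_qball hX x r0.
have sBn y : a y != 0 -> Bn n y by move=> /sa/BB.
have I (f : X -> R) : (forall y, f y != 0 -> qball rho x r y) ->
    (\int[mu]_(y in Bn n) (f y)%:E = \int[mu]_(y in qball rho x r) (f y)%:E)%E.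
  move=> sf; have sfe y : (f y)%:E != 0%E -> qball rho x r y.
    by move=> e0; apply: sf; apply: contra_neq e0 => ->.
  rewrite -(supported_integral mu (fun y h => BB _ (sfe y h)) (mBn n)).
  by rewrite (supported_integral mu sfe mB).
have aoo : (\int[mu]_(y in Bn n) (a y ^+ 2 * w y)%:E < +oo)%E.
  rewrite I; first by apply: le_lt_trans aL _; rewrite ltry.
  move=> y; rewrite mulf_eq0 negb_or => /andP[ay _].
  by apply: sa; apply: contra_neq ay => ->; rewrite expr0n.
have ca : cancelling rho mu w n a by split => //; rewrite I.
by rewrite -(recentre_id ca) -/(extension l a) (@extension_eq0 n).
Qed.

End annihilated.

End bmo_representative.

(** * Duality *)

Section duality.
Context (R : realType) (disp : measure_display) (X : measurableType disp)
  (rho : X -> X -> R) (mu : {measure set X -> \bar R}) (w : X -> R).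
Hypothesis hX : homogeneous_type rho mu.
Hypothesis hw : A2_weight rho mu w.

Local Notation m D := (fine (mu D)).
Local Notation W D := (\int[mu]_(y in D) w y).
Local Notation atf := (@atom_fun R disp X rho mu w).

Implicit Type l : (BMO rho mu w -> R) -> R.

Let Bn (n : nat) : set X := qball rho point (2 ^+ n * 1).
Let pow0 n : 0 < 2 ^+ n * 1 :> R.
Proof. by rewrite mulr_gt0// exprn_gt0. Qed.
Let mBn n : measurable (Bn n). Proof. exact: measurable_qball hX _ _ (pow0 n). Qed.
Let m0 : 0 < m (Bn 0). Proof. exact: fine_qball_gt0 hX _ _ (pow0 0%N). Qed.

(** A norm at most 1 is an infimum that need not be attained, but it provides a decomposition of
    total mass below 2; this is the factor 2. Convergence on series is a premise because, for
    evaluation functionals, it is available before they are known to be bounded. *)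
Lemma dual_norm_le l (K : R) : 0 <= K ->
  (forall F lam a, atomic_decomposition F lam a ->
    \sum_(0 <= j < n) lam j * l (atf (a j)) @[n --> \oo] --> l F) ->
  (forall a, atom rho mu w a -> `|l (atf a)| <= K) ->
  (dual_norm l <= (2 * K)%:E)%E.
Proof.
move=> K0 lser lK; apply: ge_ereal_sup => _ [F [_ nF] <-].
have nF2 : (H1_norm F < 2%:E)%E.
  by apply: le_lt_trans nF _; rewrite lte_fin ltr1n.
have [_ [lam [a [dF ->]]] s2] := ereal_inf_lt nF2.
have [ha lamoo _] := dF.
have := decomposition_le K0 lamoo (fun j => lK _ (ha j)) (lser _ _ _ dF).
move=> /le_trans; apply; rewrite mulrC EFinM; apply: lee_wpmul2l.
  by rewrite lee_fin.
exact: ltW.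
Qed.

Lemma dual_norm_represents : exists2 C : R, 0 < C &
  forall g N l, loc_integrable rho mu g -> 0 < N -> (bmo_norm rho mu w g <= N%:E)%E ->
  H1_dual l -> represents g l -> (dual_norm l <= (C * N)%:E)%E.
Proof.
have [C C0 hC] := atom_pairing_le hX hw; exists (2 * C).
  by rewrite mulr_gt0.
move=> g N l hg N0 gN hl rl; rewrite -mulrA; apply: dual_norm_le.
- by rewrite mulr_ge0// ltW.
- by move=> F lam a dF; exact: H1_dual_series hX hw _ _ _ _ hl dF.
- by move=> a ha; rewrite (rl a ha).2; exact: (hC g a N hg N0 gN ha).2.
Qed.

Definition BMO_elt g (hg : BMO rho mu w g) : BMO rho mu w := SigSub (mem_set hg).

(** Evaluation at [g] is linear on functions on BMO_w, and on an atomic series it converges by the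
    very definition of a decomposition; the bound comes from atoms. *)
Lemma eval_dual g (hg : BMO rho mu w g) :
  H1_dual (fun F : BMO rho mu w -> R => F (BMO_elt hg)).
Proof.
split => //; have [C C0 hC] := atom_pairing_le hX hw.
have [N N0 gN] := bigger_bmo_norm hw hg.
apply: (@le_lt_trans _ _ (2 * (C * N))%:E); last by rewrite ltry.
apply: dual_norm_le.
- by rewrite mulr_ge0// ltW.
- by move=> F lam a [_ _]; apply.
- by move=> a ha; exact: (hC g a N hg.1 N0 gN ha).2.
Qed.

Lemma eval_represents g (hg : BMO rho mu w g) :
  represents g (fun F : BMO rho mu w -> R => F (BMO_elt hg)).
Proof. by move=> a ha; split; first exact: (atom_integrable hX hw hg ha). Qed.

Lemma H1_dualB l1 l2 : H1_dual l1 -> H1_dual l2 ->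
  H1_dual (fun F => l1 F - l2 F).
Proof.
move=> [h1 b1] [h2 b2]; split.
  by move=> c F G hF hG; rewrite h1// h2//; ring.
apply: le_lt_trans (lte_add_pinfty b1 b2); apply: ge_ereal_sup => _ [F hF <-].
apply: (@le_trans _ _ (`|l1 F|%:E + `|l2 F|%:E)%E).
  by rewrite -EFinD lee_fin ler_normB.
by apply: leeD; apply: ereal_sup_ubound; exists F.
Qed.

(** The functional [l] minus evaluation at its density kills all recentred indicators, hence all
    atoms. *)
Lemma dual_represented l : H1_dual l ->
  exists2 g, BMO rho mu w g & represents g l.
Proof.
move=> hl; have [g hg Lg] := bmo_density hX hw hl; exists g => // a ha.
split; first exact: (atom_integrable hX hw hg ha).
have B0n n : Bn 0 `<=` Bn n.
  by apply: qball_le; rewrite !mulr1 ler_weXn2l// ler1n.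
have R0 : recentre rho mu \1_(Bn 0) = fun=> 0.
  have [_ [h1 _]] := L2_on_indic hX hw (mBn 0) (@subset_refl _ _).
  by apply/funext => y; rewrite /recentre h1 divff ?gt_eqF// mul1r subrr.
(* The indicator of [Bn 0] recentres to 0, so its extension is 0. This makes the correction term
   invisible to [g], and the pairing of a recentred indicator with [g] is the plain integral of [g]
   over the set. *)
have g0 : \int[mu]_(y in Bn 0) g y = 0.
  rewrite -(Lg 0%N _ (mBn 0) (@subset_refl _ _)) -(extension0 hX hw hl) /extension R0.
  congr (l (atf _)); apply/funext => y; rewrite /recentre.
  by rewrite Rintegral_cst// mul0r mul0r mul0r subrr.
have := atoms_eq0 hX hw (H1_dualB hl (eval_dual hg)) _ ha.
move=> /(_ _)/eqP; rewrite subr_eq0 => h; apply/eqP; apply: h => n A mA AB.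
rewrite /extension -/(extension l _) (Lg n A mA AB).
apply/eqP; rewrite subr_eq0; apply/eqP.
rewrite /BMO_elt /atom_fun /pairing /=.
have ig : mu.-integrable (Bn n) (EFin \o g).
  by apply: hg.1; exists point, (2 ^+ n * 1).
have iA (D : set X) : measurable D ->
    mu.-integrable (Bn n) (EFin \o (fun y => \1_D y * g y)).
  by move=> mD; exact: integrable_mul_indic.
set k := \int[mu]_x \1_A x / m (Bn 0).
have sA y : recentre rho mu \1_A y * g y != 0 -> Bn n y.
  apply: contraNP => nB; rewrite /recentre !indicE (memNset (_ : ~ A y)).
    by rewrite (memNset (_ : ~ Bn 0 y)) ?mulr0 ?subr0 ?mul0r// => /B0n.
  by move=> /AB.
rewrite (supported_Rintegral mu sA (mBn n)).
rewrite (_ : \int[mu]_(y in Bn n) _ = \int[mu]_(y in Bn n)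
    (\1_A y * g y - k * (\1_(Bn 0) y * g y))); last first.
  by apply: eq_Rintegral => y _; rewrite /recentre -/k; ring.
rewrite RintegralB//; [|exact: iA|by apply: integrableZ_EFin => //; exact: iA].
rewrite RintegralZl//; last exact: iA.
by rewrite !Rintegral_mul_indic// g0 mulr0 subr0.
Qed.

(** Both functionals are determined by their values on atoms through [H1_dual_series]. *)
Lemma represented_unique l1 l2 g F : H1_dual l1 -> H1_dual l2 ->
  represents g l1 -> represents g l2 -> H1 F -> l1 F = l2 F.
Proof.
move=> h1 h2 r1 r2 [lam [a dF]]; have [ha _ _] := dF.
have c1 := H1_dual_series hX hw h1 dF.
have c2 := H1_dual_series hX hw h2 dF.
have E : (fun n => \sum_(0 <= j < n) lam j * l1 (atf (a j))) =
    (fun n => \sum_(0 <= j < n) lam j * l2 (atf (a j))).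
  apply/funext => n; apply: eq_bigr => j _.
  by rewrite (r1 _ (ha j)).2 (r2 _ (ha j)).2.
by rewrite -(cvg_lim (@Rhausdorff R) c1) -(cvg_lim (@Rhausdorff R) c2) E.
Qed.

(** The difference of two representatives annihilates every atom, so [annihilated_const] applies to
    it. *)
Lemma representative_unique l g1 g2 : BMO rho mu w g1 -> BMO rho mu w g2 ->
  represents g1 l -> represents g2 l ->
  exists k, {ae mu, forall x, g1 x = g2 x + k}.
Proof.
move=> h1 h2 r1 r2.
have mball B : Defs.is_ball rho B -> measurable B by exact: balls_measurable hX B.
have lh : loc_integrable rho mu (fun y => g1 y - g2 y).
  move=> B hB; exact (integrableB_EFin (mball B hB) (h1.1 B hB) (h2.1 B hB)).
have [a ha|k hk] := annihilated_const hX hw lh.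
  have [i1 e1] := r1 a ha; have [i2 e2] := r2 a ha.
  transitivity (pairing mu a g1 - pairing mu a g2); last by rewrite -e1 -e2 subrr.
  rewrite /pairing -RintegralB//; apply: eq_Rintegral => y _.
  by rewrite mulrBr.
exists k; apply: filterS hk => y /eqP; rewrite subr_eq => /eqP ->.
by rewrite addrC.
Qed.

(** The oscillation over a ball is [2 * W] times the pairing with the test atom, and [l] is bounded
    on atoms by its dual norm; the 2 is the sup bound of the test function. *)
Lemma bmo_norm_represents l g : BMO rho mu w g -> H1_dual l ->
  represents g l -> (bmo_norm rho mu w g <= 2%:E * dual_norm l)%E.
Proof.
move=> [hg _] hl rl; have d0 := dual_norm_ge0 hX hw hl.
have dE : dual_norm l = (fine (dual_norm l))%:E.
  by rewrite fineK// ge0_fin_numE//; case: hl.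
rewrite dE -EFinM; apply/(bmo_normP hX hw _ hg) => x r r0.
have ta := test_atom hX hw x hg r0.
rewrite (test_pairing hX hw x hg r0) -(rl _ ta).2.
have W20 : 0 < 2 * W (qball rho x r) by rewrite mulr_gt0// (weight_ball_gt0 hX hw).
have [h1 h2] := atomic_decomposition_single 1 ta.
have := H1_dual_le hX hw hl h1.
rewrite h2 scale1r normr1 mule1 dE lee_fin => h.
rewrite -[leRHS]mulrA [leRHS]mulrCA [leRHS]mulrC.
by rewrite ler_pM2l// (le_trans (ler_norm _)).
Qed.

End duality.

Theorem theorem6p6 (R : realType) (disp : measure_display)
    (X : measurableType disp) (rho : X -> X -> R)
    (mu : {measure set X -> \bar R}) (w : X -> R)
    (hX : homogeneous_type rho mu)
    (hinf : mu [set: X] = +oo%E)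
    (hpt : forall x0 : X, mu [set x0] = 0%E)
    (hw : A2_weight rho mu w) :
  [/\ (forall g, BMO rho mu w g ->
         exists2 l, H1_dual (rho := rho) (mu := mu) (w := w) l & represents g l),
      (forall l, H1_dual (rho := rho) (mu := mu) (w := w) l ->
         exists2 g, BMO rho mu w g & represents g l),
      (forall g (l1 l2 : (BMO rho mu w -> R) -> R), BMO rho mu w g ->
         H1_dual l1 -> H1_dual l2 -> represents g l1 -> represents g l2 ->
         forall F, H1 F -> l1 F = l2 F),
      (forall g1 g2 (l : (BMO rho mu w -> R) -> R),
         BMO rho mu w g1 -> BMO rho mu w g2 ->
         H1_dual l -> represents g1 l -> represents g2 l ->
         exists k : R, {ae mu, forall x, g1 x = g2 x + k}) &
      exists c1 c2 : R, [/\ 0 < c1, 0 < c2 &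
        forall g (l : (BMO rho mu w -> R) -> R),
          BMO rho mu w g -> H1_dual l -> represents g l ->
          (c1%:E * bmo_norm rho mu w g <= dual_norm l)%E /\
          (dual_norm l <= c2%:E * bmo_norm rho mu w g)%E]].
Proof.
split.
- by move=> g hg; eexists; [exact: (eval_dual hX hw hg)|exact: eval_represents].
- by move=> l hl; exact: dual_represented.
- by move=> g l1 l2 _ h1 h2 r1 r2 F; exact: (represented_unique hX hw h1 h2 r1 r2).
- move=> g1 g2 l h1 h2 _ r1 r2.
  exact: (representative_unique hX hw h1 h2 r1 r2).
have [C C0 hC] := dual_norm_represents hX hw.
exists 2^-1, C; split; [by rewrite invr_gt0|by []|move=> g l hg hl rl].
split.
  have h := bmo_norm_represents hX hw hg hl rl.
  by rewrite lee_pdivrMl.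
have g0 := bmo_norm_ge0 hw hg.1.
have gE : bmo_norm rho mu w g = (fine (bmo_norm rho mu w g))%:E.
  by rewrite fineK// ge0_fin_numE//; case: hg.
(* The upper bound asks for a positive [N], while the norm of [g] is zero for constants, so the norm
   is enlarged by [e / C] and [e] is arbitrary. *)
apply/lee_addgt0Pr => e e0; rewrite gE -EFinM -EFinD.
have eC : 0 < e / C by rewrite divr_gt0.
apply: le_trans (hC g (fine (bmo_norm rho mu w g) + e / C) l hg.1 _ _ hl rl) _.
- by rewrite ltr_wpDl// fine_ge0.
- by rewrite gE /= lee_fin lerDl ltW.
- by rewrite lee_fin mulrDr mulrCA divff ?mulr1// gt_eqF.
Qed.
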